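(* Let $r=\{r(t)\}_{t\ge0}$ be the one dimensional centered Gaussian process with covariance $\mathbb E(r(t)r(t'))=\sqrt{t+t'}-\sqrt{t-t'}$ for $t\ge t'\ge0$. Then $r$ is a continuous process (it has a modification with continuous paths) and it is self-similar of order $\frac14$, i.e. for every $a>0$, $\{r(at)\}_{t\ge0}$ and $\{a^{1/4}r(t)\}_{t\ge0}$ have the same law. Moreover, it admits the following three representations (equalities in law of processes indexed by $t\ge0$): (1) $\{r(t)\}_{t\ge 0}\overset{\rm law}{=}\{2\,\nu_O^{(\frac14)}(t)\}_{t\ge 0}$, where $\nu^{(H)}$ is the two sided fractional Brownian motion with Hurst parameter $H$ and $\nu^{(H)}_O$ is its odd part; (2) $\{r(t)\}_{t\ge 0}\overset{\rm law}{=}\{(2\pi)^{\frac14}h(0,t)\}_{t\ge 0}$, where $h(x,t)$ is the solution to the heat equation $\partial_th=\frac12\partial_x^2h+\dot W$ on $\mathbb R$ with additive space-time white noise $\dot W$ and initial condition $h(x,0)=0$; (3) $\{r(t)\}_{t\ge 0}\overset{\rm law}{=}\Big\{c\displaystyle\int_0^t\frac{s^{\frac14}}{(t^2-s^2)^{\frac14}}\,db(s)\Big\}_{t\ge 0}$, where $b$ is a standard Brownian motion and $c=\big(\frac12B(\frac34,\frac34)\big)^{-\frac12}$, with $B(\cdot,\cdot)$ the Euler beta function.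
   Context: The two sided fractional Brownian motion with Hurst parameter $H$ is the centered Gaussian process $\nu^{(H)}(t)$, $t\in\mathbb R$, with covariance $\mathbb E(\nu^{(H)}(t)\nu^{(H)}(s))=\frac12(|t|^{2H}+|s|^{2H}-|t-s|^{2H})$; its odd part is $\nu_O^{(H)}(t)=\frac12(\nu^{(H)}(t)-\nu^{(H)}(-t))$. The solution of the stochastic heat equation is the mild one, $h(x,t)=\int_0^t\int\frac{1}{\sqrt{2\pi(t-s)}}\mathrm e^{-\frac{(x-y)^2}{2(t-s)}}\,dW_{y,s}$. *)

(* Defs.v *)
From HB Require Import structures.
From mathcomp Require Import all_boot all_order all_algebra.
From mathcomp Require Import all_classical all_reals all_analysis.
Set Implicit Arguments.
Unset Strict Implicit.
Unset Printing Implicit Defensive.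
Import Order.TTheory GRing.Theory Num.Theory.
Import numFieldNormedType.Exports.
Local Open Scope classical_set_scope.
Local Open Scope ring_scope.

(* Processes are families [X : I -> T -> R] of which only the indices in a set
   [D : set I] matter. *)

Section gaussian_processes.
Context {d : measure_display} {T : measurableType d} {R : realType}.
Variable P : probability T R.

(* [normal_prob m 0] is a junk value (uniform on [0, 1]), hence the separate
   treatment of the degenerate case. *)
Definition gaussian_law (m s : R) (B : set R) : \bar R :=
  if s == 0 then \d_m B else normal_prob m s B.

Definition gaussian_rv (X : T -> R) : Prop :=
  measurable_fun setT X /\
  exists m s : R, 0 <= s /\
    forall B : set R, measurable B -> pushforward P X B = gaussian_law m s B.

Definition gaussian_process {I : Type} (D : set I) (X : I -> T -> R) : Prop :=
  forall (n : nat) (i : 'I_n -> I) (c : 'I_n -> R),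
    (forall k, D (i k)) -> gaussian_rv (fun w => \sum_(k < n) c k * X (i k) w).

Definition centered_gaussian_process {I : Type} (D : set I) (X : I -> T -> R)
  : Prop :=
  gaussian_process D X /\ forall i, D i -> 'E_P[X i]%E = 0%E.

End gaussian_processes.

Section law_of_a_process.
Context {R : realType}.

Definition cylinders {I : Type} (D : set I) : set (set (I -> R)) :=
  [set C | exists i, D i /\
     exists B : set R, measurable B /\ C = [set x | B (x i)]].

Definition process {d} {T : measurableType d} {I : Type} (D : set I)
  (X : I -> T -> R) : Prop :=
  forall i, D i -> measurable_fun setT (X i).

(* Equality of the image measures on the product sigma-algebra; the two
   processes may live on different probability spaces. *)
Definition equal_in_law {d d'} {T : measurableType d} {T' : measurableType d'}
  {I : Type} (D : set I) (P : probability T R) (X : I -> T -> R)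
  (P' : probability T' R) (Y : I -> T' -> R) : Prop :=
  [/\ process D X, process D Y &
    forall A : set (I -> R), <<s cylinders D >> A ->
      P [set w | A (X^~ w)] = P' [set w | A (Y^~ w)]].

End law_of_a_process.

Section path_properties.
Context {d : measure_display} {T : measurableType d} {R : realType}.
Variable P : probability T R.

Definition has_continuous_modification (D : set R) (X : R -> T -> R) : Prop :=
  exists Y : R -> T -> R,
    [/\ process D Y,
        forall t, D t -> P [set w | Y t w = X t w] = 1%E &
        forall w, {within D, continuous (Y^~ w)}].

Definition self_similar (H : R) (X : R -> T -> R) : Prop :=
  forall a : R, 0 < a ->
    equal_in_law `[0, +oo[%classic P (fun t : R => X (a * t))
                 P (fun (t : R) w => a `^ H * X t w).

Definition two_sided_fbm (H : R) (nu : R -> T -> R) : Prop :=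
  centered_gaussian_process P setT nu /\
  forall s t : R, 'E_P[nu t \* nu s]%E =
    (2^-1 * (`|t| `^ (2 * H) + `|s| `^ (2 * H) - `|t - s| `^ (2 * H)))%:E.

Definition standard_brownian_motion (b : R -> T -> R) : Prop :=
  [/\ centered_gaussian_process P `[0, +oo[%classic b,
      forall s t : R, 0 <= s -> 0 <= t ->
        'E_P[b s \* b t]%E = (Num.min s t)%:E &
      {ae P, forall w, {within `[0, +oo[%classic, continuous (b^~ w)}}].

End path_properties.

Definition odd_part {T : Type} {R : realType} (X : R -> T -> R) (t : R)
  (w : T) : R := 2^-1 * (X t w - X (- t) w).

(* Wiener integrals of deterministic functions on [U].  The integrator is given
   by its values [M i] on sets [E i] (for [i] in [D]): the integral of a linear
   combination of indicators of such sets is the corresponding combination of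
   the [M i], and the integral in general is the L^2 limit of these. *)
Section wiener_integral.
Context {d : measure_display} {T : measurableType d} {R : realType}.
Context {d' : measure_display} {U : measurableType d'}.
Variables (P : probability T R) (mu : {measure set U -> \bar R}).
Context {I : Type}.
Variables (D : set I) (E : I -> set U) (M : I -> T -> R).

Definition elementary_integral (f : U -> R) (Y : T -> R) : Prop :=
  exists (n : nat) (c : 'I_n -> R) (i : 'I_n -> I),
    [/\ forall k, D (i k),
        f = (fun x => \sum_(k < n) c k * \1_(E (i k)) x) &
        Y = (fun w => \sum_(k < n) c k * M (i k) w)].

Definition is_wiener_integral (f : U -> R) (Y : T -> R) : Prop :=
  [/\ measurable_fun setT f, measurable_fun setT Y &
    exists (f_ : nat -> U -> R) (Y_ : nat -> T -> R),
      [/\ forall n, elementary_integral (f_ n) (Y_ n),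
          ('N[mu]_2%:E[EFin \o (f \- f_ n)%R])%E @[n --> \oo] --> 0%E &
          ('N[P]_2%:E[EFin \o (Y \- Y_ n)%R])%E @[n --> \oo] --> 0%E]].

(* A version of the integral (they are all almost surely equal), or 0 if the
   integral does not exist. *)
Definition wiener_integral (f : U -> R) : T -> R :=
  xget (cst 0) [set Y | is_wiener_integral f Y].

End wiener_integral.

Section brownian_integral.
Context {d : measure_display} {T : measurableType d} {R : realType}.

Definition brownian_integral (P : probability T R) (b : R -> T -> R)
  (f : R -> R) : T -> R :=
  wiener_integral P lebesgue_measure
    [set uv : R * R | 0 <= uv.1 <= uv.2]
    (fun uv => `]uv.1, uv.2]%classic)
    (fun uv w => b uv.2 w - b uv.1 w) f.

End brownian_integral.

(* Points of space-time are pairs [(y, s)] with [y] in space and [s] in time. *)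
Notation space_time R := (measurableTypeR R * measurableTypeR R)%type.

Section stochastic_heat_equation.
Context {d : measure_display} {T : measurableType d} {R : realType}.
Variable P : probability T R.

Definition space_time_measure : {measure set (space_time R) -> \bar R} :=
  (@lebesgue_measure R \x @lebesgue_measure R)%E.

Definition space_time_sets : set (set (space_time R)) :=
  [set A | [/\ measurable A, A `<=` [set z : R * R | 0 <= z.2] &
             (space_time_measure A < +oo)%E]].

Definition space_time_white_noise (W : set (space_time R) -> T -> R) : Prop :=
  centered_gaussian_process P space_time_sets W /\
  forall A B, space_time_sets A -> space_time_sets B ->
    'E_P[W A \* W B]%E = space_time_measure (A `&` B).

Definition heat_kernel (t x : R) : R :=
  (Num.sqrt (2 * pi * t))^-1 * expR (- (x ^+ 2 / (2 * t))).

Definition mild_solution (W : set (space_time R) -> T -> R) (x t : R) : T -> R :=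
  wiener_integral P space_time_measure space_time_sets id W
    (fun z : R * R =>
       if 0 <= z.2 < t then heat_kernel (t - z.2) (x - z.1) else 0).

End stochastic_heat_equation.

Definition euler_beta {R : realType} (a b : R) : R :=
  \int[lebesgue_measure]_(u in `]0, 1[) (u `^ (a - 1) * (1 - u) `^ (b - 1)).

(* Main.v *)
(* A centered Gaussian process is determined in law by its covariance.  Indeed,
   the expectation of [cos (Z + theta)], for [Z] a linear combination of values
   of the process, depends only on [theta] and on the variance of [Z], and the
   indicator of a box is a bounded limit of trigonometric polynomials.  All the
   equalities in law thus reduce to computations of covariances.

   The increments [r s - r t] are Gaussian of variance at most
   [2 sqrt `|s - t|], so their 16th moments are of order [`|s - t| ^ 4]; the
   limits of [r] along dyadic times give a continuous modification.

   A Wiener integral is a limit of Gaussian variables and an isometry.  For the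
   heat equation, the semigroup property of the heat kernel reduces the
   covariance to the integral of [(s + t - 2 u)^(- 1/2)].  For the Brownian
   integral, expanding [(1 - x)^(- 1/4)] twice gives
   [sqrt t / 2 * sum_n a_n B(n + 3/4, 3/4) z^(2 n + 1)], with [z = s / t] and
   [a_n] the binomial coefficients of [(1 - x)^(- 1/4)]; up to the factor
   [B(3/4, 3/4)], the sum is the expansion of [sqrt (1 + z) - sqrt (1 - z)]. *)
From HB Require Import structures.
Require Import Defs.
From mathcomp Require Import all_boot all_order all_algebra.
From mathcomp Require Import all_classical all_reals all_analysis.
From mathcomp Require Import measurable_realfun.
From mathcomp Require Import ring lra.
Set Implicit Arguments.
Unset Strict Implicit.
Unset Printing Implicit Defensive.
Import Order.TTheory GRing.Theory Num.Theory.
Import numFieldNormedType.Exports.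
Local Open Scope classical_set_scope.
Local Open Scope ring_scope.

(** * Integrals of Gaussian variables *)

(** Gaussianity is carried through the proof by [cgauss], which records the mean square and the
    expectations of shifted cosines instead of a law: this form is stable under L^2 limits and
    treats degenerate laws like the others.

    [wiener_integral] is a choice with default 0, so nothing can be said of it before the integral
    is shown to exist. Both kernels are unbounded (near time [t], and for the heat equation near the
    point [(0, t)]), so existence rests on approximation from below by elementary integrands, the
    isometry, and completeness of L^2.

    The 16th moment leaves room for a union bound over [0, 2^n]: at mesh 2^-n this interval has 4^n
    cells, and the probabilities 4^n (2^-n)^4 / q^(16 n) are summable once q^16 > 1/4. The windows
    grow with n, so one exceptional event serves the whole half-line.

    Beta integrals enter through the sums given by termwise integration. Their constant B is at
    first only a limit, common to all B(n + 3/4, 3/4) up to the factor [beta_ratio n]; it is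
    identified with the Euler beta function afterwards, by integrating the same series. *)

Section density.
Context d (T : measurableType d) (R : realType).
Variables (mu nu : {measure set T -> \bar R}) (h : T -> R).
Hypotheses (mh : measurable_fun setT h) (h0 : forall x, 0 <= h x).
Hypothesis nuE :
  forall A, measurable A -> nu A = (\int[mu]_(x in A) (h x)%:E)%E.
Local Open Scope ereal_scope.
Import HBNNSimple.

Let integral_density_nnsfun (f : {nnsfun T >-> R}) :
  \int[nu]_x (f x)%:E = \int[mu]_x ((f x)%:E * (h x)%:E).
Proof.
rewrite integralT_nnsfun sintegralE.
have fE x : (f x)%:E * (h x)%:E =
    \sum_(k \in range f) (k%:E * (\1_(f @^-1` [set k]) x * h x)%:E).
  rewrite fimfunE -fsumEFin// ge0_mule_fsuml.
    by apply: eq_fsbigr => k _; rewrite -!EFinM mulrA.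
  by move=> k; rewrite lee_fin; exact: nnfun_muleindic_ge0.
under [in RHS]eq_integral do rewrite fE.
rewrite ge0_integral_fsum//; last 2 first.
- move=> k; apply/measurable_EFinP; apply: measurable_funM => //.
  exact: measurable_funM.
- move=> k x _; rewrite EFinM muleA mule_ge0 ?lee_fin//.
  exact: nnfun_muleindic_ge0.
apply: eq_fsbigr => k /[!inE] -[x _ fxk].
have k0 : (0 <= k)%R by rewrite -fxk.
rewrite ge0_integralZl_EFin//; last 2 first.
- by move=> z _; rewrite lee_fin mulr_ge0.
- by apply/measurable_EFinP; apply: measurable_funM => //.
congr (_ * _); rewrite nuE// integral_mkcond; apply: eq_integral => z _.
by rewrite restrict_EFin /= patchE indicE; case: ifP => _; rewrite ?mul1r ?mul0r.
Qed.

Lemma ge0_integral_density (f : T -> \bar R) :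
  measurable_fun setT f -> (forall x, 0 <= f x) ->
  \int[nu]_x f x = \int[mu]_x (f x * (h x)%:E).
Proof.
move=> mf f0.
pose f_ := nnsfun_approx measurableT mf.
have f_f x : EFin \o f_ ^~ x @ \oo --> f x.
  by apply: cvg_nnsfun_approx => // y _; exact: f0.
transitivity (limn (fun n => \int[nu]_x (f_ n x)%:E)).
  rewrite -monotone_convergence//=.
  - by apply: eq_integral => x _; apply/esym/cvg_lim => //; exact: f_f.
  - by move=> n; exact/measurable_EFinP/measurable_funTS.
  - by move=> n x _; rewrite lee_fin.
  - by move=> x _ m n mn; rewrite lee_fin; exact/lefP/nd_nnsfun_approx.
under eq_fun do rewrite integral_density_nnsfun.
rewrite -monotone_convergence//=.
- apply: eq_integral => x _; apply/cvg_lim => //.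
  by apply: cvgeZr => //; exact: f_f.
- move=> n; apply: emeasurable_funM; exact/measurable_EFinP.
- by move=> n x _; rewrite mule_ge0// lee_fin.
- move=> x _ m n mn; rewrite lee_pmul// ?lee_fin//.
  exact/lefP/nd_nnsfun_approx.
Qed.

End density.

Section standard_normal.
Context {R : realType}.
Local Notation mu := (@lebesgue_measure R).
Local Notation std := (@normal_prob R 0 1).
Local Open Scope ereal_scope.

Lemma ge0_integral_normal_pdf (m s : R) (f : R -> \bar R) :
  measurable_fun setT f -> (forall x, 0 <= f x) ->
  \int[normal_prob m s]_x f x = \int[mu]_x (f x * (normal_pdf m s x)%:E).
Proof.
move=> mf f0; apply: (@ge0_integral_density _ (measurableTypeR R)) => //.
- exact: measurable_normal_pdf.
- by move=> x; exact: normal_pdf_ge0.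
Qed.

(** The substitution y = m + s x, which reduces every nondegenerate normal law to the standard one;
    [g] is continuous because the substitution theorem on the whole line asks for it. *)
Lemma ge0_integral_normal_affine (m s : R) (g : R -> R) : (0 < s)%R ->
  continuous g -> (forall x, 0 <= g x)%R ->
  \int[normal_prob m s]_x (g x)%:E = \int[std]_x (g (m + s * x))%:E.
Proof.
move=> s0 cg g0.
have ds (x : R) : is_derive x 1%R (fun x : R => m + s * x)%R s.
  have := is_deriveD (is_derive_cst m x 1%R) (is_deriveZ s (is_derive_id x 1%R)).
  by rewrite add0r /GRing.scale /= mulr1.
have dsE : (fun x : R => m + s * x)%R^`()%classic = cst s.
  by apply/funext => x; rewrite derive1E; apply: derive_val.
have caff : continuous (fun x : R => m + s * x)%R.
  move=> x; apply: differentiable_continuous; apply/derivable1_diffP.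
  by have [] := ds x.
rewrite (@ge0_integral_normal_pdf m s); last 2 first.
- by apply/measurable_EFinP; exact: continuous_measurable_fun.
- by move=> x; rewrite lee_fin.
rewrite (@ge0_integral_normal_pdf 0 1); last 2 first.
- apply/measurable_EFinP; apply: continuous_measurable_fun.
  by move=> x; apply: continuous_comp; [exact: caff|exact: cg].
- by move=> x; rewrite lee_fin.
under eq_integral do rewrite -EFinM.
rewrite (@increasing_ge0_integration_by_substitutionT _
  (fun x => m + s * x)%R (fun x => g x * normal_pdf m s x)%R); first last.
- by move=> x; rewrite mulr_ge0 ?normal_pdf_ge0.
- move=> x; apply: continuousM; first exact: cg.
  by apply: continuous_normal_pdf; rewrite gt_eqF.
- apply/cvgryPge => A; exists ((A - m) / s)%R; split; first exact: num_real.
  by move=> x /ltW; rewrite /= ler_pdivrMr// lerBlDl mulrC.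
- apply/cvgrNyPle => A; exists ((A - m) / s)%R; split; first exact: num_real.
  by move=> x /ltW; rewrite /= ler_pdivlMr// lerBrDl mulrC.
- by move=> x; have [] := ds x.
- by rewrite dsE; exact: is_cvg_cst.
- by rewrite dsE; exact: is_cvg_cst.
- by rewrite dsE => x; exact: cvg_cst.
- by move=> x y xy; rewrite ltrD2l ltr_pM2l.
apply: eq_integral => x _; rewrite dsE -EFinM; congr EFin.
transitivity (g (m + s * x) * (normal_pdf m s (m + s * x) * s))%R.
  by rewrite mulrA.
congr (_ * _)%R.
rewrite !normal_pdfE ?gt_eqF// /normal_fun /normal_peak.
have -> : (- (m + s * x - m) ^+ 2 / (s ^+ 2 *+ 2) =
    - (x - 0) ^+ 2 / (1 ^+ 2 *+ 2))%R.
  rewrite addrAC subrr add0r subr0 expr1n exprMn -mulrN -mulr_natr.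
  by rewrite -mulf_div divff ?mul1r// sqrf_eq0 gt_eqF.
rewrite mulrAC; congr (_ * _)%R.
rewrite expr1n mul1r -mulrnAr sqrtrM ?sqr_ge0// sqrtr_sqr gtr0_norm//.
by rewrite invfM mulrAC mulVf ?mul1r// gt_eqF.
Qed.

Lemma integral_std_opp (g : R -> \bar R) : measurable_fun setT g ->
  (forall x, 0 <= g x) ->
  \int[std]_x g (- x)%R = \int[std]_x g x.
Proof.
move=> mg g0; rewrite !ge0_integral_normal_pdf//; last first.
  by apply: measurableT_comp.
pose f x := g x * (normal_pdf 0 1 x)%:E.
have fE x : g (- x)%R * (normal_pdf 0 1 x)%:E = f (- x)%R.
  rewrite /f; congr (_ * _%:E); rewrite !normal_pdfE ?oner_eq0//.
  by congr (_ * _)%R; rewrite /normal_fun !subr0 sqrrN.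
under eq_integral do rewrite fE.
have mf : measurable_fun setT f.
  by apply: emeasurable_funM => //; apply/measurable_EFinP; exact: measurable_normal_pdf.
transitivity (\int[pushforward mu (-%R : _ -> measurableTypeR R)]_x f x).
  rewrite ge0_integral_pushforward//.
  by move=> y _; rewrite mule_ge0// lee_fin normal_pdf_ge0.
by apply: eq_measure_integral => A mA _; exact: lebesgue_measureN.
Qed.

(** Half of the Gaussian exponent absorbs the power: x^(2j) exp(- x^2 / 2) is at most a constant
    times exp(- x^2 / 4), which is proportional to the density of variance 2. *)
Lemma std_moment_fin (j : nat) : \int[std]_x (x ^+ j.*2)%:E < +oo.
Proof.
rewrite ge0_integral_normal_pdf; last 2 first.
- by apply/measurable_EFinP; exact: exprn_measurable.
- by move=> x; rewrite lee_fin exprn_even_ge0// odd_double.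
(* With y = x^2 / 4, the inequality y <= j exp(y / j) raised to the power j gives x^(2j) <= 4^j j^j
   exp(y). The quotient of the two [normal_peak] exchanges the normalizations. *)
pose C : R := (4 ^+ j * j%:R ^+ j * normal_peak 1 / normal_peak (Num.sqrt 2))%R.
have s2 : (Num.sqrt 2 != 0 :> R)%R by rewrite gt_eqF// sqrtr_gt0.
have C0 : (0 <= C)%R.
  by rewrite /C !mulr_ge0// ?exprn_ge0// ?invr_ge0 ?normal_peak_ge0.
apply: (@le_lt_trans _ _ (\int[mu]_x (C%:E * (normal_pdf 0 (Num.sqrt 2) x)%:E))).
  apply: ge0_le_integral => //.
  - by move=> x _; rewrite -EFinM lee_fin mulr_ge0 ?normal_pdf_ge0 ?exprn_even_ge0// odd_double.
  - apply: emeasurable_funM; apply/measurable_EFinP; last exact: measurable_normal_pdf.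
    exact: exprn_measurable.
  - apply: emeasurable_funM => //; apply/measurable_EFinP; exact: measurable_normal_pdf.
  move=> x _; rewrite -!EFinM lee_fin !normal_pdfE ?oner_eq0// /C /normal_fun.
  rewrite [leRHS]mulrA divfK ?gt_eqF ?normal_peak_gt0//.
  rewrite mulrCA [leRHS]mulrAC [leRHS]mulrC.
  rewrite ler_wpM2l ?normal_peak_ge0// subr0 sqr_sqrtr// expr1n.
  set y := (x ^+ 2 / 4)%R.
  have y0 : (0 <= y)%R by rewrite /y divr_ge0// sqr_ge0.
  have -> : (- x ^+ 2 / (1 *+ 2) = - y + - y)%R by rewrite /y; lra.
  have -> : (- x ^+ 2 / (2 *+ 2) = - y)%R by rewrite /y -mulr_natr; field.
  rewrite expRD mulrA mulrC mulrA ler_wpM2r ?expR_ge0//.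
  rewrite expRN ler_pdivrMl ?expR_gt0// -mul2n exprM.
  have -> : (x ^+ 2 = 4 * y)%R by rewrite /y; field.
  rewrite exprMn mulrCA ler_wpM2l ?exprn_ge0//.
  have [->|j0] := eqVneq j 0%N; first by rewrite !expr0 mulr1 -[leLHS]expR0 ler_expR.
  have jn0 : (j%:R != 0 :> R)%R by rewrite pnatr_eq0.
  have -> : expR y = (expR (y / j%:R) ^+ j)%R by rewrite -expRM_natl mulrC divfK.
  rewrite -exprMn; apply: lerXn2r; rewrite ?nnegrE//.
  rewrite -ler_pdivrMr ?ltr0n ?lt0n//.
  by rewrite (le_trans _ (expR_ge1Dx _))// lerDr.
rewrite ge0_integralZl_EFin//; last 2 first.
- by move=> x _; rewrite lee_fin normal_pdf_ge0.
- by apply/measurable_EFinP; exact: measurable_normal_pdf.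
by rewrite integral_normal_pdf mule1 ltry.
Qed.

End standard_normal.

Section gaussian_variables.
Context {R : realType}.
Local Notation std := (@normal_prob R 0 1).
Local Open Scope ereal_scope.

(** Writing the variable as m + s x with x standard normal covers the degenerate law too: for s = 0
    both sides are [g m]. *)
Lemma ge0_integral_gaussian d (T : measurableType d) (P : probability T R)
  (X : T -> R) (m s : R) (g : R -> R) :
  measurable_fun setT X -> (0 <= s)%R ->
  (forall B, measurable B -> pushforward P X B = gaussian_law m s B) ->
  continuous g -> (forall x, 0 <= g x)%R ->
  \int[P]_w (g (X w))%:E = \int[std]_x (g (m + s * x))%:E.
Proof.
move=> mX s0 PX cg g0.
have mg : measurable_fun setT (EFin \o g).
  by apply/measurable_EFinP; exact: continuous_measurable_fun.
pose X' : {mfun T >-> measurableTypeR R} :=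
  HB.pack X (@isMeasurableFun.Build _ _ T (measurableTypeR R) X mX).
transitivity (\int[distribution P X']_x (g x)%:E).
  by rewrite ge0_integral_distribution// => y; rewrite lee_fin.
move: s0; rewrite le_eqVlt => /predU1P[s0|s0].
  transitivity (\int[dirac (m : measurableTypeR R)]_x (g x)%:E).
    apply: eq_measure_integral => A mA _.
    by transitivity (gaussian_law m s A); [exact: PX|rewrite /gaussian_law -s0 eqxx].
  rewrite integral_dirac// diracT mul1e -s0.
  under eq_integral do rewrite mul0r addr0.
  by rewrite integral_cst// [X in _ * X]probability_setT mule1.
rewrite -ge0_integral_normal_affine//.
apply: eq_measure_integral => A mA _.
transitivity (gaussian_law m s A); first exact: PX.
by rewrite /gaussian_law gt_eqF.
Qed.

Lemma integral_gaussian d (T : measurableType d) (P : probability T R)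
  (X : T -> R) (m s : R) (g : R -> R) :
  measurable_fun setT X -> (0 <= s)%R ->
  (forall B, measurable B -> pushforward P X B = gaussian_law m s B) ->
  continuous g ->
  \int[P]_w (g (X w))%:E = \int[std]_x (g (m + s * x))%:E.
Proof.
move=> mX s0 PX cg; rewrite integralE [RHS]integralE.
have c0 : continuous (cst 0%R : R -> R) by move=> x; exact: cvg_cst.
congr (_ - _).
  transitivity (\int[P]_w ((g \max cst 0%R)%R (X w))%:E).
    by apply: eq_integral => w _; rewrite funeposE -EFin_max.
  rewrite (ge0_integral_gaussian mX s0 PX).
  - by apply: eq_integral => w _; rewrite funeposE -EFin_max.
  - by move=> x; apply: continuous_max; [exact: cg|exact: c0].
  - by move=> x; rewrite /= le_max lexx orbT.
transitivity (\int[P]_w (((\- g) \max cst 0%R)%R (X w))%:E).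
  by apply: eq_integral => w _; rewrite funenegE -EFin_max.
rewrite (ge0_integral_gaussian mX s0 PX).
- by apply: eq_integral => w _; rewrite funenegE -EFin_max.
- by move=> x; apply: continuous_max; [apply: continuousN; exact: cg|exact: c0].
- by move=> x; rewrite /= le_max lexx orbT.
Qed.

(** The variance of the standard normal law, kept as a symbol: variances are always divided by it,
    so only its finiteness and its positivity matter. *)
Definition std_var : R := fine (\int[std]_x (x ^+ 2)%:E).

Lemma std_varE : \int[std]_x (x ^+ 2)%:E = std_var%:E.
Proof.
rewrite /std_var fineK// ge0_fin_numE ?(std_moment_fin 1)//.
by apply: integral_ge0 => x _; rewrite lee_fin sqr_ge0.
Qed.

(** If it were zero, x^2 would vanish almost everywhere, and the standard normal law would be
    carried by {0}, a null set since the law has a density. *)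
Lemma std_var_gt0 : (0 < std_var)%R.
Proof.
have v0 : 0 <= \int[std]_x (x ^+ 2)%:E.
  by apply: integral_ge0 => x _; rewrite lee_fin sqr_ge0.
rewrite lt_neqAle -lee_fin -std_varE v0 andbT eq_sym; apply/eqP => v1.
have m2 : measurable_fun setT (fun x : R => (x ^+ 2)%:E).
  by apply/measurable_EFinP; exact: exprn_measurable.
have : \int[std]_x `|(x ^+ 2)%:E| = 0.
  have -> : 0 = std_var%:E by rewrite v1.
  rewrite -std_varE; apply: eq_integral => x _.
  by rewrite gee0_abs// lee_fin sqr_ge0.
move/(ae_eq_integral_abs std measurableT m2) => [N [mN N0 sN]].
have : std setT <= std N + std [set 0%R].
  apply: (le_trans _ (measureU2 _ _ _)) => //.
  apply: le_measure; rewrite ?inE//; first exact: measurableU.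
  move=> x _; have [->|x0] := eqVneq x 0%R; [by right|left].
  by apply: sN => /= /(_ Logic.I) -[] /eqP; rewrite sqrf_eq0 (negbTE x0).
rewrite probability_setT N0 add0e /normal_prob integral_set1.
by rewrite lee_fin ler10.
Qed.

(** The square of the L^2 norm, the form in which squares of sums are expanded; [Lnorm_msq] and
    [cvg_Lnorm2_msq] translate to and from the norm. *)
Definition msq d (T : measurableType d) (mu : {measure set T -> \bar R})
  (f : T -> R) : \bar R := \int[mu]_x (f x ^+ 2)%:E.

Lemma integrable_std_id : std.-integrable setT (EFin \o id).
Proof.
have mid : measurable_fun setT (id : R -> R) by exact: measurable_id.
have le1Dsqr (y : R) : (y <= 1 + y ^+ 2)%R by nra.
apply/integrableP; split; first exact/measurable_EFinP.
apply: (@le_lt_trans _ _ (\int[std]_x (1 + x ^+ 2)%:E)).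
  apply: ge0_le_integral => //=.
  - by apply/measurable_EFinP; exact: (@normr_measurable R setT).
  - apply/measurable_EFinP; exact: measurable_funD.
  move=> x _; rewrite lee_fin -(@real_normK _ x) ?num_real//.
under eq_integral do rewrite EFinD.
rewrite ge0_integralD//; last 2 first.
- by move=> x _; rewrite lee_fin sqr_ge0.
- by apply/measurable_EFinP; exact: exprn_measurable.
by rewrite std_varE integral_cst// mul1e [X in X + _]probability_setT ltry.
Qed.

Lemma integral_std_id : \int[std]_x x%:E = 0.
Proof.
rewrite integralE.
have -> : \int[std]_x (fun x : R => x%:E)^\- x
    = \int[std]_x (fun x : R => x%:E)^\+ x.
  rewrite -integral_std_opp//; last first.
    by apply: measurable_funeneg; apply/measurable_EFinP; exact: measurable_id.
  by apply: eq_integral => x _; rewrite funeposE funenegE -EFinN opprK.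
rewrite subee//; have := integrable_pos_fin_num measurableT integrable_std_id.
exact.
Qed.

Lemma integral_std_affine (m s : R) : \int[std]_x (m + s * x)%:E = m%:E.
Proof.
under eq_integral do rewrite EFinD.
have is_ : std.-integrable setT (fun x : R => (s * x)%:E).
  apply: eq_integrable (integrableZl measurableT s integrable_std_id) => //.
rewrite integralD//; last exact: finite_measure_integrable_cst.
rewrite integral_cst// [X in _ * X]probability_setT mule1.
under eq_integral do rewrite EFinM.
by rewrite integralZl//; [rewrite integral_std_id mule0 adde0|exact: integrable_std_id].
Qed.

(** The existential law of [gaussian_rv] is replaced here by one scale [s] and the standard normal
    law; the mean parameter vanishes because it is the expectation. *)
Lemma centered_gaussian_integral d (T : measurableType d)
    (P : probability T R) (X : T -> R) :
  gaussian_rv P X -> 'E_P[X] = 0 ->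
  exists s : R, [/\ (0 <= s)%R, msq P X = (s ^+ 2 * std_var)%:E &
    forall g : R -> R, continuous g ->
      \int[P]_w (g (X w))%:E = \int[std]_x (g (s * x)%R)%:E].
Proof.
move=> [mX [m [s [s0 PX]]]] EX0.
have m0 : m = 0%R.
  apply/EFin_inj; rewrite -(integral_std_affine m s).
  rewrite -(@integral_gaussian _ _ P X m s id)//.
    by move: EX0; rewrite unlock.
  by move=> x; exact: cvg_id.
have XE (g : R -> R) : continuous g ->
    \int[P]_w (g (X w))%:E = \int[std]_x (g (s * x)%R)%:E.
  move=> cg; rewrite (integral_gaussian mX s0 PX)//.
  by rewrite m0; under eq_integral do rewrite add0r.
exists s; split => //; rewrite /msq (XE (fun x => x ^+ 2)%R); last first.
  exact: exprn_continuous.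
under eq_integral do rewrite exprMn EFinM.
rewrite ge0_integralZl_EFin//; last 3 first.
- by move=> x _; rewrite lee_fin sqr_ge0.
- by apply/measurable_EFinP; exact: exprn_measurable.
- exact: sqr_ge0.
by rewrite std_varE.
Qed.

(** The characteristic function of the centered normal law of variance [v] in real form: the phase
    [theta] yields both the real and the imaginary part. *)
Definition gauss_char (v theta : R) : \bar R :=
  \int[std]_x (cos (Num.sqrt (v / std_var) * x + theta))%:E.

Lemma centered_gaussian_cos d (T : measurableType d)
    (P : probability T R) (X : T -> R) :
  gaussian_rv P X -> 'E_P[X] = 0 ->
  exists v : R, [/\ (0 <= v)%R, msq P X = v%:E &
    forall theta, \int[P]_w (cos (X w + theta))%:E = gauss_char v theta].
Proof.
move=> gX EX0; have [s [s0 vX XE]] := centered_gaussian_integral gX EX0.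
have sv0 := std_var_gt0; exists (s ^+ 2 * std_var)%R; split => //.
  by rewrite mulr_ge0 ?sqr_ge0 ?ltW.
move=> theta; rewrite /gauss_char mulfK ?gt_eqF// sqrtr_sqr ger0_norm//.
apply: (XE (fun x => cos (x + theta))) => x.
apply: continuous_comp; last exact: continuous_cos.
by apply: cvgD; [exact: cvg_id|exact: cvg_cst].
Qed.

Lemma gauss_char_cvg (v_ : nat -> R) (v theta : R) :
  v_ @ \oo --> v ->
  (gauss_char (v_ n) theta) @[n --> \oo] --> gauss_char v theta.
Proof.
move=> v_v; rewrite /gauss_char.
pose f_ (n : nat) (x : R) := (cos (Num.sqrt (v_ n / std_var) * x + theta))%:E.
pose f (x : R) := (cos (Num.sqrt (v / std_var) * x + theta))%:E.
have mc (c : R) : measurable_fun setT (fun x : R => (cos (c * x + theta))%:E).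
  apply/measurable_EFinP; apply: continuous_measurable_fun => x.
  apply: continuous_comp; last exact: continuous_cos.
  apply: cvgD; last exact: cvg_cst.
  by apply: cvgM; [exact: cvg_cst|exact: cvg_id].
have [] := @dominated_convergence _ _ _ std setT measurableT f_ f (cst 1) => //.
- by move=> n; exact: mc.
- exact: mc.
- apply: aeW => x _; apply: cvg_EFin; first exact: nearW.
  apply: continuous_cvg; first exact: continuous_cos.
  apply: cvgD; last exact: cvg_cst.
  apply: cvgM; last exact: cvg_cst.
  apply: continuous_cvg; first exact: sqrt_continuous.
  by apply: cvgM => //; exact: cvg_cst.
- exact: finite_measure_integrable_cst.
- by apply: aeW => x n _; rewrite /f_ /= lee_fin ler_norml cos_geN1 cos_le1.
Qed.

End gaussian_variables.

(** * Finite-dimensional laws and characteristic functions *)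

Section bump.
Context {R : realType}.
Implicit Types (x u p : R).

Lemma sin_cos_MVT x : 0 < x -> exists2 c : R, 0 < c < x & sin x = cos c * x.
Proof.
move=> x0; have [c cx] : exists2 c, c \in `]0, x[ & sin x - sin 0 = cos c * (x - 0).
  apply: MVT => //; apply: continuous_subspaceT; exact: continuous_sin.
by rewrite sin0 !subr0 => ->; exists c => //; move: cx; rewrite in_itv.
Qed.

Lemma abs_sin_le x : `|sin x| <= `|x|.
Proof.
wlog x0 : x / 0 < x.
  move=> h; have [x0|x0|->] := ltgtP x 0; last by rewrite sin0.
    by rewrite -normrN -sinN -[leRHS]normrN h// oppr_gt0.
  exact: h.
have [c _ ->] := sin_cos_MVT x0.
by rewrite normrM ler_piMl// cos_max.
Qed.

Lemma cos_ge x : 1 - x ^+ 2 / 2 <= cos x.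
Proof.
have -> : cos x = 1 - sin (x / 2) ^+ 2 *+ 2.
  rewrite {1}(_ : x = (x / 2) *+ 2); last by rewrite -mulr_natr divfK.
  by rewrite cos_mulr2n cos2sin2 mulrnBl; lra.
rewrite lerD2l lerN2.
have : sin (x / 2) ^+ 2 <= (x / 2) ^+ 2.
  rewrite -(real_normK (num_real (sin _))) -(real_normK (num_real (x / 2))).
  by apply: lerXn2r; rewrite ?nnegrE// abs_sin_le.
rewrite -mulr_natr; nra.
Qed.

Lemma abs_sin_ge x : `|x| * (1 - x ^+ 2 / 2) <= `|sin x|.
Proof.
wlog x0 : x / 0 < x.
  move=> h; have [x0|x0|->] := ltgtP x 0; last by rewrite sin0 normr0 mul0r.
    by rewrite -(normrN (sin x)) -sinN -(normrN x) -sqrrN h// oppr_gt0.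
  exact: h.
have [c /andP[c0 cx] ->] := sin_cos_MVT x0.
rewrite normrM mulrC ler_wpM2r//.
apply: (le_trans _ (ler_norm _)); apply: (le_trans _ (cos_ge c)).
by rewrite lerD2l lerN2 ler_wpM2r// ?invr_ge0//; apply: lerXn2r; rewrite ?nnegrE ltW.
Qed.

Lemma bernoulli_le p n : -1 <= p -> 1 + n%:R * p <= (1 + p) ^+ n.
Proof.
move=> p1; elim: n => [|n ih]; first by rewrite mul0r addr0.
rewrite exprS; have p10 : 0 <= 1 + p by lra.
apply: (le_trans _ (ler_wpM2l p10 ih)).
rewrite -natr1; have : 0 <= n%:R :> R by []. nra.
Qed.

(** From (1 - p)^n (1 + p)^n <= 1 and the Bernoulli inequality for the second factor. *)
Lemma expr_onem_le p n : 0 <= p <= 1 -> (1 - p) ^+ n <= (1 + n%:R * p)^-1.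
Proof.
move=> /andP[p0 p1]; have np : 0 < 1 + n%:R * p.
  by rewrite ltr_wpDr// mulr_ge0.
rewrite -[leRHS]mul1r ler_pdivlMr//.
apply: (@le_trans _ _ ((1 - p) ^+ n * (1 + p) ^+ n)).
  by rewrite ler_wpM2l ?exprn_ge0 ?subr_ge0// bernoulli_le//; lra.
rewrite -exprMn exprn_ile1//; nra.
Qed.

(* [m]-th term of a sequence of polynomials in [sin (u / m)] that converges to
   the indicator of the open unit interval; the second exponent is chosen of
   larger order than [m ^ 2m] so that the limit at the end points is [0]. *)
Definition bump (m : nat) u : R :=
  (1 - sin (u / m.+1%:R) ^+ (m.+1).*2) ^+ (m.+1 * m.+1 ^ (m.+1).*2).

Let sin_expr01 (y : R) n : 0 <= sin y ^+ n.*2 <= 1.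
Proof.
have s2 : sin y ^+ 2 <= 1 by rewrite sin2cos2 lerBlDr lerDl sqr_ge0.
apply/andP; split; first by rewrite exprn_even_ge0 ?odd_double.
by rewrite -muln2 mulnC exprM exprn_ile1 ?sqr_ge0.
Qed.

Lemma bump_ge0 m u : 0 <= bump m u.
Proof. by rewrite exprn_ge0// subr_ge0; case/andP: (sin_expr01 (u / m.+1%:R) m.+1). Qed.

Lemma bump_le1 m u : bump m u <= 1.
Proof.
have /andP[s0 s1] := sin_expr01 (u / m.+1%:R) m.+1.
by apply: exprn_ile1; rewrite ?subr_ge0// lerBlDr lerDl.
Qed.

(** With M = m + 1, the Bernoulli inequality bounds the defect by M (M sin(u / M))^(2M) <= M
    |u|^(2M), and the geometric decay of |u|^(2M) absorbs the factor M. *)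
Lemma bump_lower u : `|u| < 1 ->
  exists2 C : R, 0 <= C & forall m, 1 - C / m.+1%:R <= bump m u.
Proof.
move=> u1; pose a := (`|u| + 1) / 2.
have ua : `|u| <= a by rewrite /a; lra.
have a0 : 0 < a by rewrite /a; have := normr_ge0 u; lra.
have a1 : a < 1 by rewrite /a; lra.
pose dl := a^-1 - 1; have dl0 : 0 < dl by rewrite subr_gt0 invf_gt1.
exists (dl ^- 2) => [|m]; first by rewrite invr_ge0 sqr_ge0.
have M0 : 0 < m.+1%:R :> R by [].
apply: (le_trans _ (bernoulli_le _ _)); last first.
  by have /andP[s0 s1] := sin_expr01 (u / m.+1%:R) m.+1; lra.
rewrite lerD2l mulrN lerN2 natrM natrX.
apply: (@le_trans _ _ (m.+1%:R * a ^+ (m.+1).*2)).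
  rewrite -mulrA ler_wpM2l// mulrC -ler_pdivlMr ?exprn_gt0// -expr_div_n.
  rewrite -muln2 mulnC !exprM.
  apply: lerXn2r; rewrite ?nnegrE ?sqr_ge0//.
  rewrite -(real_normK (num_real (sin _))).
  apply: lerXn2r; rewrite ?nnegrE//; first by rewrite divr_ge0// ltW.
  apply: (le_trans (abs_sin_le _)).
  rewrite normrM normfV [X in _ / X]gtr0_norm//.
  by rewrite ler_wpM2r// invr_ge0 ltW.
have aE : a = (1 + dl)^-1 by rewrite /dl addrC subrK invrK.
have am : a ^+ m.+1 <= (m.+1%:R * dl)^-1.
  have d1 : 0 < 1 + dl by rewrite ltr_pwDl// ltW.
  rewrite aE exprVn lef_pV2 ?posrE//; [|exact: exprn_gt0|exact: mulr_gt0].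
  apply: (@le_trans _ _ (1 + m.+1%:R * dl)); first by rewrite lerDr.
  by apply: bernoulli_le; rewrite (le_trans _ (ltW dl0))// lerN10.
rewrite -muln2 exprM.
apply: (@le_trans _ _ (m.+1%:R * (m.+1%:R * dl)^-1 ^+ 2)).
  rewrite ler_wpM2l//; apply: lerXn2r; rewrite ?nnegrE//.
  - by rewrite exprn_ge0// ltW.
  - by rewrite invr_ge0 mulr_ge0// ltW.
rewrite exprVn exprMn invfM mulrA [m.+1%:R ^+ 2]expr2 invfM mulrA divff ?gt_eqF//.
by rewrite mul1r mulrC.
Qed.

(** With M = m + 1, [expr_onem_le] reduces the bound to M (M |sin(u / M)|)^(2M) >= M / 2. As |u| >=
    1, M |sin(u / M)| is at least 1 - u^2 / (2 M^2), whose power 2M is at least 1 - u^2 / M >= 1/2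
    once M >= 2 u^2. The leading factor M is what forces the limit 0 when |u| = 1. *)
Lemma bump_upper u : 1 <= `|u| ->
  \forall m \near \oo, bump m u <= 2 / m.+1%:R.
Proof.
move=> u1; have u0 : 0 < `|u| by lra.
near=> m.
have M0 : 0 < m.+1%:R :> R by [].
have mu : 2 * u ^+ 2 <= m.+1%:R.
  near: m; exists (Num.truncn (2 * u ^+ 2)).+1 => // m /= tm.
  apply: (le_trans (ltW (truncnS_gt _))); rewrite ler_nat.
  by apply: (leq_trans tm).
apply: (le_trans (expr_onem_le _ (sin_expr01 _ _))).
rewrite -[2 / _]invf_div lef_pV2 ?posrE ?divr_gt0//; last first.
  by rewrite ltr_wpDr// mulr_ge0//; case/andP: (sin_expr01 (u / m.+1%:R) m.+1).
apply: (le_trans (y := m.+1%:R * (m.+1%:R * `|sin (u / m.+1%:R)|) ^+ (m.+1).*2)); last first.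
  rewrite natrM natrX exprMn -!mulrA -normrX ger0_norm ?ler_wpDl//.
  by case/andP: (sin_expr01 (u / m.+1%:R) m.+1).
rewrite ler_wpM2l//.
have u2 : 0 <= u ^+ 2 by exact: sqr_ge0.
have e1 : 1 - u ^+ 2 / m.+1%:R ^+ 2 / 2 <= m.+1%:R * `|sin (u / m.+1%:R)|.
  apply: (@le_trans _ _ (m.+1%:R * (`|u / m.+1%:R| * (1 - (u / m.+1%:R) ^+ 2 / 2)))); last first.
    by rewrite ler_wpM2l// abs_sin_ge.
  rewrite normrM normfV (gtr0_norm M0) mulrA mulrCA divff ?gt_eqF// mulr1.
  rewrite expr_div_n ler_peMl// subr_ge0 ler_pdivrMr// mul1r.
  rewrite ler_pdivrMr ?exprn_gt0// expr2.
  have : 1 <= m.+1%:R :> R by rewrite ler1n.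
  nra.
have e0 : 0 <= 1 - u ^+ 2 / m.+1%:R ^+ 2 / 2.
  rewrite subr_ge0 ler_pdivrMr// mul1r ler_pdivrMr ?exprn_gt0// expr2.
  have : 1 <= m.+1%:R :> R by rewrite ler1n.
  nra.
apply: (@le_trans _ _ ((1 - u ^+ 2 / m.+1%:R ^+ 2 / 2) ^+ (m.+1).*2)); last first.
  by apply: lerXn2r; rewrite ?nnegrE ?mulr_ge0.
apply: (@le_trans _ _ (1 + (m.+1).*2%:R * - (u ^+ 2 / m.+1%:R ^+ 2 / 2))); last first.
  by apply: bernoulli_le; move: e0; set y := _ / 2; lra.
have -> : (m.+1).*2%:R * - (u ^+ 2 / m.+1%:R ^+ 2 / 2) = - (u ^+ 2 / m.+1%:R).
  by rewrite -muln2 natrM; field; rewrite gt_eqF.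
have : u ^+ 2 / m.+1%:R <= 2^-1 by rewrite ler_pdivrMr//; move: mu; lra.
by set y := u ^+ 2 / _; lra.
Unshelve. all: by end_near. Qed.

Lemma cvg_bump u : bump m u @[m --> \oo] --> ((`|u| < 1)%R%:R : R).
Proof.
have hC (C : R) : C / m.+1%:R @[m --> \oo] --> (0 : R).
  by rewrite -[X in _ --> X](mulr0 C); apply: cvgM; [exact: cvg_cst|exact: cvg_harmonic].
have [u1|u1] := ltP `|u| 1.
  have [C C0 lb] := bump_lower u1.
  apply: (@squeeze_cvgr _ _ _ _ (fun m => 1 - C / m.+1%:R) (cst 1)).
  - by apply: nearW => m /=; rewrite lb bump_le1.
  - rewrite -[X in _ --> X](subr0 (1 : R)).
    by apply: cvgB; [exact: cvg_cst|exact: hC].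
  - exact: cvg_cst.
apply: (@squeeze_cvgr _ _ _ _ (cst 0) (fun m => 2 / m.+1%:R)).
- by near=> m; rewrite /= bump_ge0 /=; near: m; exact: bump_upper.
- exact: cvg_cst.
- exact: hC.
Unshelve. all: by end_near. Qed.

End bump.

Section trigonometric_polynomials.
Context {R : realType} {n : nat}.
Implicit Types (c : 'I_n -> R) (p q : ('I_n -> R) -> R).

(** Real trigonometric polynomials with phases. A phase of - pi / 2 turns a cosine into a sine, and
    the product of two generators is again a sum of two generators, so one kind of generator
    suffices. *)
Inductive trigpoly : (('I_n -> R) -> R) -> Prop :=
| trigpoly_cos a c theta :
    trigpoly (fun x => a * cos (\sum_(k < n) c k * x k + theta))
| trigpolyD p q : trigpoly p -> trigpoly q -> trigpoly (fun x => p x + q x).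

Lemma eq_trigpoly p q : p =1 q -> trigpoly p -> trigpoly q.
Proof. by move=> /funext ->. Qed.

Lemma trigpoly_cst a : trigpoly (fun=> a).
Proof.
apply: eq_trigpoly (trigpoly_cos a (fun=> 0) 0) => x.
by rewrite big1 ?addr0 ?cos0 ?mulr1// => k _; rewrite mul0r.
Qed.

Lemma trigpolyM p q : trigpoly p -> trigpoly q ->
  trigpoly (fun x => p x * q x).
Proof.
move=> tp tq; elim: tp => {p} [a c theta|p p' _ ih _ ih']; last first.
  by apply: eq_trigpoly (trigpolyD ih ih') => x; rewrite mulrDl.
elim: tq => {q} [b e eta|q q' _ ih _ ih']; last first.
  by apply: eq_trigpoly (trigpolyD ih ih') => x; rewrite mulrDr.
apply: eq_trigpoly (trigpolyD
  (trigpoly_cos (a * b / 2) (fun k => c k + e k) (theta + eta))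
  (trigpoly_cos (a * b / 2) (fun k => c k - e k) (theta - eta))) => x.
set A := \sum_(k < n) c k * x k; set B := \sum_(k < n) e k * x k.
have -> : \sum_(k < n) (c k + e k) * x k = A + B.
  by rewrite -big_split; apply: eq_bigr => k _; rewrite mulrDl.
have -> : \sum_(k < n) (c k - e k) * x k = A - B.
  by rewrite -sumrB; apply: eq_bigr => k _; rewrite mulrBl.
have -> : A - B + (theta - eta) = A + theta - (B + eta).
  by rewrite opprD addrACA.
rewrite addrACA cosD cosB.
by field.
Qed.

Lemma trigpolyX p m : trigpoly p -> trigpoly (fun x => p x ^+ m).
Proof.
move=> tp; elim: m => [|m ih].
  by apply: eq_trigpoly (trigpoly_cst 1) => x; rewrite expr0.
by apply: eq_trigpoly (trigpolyM tp ih) => x; rewrite exprS.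
Qed.

Lemma trigpoly_prod (s : seq 'I_n) (f : 'I_n -> ('I_n -> R) -> R) :
  (forall k, trigpoly (f k)) -> trigpoly (fun x => \prod_(k <- s) f k x).
Proof.
move=> tf; elim: s => [|k s ih].
  by apply: eq_trigpoly (trigpoly_cst 1) => x; rewrite big_nil.
by apply: eq_trigpoly (trigpolyM (tf k) ih) => x; rewrite big_cons.
Qed.

Lemma trigpoly_sin k b e : trigpoly (fun x => sin (b * x k + e)).
Proof.
apply: eq_trigpoly (trigpoly_cos 1 (fun j => b *+ (j == k)) (e - pi / 2)) => x.
rewrite (bigD1 k)//= eqxx mulr1n big1 ?addr0; last first.
  by move=> j /negbTE ->; rewrite mulr0n mul0r.
by rewrite mul1r addrA cosBpihalf.
Qed.

Lemma trigpoly_bump k b a m : trigpoly (fun x => bump m (b * (x k - a))).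
Proof.
apply: trigpolyX; apply: (trigpolyD (trigpoly_cst 1)).
apply: eq_trigpoly (trigpolyM (trigpoly_cst (-1)) (trigpolyX (m.+1).*2
  (trigpoly_sin k (b / m.+1%:R) (- (b * a / m.+1%:R))))) => x.
by rewrite mulN1r; congr (- sin _ ^+ _); rewrite mulrBr mulrBl mulrAC.
Qed.

End trigonometric_polynomials.

Lemma measurable_norm_lt1 {R : realType} d (T : measurableType d) (f : T -> R) :
  measurable_fun setT f -> measurable [set w | `|f w| < 1].
Proof.
move=> mf; rewrite -[X in measurable X]setTI.
apply: (@measurable_fun_ltr _ _ _ setT (fun w => `|f w|) (cst 1)
  _ _ measurableT [set true]) => //.
by apply: measurableT_comp; [exact: normr_measurable|exact: mf].
Qed.

Section cramer_wold.
Context {R : realType} {d d' : measure_display}.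
Context {T : measurableType d} {T' : measurableType d'} {I : Type}.
Variables (P : probability T R) (P' : probability T' R).
Variables (D : set I) (X : I -> T -> R) (Y : I -> T' -> R).
Hypotheses (mX : process D X) (mY : process D Y).
Hypothesis XYcos : forall (n : nat) (i : 'I_n -> I) (c : 'I_n -> R) (theta : R),
  (forall k, D (i k)) ->
  (\int[P]_w (cos (\sum_(k < n) c k * X (i k) w + theta))%:E =
   \int[P']_w (cos (\sum_(k < n) c k * Y (i k) w + theta))%:E)%E.

Section finite_family.
Context {n : nat} (i : 'I_n -> I) (Di : forall k, D (i k)).

Let mcos {d0} {T0 : measurableType d0} (Z : I -> T0 -> R) :
  process D Z -> forall a c theta,
  measurable_fun setT
    (fun w => a * cos (\sum_(k < n) c k * Z (i k) w + theta)).
Proof.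
move=> mZ a c theta; apply: measurable_funM => //.
apply: measurableT_comp.
  by apply: continuous_measurable_fun; exact: continuous_cos.
apply: measurable_funD => //; apply: measurable_sum => k.
by apply: measurable_funM => //; exact/mZ/Di.
Qed.

Let icos {d0} {T0 : measurableType d0} (P0 : probability T0 R) (Z : I -> T0 -> R) :
  process D Z -> forall a c theta,
  P0.-integrable setT
    (fun w => (a * cos (\sum_(k < n) c k * Z (i k) w + theta))%:E).
Proof.
move=> mZ a c theta; apply: measurable_bounded_integrable => //.
- by rewrite [X in (X < _)%E]probability_setT ltry.
- exact: mcos.
- exists `|a|; split; first exact: num_real.
  move=> M aM w _ /=; rewrite normrM (le_trans _ (ltW aM))//.
  by rewrite ler_piMr// cos_max.
Qed.

Lemma integral_trigpoly (p : ('I_n -> R) -> R) : trigpoly p ->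
  [/\ P.-integrable setT (fun w => (p (fun k => X (i k) w))%:E),
      P'.-integrable setT (fun w => (p (fun k => Y (i k) w))%:E) &
      (\int[P]_w (p (fun k => X (i k) w))%:E =
       \int[P']_w (p (fun k => Y (i k) w))%:E)%E].
Proof.
elim=> {p} [a c theta|p q _ [pX pY pE] _ [qX qY qE]].
  split; [exact: icos|exact: icos|].
  under eq_integral do rewrite EFinM.
  under [RHS]eq_integral do rewrite EFinM.
  have i1 := icos P mX 1 c theta; have i2 := icos P' mY 1 c theta.
  rewrite !integralZl//; first by rewrite XYcos.
    by apply: eq_integrable i2 => // w _; rewrite mul1r.
  by apply: eq_integrable i1 => // w _; rewrite mul1r.
split.
- by apply: eq_integrable (integrableD measurableT pX qX).
- by apply: eq_integrable (integrableD measurableT pY qY).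
under eq_integral do rewrite EFinD.
under [RHS]eq_integral do rewrite EFinD.
by rewrite !integralD// pE qE.
Qed.

(** Dominated convergence with bound 1: the products of bumps converge pointwise to the indicator of
    an open box. *)
Let cvg_prod_bump {d0} {T0 : measurableType d0} (P0 : probability T0 R)
  (Z : I -> T0 -> R) (a b : 'I_n -> R) : process D Z ->
  (\int[P0]_w (\prod_(k < n) bump m (b k * (Z (i k) w - a k)))%:E)%E
    @[m --> \oo] -->
  P0 [set w | forall k, `|b k * (Z (i k) w - a k)| < 1].
Proof.
move=> mZ.
have mlin k : measurable_fun setT (fun w => b k * (Z (i k) w - a k)).
  by apply: measurable_funM => //; apply: measurable_funB => //; exact/mZ/Di.
have cvg_prod w : \prod_(k < n) bump m (b k * (Z (i k) w - a k))
    @[m --> \oo] --> \prod_(k < n) ((`|b k * (Z (i k) w - a k)| < 1)%R%:R : R).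
  elim: (index_enum _) => [|k s ih].
    by under eq_fun do rewrite big_nil; rewrite big_nil; exact: cvg_cst.
  under eq_fun do rewrite big_cons; rewrite big_cons.
  by apply: cvgM => //; exact: cvg_bump.
pose F (w : T0) := (\prod_(k < n) ((`|b k * (Z (i k) w - a k)| < 1)%R%:R : R)).
have -> : P0 [set w | forall k, `|b k * (Z (i k) w - a k)| < 1] =
    (\int[P0]_w (F w)%:E)%E.
  have FE w : F w = \1_[set w | forall k, `|b k * (Z (i k) w - a k)| < 1] w.
    rewrite indicE /F; have [|] := boolP (w \in _).
      by rewrite inE /= => h; rewrite big1// => k _; rewrite h.
    move/negP; rewrite inE /= => /existsNP[k /negP/negbTE kw].
    by rewrite (bigD1 k)//= kw mul0r.
  under eq_integral do rewrite FE.
  rewrite integral_indic ?setIT//.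
  rewrite (_ : [set w | _] = \bigcap_(k in [set: 'I_n])
      [set w | `|b k * (Z (i k) w - a k)| < 1]); last first.
    by apply/seteqP; split=> [w h k _|w h k]; [exact: h|exact: (h k)].
  apply: fin_bigcap_measurable => // k _.
  by apply: measurable_norm_lt1; exact: mlin.
have mb m : measurable_fun setT (@bump R m).
  apply: measurable_funX; apply: measurable_funB => //; apply: measurable_funX.
  apply: measurableT_comp; last exact: measurable_funM.
  by apply: continuous_measurable_fun; exact: continuous_sin.
have mF : measurable_fun setT F.
  apply: (@measurable_fun_cvg _ _ _ setT
    (fun m w => \prod_(k < n) bump m (b k * (Z (i k) w - a k)))).
    by move=> m; apply: measurable_prod => k _; exact: measurableT_comp.
  by move=> w _; exact: cvg_prod.
have [] // := @dominated_convergence _ _ _ P0 setT measurableT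
  (fun m w => (\prod_(k < n) bump m (b k * (Z (i k) w - a k)))%:E)
  (EFin \o F) (cst 1%E).
- move=> m; apply/measurable_EFinP; apply: measurable_prod => k _.
  exact: measurableT_comp.
- exact/measurable_EFinP.
- apply: aeW => w _; apply: cvg_EFin; first exact: nearW.
  exact: cvg_prod.
- exact: finite_measure_integrable_cst.
- apply: aeW => w m _; rewrite lee_fin ger0_norm ?prodr_ge0//; last first.
    by move=> k _; exact: bump_ge0.
  by apply: prodr_ile1 => k _; rewrite bump_ge0 bump_le1.
Qed.

Lemma eq_proba_boxes (a b : 'I_n -> R) :
  P [set w | forall k, `|b k * (X (i k) w - a k)| < 1] =
  P' [set w | forall k, `|b k * (Y (i k) w - a k)| < 1].
Proof.
have := @cvg_prod_bump _ _ P _ a b mX.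
under eq_fun => m.
  have [_ _ ->] := integral_trigpoly (trigpoly_prod (index_enum _)
    (fun k => trigpoly_bump k (b k) (a k) m)).
  over.
move=> h; have := @cvg_prod_bump _ _ P' _ a b mY.
by move/(cvg_unique _) : h => /[apply]; apply.
Qed.

End finite_family.

(** Open boxes, with center [a k] and half-width 1 / |b k| in the coordinate [i k]; b = 0 leaves the
    coordinate free. Indices may repeat, so two boxes are intersected by concatenating their lists
    of constraints, with no computation on intervals. *)
Let G : set (set (I -> R)) := [set C | exists n (i : 'I_n -> I) (a b : 'I_n -> R),
  (forall k, D (i k)) /\
  C = [set x | forall k, `|b k * (x (i k) - a k)| < 1]].

Let setI_closed_G : setI_closed G.
Proof.
move=> _ _ [n [i [a [b [Di ->]]]]] [m [j [a' [b' [Dj ->]]]]].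
pose glue (A : Type) (f : 'I_n -> A) (g : 'I_m -> A) (k : 'I_(n + m)) :=
  match fintype.split k with inl k => f k | inr k => g k end.
exists (n + m)%N, (glue _ i j), (glue _ a a'), (glue _ b b'); split.
  by move=> k; rewrite /glue; case: (fintype.split k).
have gl (A : Type) (f : 'I_n -> A) g k : glue A f g (lshift m k) = f k.
  by rewrite /glue (unsplitK (inl k)).
have gr (A : Type) (f : 'I_n -> A) g k : glue A f g (rshift n k) = g k.
  by rewrite /glue (unsplitK (inr k)).
apply/seteqP; split => [x [h h'] k|x h].
  by case: (split_ordP k) => l ->; rewrite ?gl ?gr; [exact: h|exact: h'].
by split=> k; [have := h (lshift m k)|have := h (rshift n k)]; rewrite ?gl ?gr.
Qed.

Let cylinders_G : <<s cylinders D >> `<=` <<s G >>.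
Proof.
apply: smallest_sub; first exact: smallest_sigma_algebra.
move=> _ [i [Di [B [mB ->]]]].
pose ev (x : g_sigma_algebraType G) : R := x i.
suff mev : measurable_fun setT ev.
  by have := mev measurableT B mB; rewrite setTI.
apply: (@measurability _ _ (g_sigma_algebraType G) (measurableTypeR R) setT ev
  _ (RGenOInfty.measurableE R)) => _ [_ [a ->] <-].
rewrite setTI.
(* A half-line is exhausted by the bounded intervals ]a, a + 2k[ of center a + k and half-width k,
   for k >= 1. *)
have -> : ev @^-1` [set` `]a, +oo[] = \bigcup_k
    [set x : g_sigma_algebraType G | `|k.+1%:R^-1 * (ev x - (a + k.+1%:R))| < 1].
  apply/seteqP; split => [x|x [k _]] /=; rewrite in_itv/= andbT.
    move=> ax; exists (Num.truncn (ev x - a)) => //=.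
    have := truncnS_gt (ev x - a); set k := (Num.truncn _).+1.
    have k0 : 0 < k%:R :> R by [].
    rewrite normrM normfV (gtr0_norm k0) mulrC ltr_pdivrMr// mul1r ltr_norml.
    by move=> ?; apply/andP; split; lra.
  have k0 : 0 < k.+1%:R :> R by [].
  rewrite normrM normfV (gtr0_norm k0) mulrC ltr_pdivrMr// mul1r ltr_norml.
  by move=> /andP[? ?]; lra.
apply: bigcup_measurable => k _; apply: sub_sigma_algebra.
exists 1%N, (fun=> i), (fun=> a + k.+1%:R), (fun=> k.+1%:R^-1); split => //.
by apply/seteqP; split => [x h j|x /(_ ord0)].
Qed.

Let measurable_path {d0} {T0 : measurableType d0} (Z : I -> T0 -> R) :
  process D Z ->
  measurable_fun setT (fun w => Z^~ w : g_sigma_algebraType (cylinders D)).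
Proof.
move=> mZ; apply: (@measurability _ _ T0 (g_sigma_algebraType (cylinders D)) setT _
  (cylinders D)) => //.
move=> _ [_ [i [Di [B [mB ->]]]] <-].
exact: (mZ i Di measurableT B mB).
Qed.

(** The boxes form a system stable under intersection that generates the cylinder sigma-algebra, and
    the two image measures are finite and agree on it. *)
Theorem cramer_wold : equal_in_law D P X P' Y.
Proof.
split => // A mA.
pose ST := g_sigma_algebraType (@cylinders R I D).
pose fX : T -> ST := fun w => X^~ w; pose fY : T' -> ST := fun w => Y^~ w.
have mfX : measurable_fun setT fX := measurable_path mX.
have mfY : measurable_fun setT fY := measurable_path mY.
pose X' : {mfun T >-> ST} := HB.pack fX (@isMeasurableFun.Build _ _ T ST fX mfX).
pose Y' : {mfun T' >-> ST} :=
  HB.pack fY (@isMeasurableFun.Build _ _ T' ST fY mfY).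
apply: (@g_sigma_algebra_measure_unique _ R ST G _ (fun=> setT) _ _
  (distribution P X') (distribution P' Y')).
- move=> _ [n [i [a [b [Di ->]]]]].
  rewrite (_ : [set x | _] = \bigcap_(k in [set: 'I_n])
      [set x : ST | `|b k * (x (i k) - a k)| < 1]); last first.
    by apply/seteqP; split=> [x h k _|x h k]; [exact: h|exact: (h k)].
  apply: fin_bigcap_measurable => // k _; apply: sub_sigma_algebra.
  exists (i k); split; first exact: Di.
  exists [set y | `|b k * (y - a k)| < 1]; split => //.
  by apply: measurable_norm_lt1; apply: measurable_funM => //; exact: measurable_funB.
(* The whole space is the box with no constraint, indexed by ['I_0]; [e] supplies the empty
   families, even in an empty type [I]. *)
- have e (U : Type) (k : 'I_0) : U by case: k.
  move=> _; exists 0%N, (e I), (e R), (e R); split; first by case.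
  by apply/seteqP; split => // x _ [].
- by rewrite bigcup_const.
- exact: setI_closed_G.
- by move=> _ [n [i [a [b [Di ->]]]]]; exact: eq_proba_boxes.
- by move=> _; rewrite [X in (X < _)%E]probability_setT ltry.
- exact: cylinders_G.
Qed.
End cramer_wold.

(** * Gaussian processes with the same covariance *)

Section mean_square.
Context {R : realType} {d : measure_display} {T : measurableType d}.
Variable mu : {measure set T -> \bar R}.
Implicit Types f g : T -> R.
Local Open Scope ereal_scope.

Lemma msq_ge0 f : 0 <= msq mu f.
Proof. by apply: integral_ge0 => x _; rewrite lee_fin sqr_ge0. Qed.

Lemma measurable_sqr f : measurable_fun setT f ->
  measurable_fun setT (fun x => (f x ^+ 2)%:E).
Proof. by move=> mf; apply/measurable_EFinP; exact: measurable_funX. Qed.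

Lemma msqZ c f : measurable_fun setT f ->
  msq mu (fun x => c * f x)%R = (c ^+ 2)%:E * msq mu f.
Proof.
move=> mf; rewrite /msq; under eq_integral do rewrite exprMn EFinM.
rewrite ge0_integralZl_EFin ?sqr_ge0//; last exact: measurable_sqr.
by move=> x _; rewrite lee_fin sqr_ge0.
Qed.

(* [(a + b)^2 <= (1 + e) a^2 + (1 + 1/e) b^2], integrated *)
Lemma msqD_le (e : R) f g : (0 < e)%R ->
  measurable_fun setT f -> measurable_fun setT g ->
  msq mu (f \+ g)%R <= (1 + e)%:E * msq mu f + (1 + e^-1)%:E * msq mu g.
Proof.
move=> e0 mf mg.
rewrite /msq -!ge0_integralZl_EFin//; first last.
- by rewrite addr_ge0// ltW.
- exact: measurable_sqr.
- by move=> x _; rewrite lee_fin sqr_ge0.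
- by rewrite addr_ge0// invr_ge0 ltW.
- exact: measurable_sqr.
- by move=> x _; rewrite lee_fin sqr_ge0.
have m1 : measurable_fun setT (fun x => (1 + e)%:E * (f x ^+ 2)%:E).
  by apply: emeasurable_funM => //; exact: measurable_sqr.
have m2 : measurable_fun setT (fun x => (1 + e^-1)%:E * (g x ^+ 2)%:E).
  by apply: emeasurable_funM => //; exact: measurable_sqr.
have p1 x : 0 <= (1 + e)%:E * (f x ^+ 2)%:E.
  by rewrite mule_ge0// lee_fin ?sqr_ge0// addr_ge0// ltW.
have p2 x : 0 <= (1 + e^-1)%:E * (g x ^+ 2)%:E.
  by rewrite mule_ge0// lee_fin ?sqr_ge0// addr_ge0// invr_ge0 ltW.
rewrite -ge0_integralD//; apply: ge0_le_integral => //.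
- by move=> x _; rewrite lee_fin sqr_ge0.
- by apply: measurable_sqr; exact: measurable_funD.
- exact: emeasurable_funD.
move=> x _; rewrite -!EFinM -EFinD lee_fin /=.
set a := f x; set b := g x.
have h : (0 <= e * (a - b / e) ^+ 2)%R by rewrite mulr_ge0 ?sqr_ge0 ?ltW.
have hE : (e * (a - b / e) ^+ 2 = e * a ^+ 2 + e^-1 * b ^+ 2 - 2 * a * b)%R.
  by field; rewrite gt_eqF.
rewrite hE in h; rewrite sqrrD -subr_ge0; apply: (le_trans h).
by rewrite le_eqVlt; apply/orP; left; apply/eqP; rewrite -mulr_natl; ring.
Qed.

Lemma integrable_mul f g : measurable_fun setT f -> measurable_fun setT g ->
  msq mu f < +oo -> msq mu g < +oo ->
  mu.-integrable setT (fun x => (f x * g x)%:E).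
Proof.
move=> mf mg f2 g2; apply/integrableP; split.
  by apply/measurable_EFinP; exact: measurable_funM.
apply: (@le_lt_trans _ _ (msq mu f + msq mu g)); last exact: lte_add_pinfty.
rewrite /msq -ge0_integralD//; first last.
- exact: measurable_sqr.
- by move=> x _; rewrite lee_fin sqr_ge0.
- exact: measurable_sqr.
- by move=> x _; rewrite lee_fin sqr_ge0.
apply: ge0_le_integral => //.
- apply: measurableT_comp => //; apply/measurable_EFinP; exact: measurable_funM.
- by apply: emeasurable_funD; exact: measurable_sqr.
move=> x _; rewrite -EFinD lee_fin.
set a := f x; set b := g x.
have h1 := sqr_ge0 (a - b); have h2 := sqr_ge0 (a + b).
by rewrite ler_norml; apply/andP; split; nra.
Qed.

Lemma msq_sum n (f : 'I_n -> T -> R) (c : 'I_n -> R) (K : 'I_n -> 'I_n -> R) :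
  (forall k, measurable_fun setT (f k)) -> (forall k, msq mu (f k) < +oo) ->
  (forall k l, \int[mu]_x (f k x * f l x)%:E = (K k l)%:E) ->
  msq mu (fun x => \sum_(k < n) c k * f k x)%R =
  (\sum_(k < n) \sum_(l < n) c k * c l * K k l)%:E.
Proof.
move=> mf f2 fK; rewrite /msq.
have ifl k l : mu.-integrable setT (fun x => (c k * c l * (f k x * f l x))%:E).
  apply: eq_integrable (integrableZl measurableT (c k * c l)
    (integrable_mul (mf k) (mf l) (f2 k) (f2 l))) => // x _.
have ->: \int[mu]_x ((\sum_(k < n) c k * f k x) ^+ 2)%:E =
    \int[mu]_x (\sum_(k < n) \sum_(l < n) (c k * c l * (f k x * f l x))%:E).
  apply: eq_integral => x _; rewrite expr2 mulr_suml -sumEFin.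
  apply: eq_bigr => k _; rewrite mulr_sumr -sumEFin; apply: eq_bigr => l _.
  by rewrite mulrACA.
rewrite integral_sum//; last by move=> k; exact: integrable_sum.
rewrite -sumEFin; apply: eq_bigr => k _.
rewrite integral_sum// -sumEFin; apply: eq_bigr => l _.
under eq_integral do rewrite EFinM.
by rewrite integralZl ?fK//; exact: integrable_mul.
Qed.

End mean_square.

Section linear_span.
Context {R : realType} {T I : Type}.
Implicit Types (D : set I) (X : I -> T -> R) (Z : T -> R).

Definition lin_span D X : set (T -> R) :=
  [set Z | exists n (i : 'I_n -> I) (c : 'I_n -> R),
     (forall k, D (i k)) /\ Z = (fun w => \sum_(k < n) c k * X (i k) w)].

Lemma lin_span_gen D X i : D i -> lin_span D X (X i).
Proof.
move=> Di; exists 1%N, (fun=> i), (fun=> 1); split => //.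
by apply/funext => w; rewrite big_ord1 mul1r.
Qed.

Lemma lin_span0 D X : lin_span D X (fun=> 0).
Proof.
have e (U : Type) (k : 'I_0) : U by case: k.
exists 0%N, (e I), (e R); split; first by case.
by apply/funext => w; rewrite big_ord0.
Qed.

Lemma lin_spanZ D X a Z : lin_span D X Z -> lin_span D X (fun w => a * Z w).
Proof.
move=> [n [i [c [Di ->]]]]; exists n, i, (fun k => a * c k); split => //.
by apply/funext => w; rewrite mulr_sumr; apply: eq_bigr => k _; rewrite mulrA.
Qed.

Lemma lin_spanD D X Z Z' : lin_span D X Z -> lin_span D X Z' ->
  lin_span D X (fun w => Z w + Z' w).
Proof.
move=> [n [i [c [Di ->]]]] [m [j [c' [Dj ->]]]].
pose glue (A : Type) (f : 'I_n -> A) (g : 'I_m -> A) (k : 'I_(n + m)) :=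
  match fintype.split k with inl k => f k | inr k => g k end.
have gl (A : Type) (f : 'I_n -> A) g k : glue A f g (lshift m k) = f k.
  by rewrite /glue (unsplitK (inl k)).
have gr (A : Type) (f : 'I_n -> A) g k : glue A f g (rshift n k) = g k.
  by rewrite /glue (unsplitK (inr k)).
exists (n + m)%N, (glue _ i j), (glue _ c c'); split.
  by move=> k; rewrite /glue; case: (fintype.split k).
apply/funext => w; rewrite big_split_ord /=.
by congr (_ + _); apply: eq_bigr => k _; rewrite ?gl ?gr.
Qed.

Lemma lin_span_sum D X n (Z : 'I_n -> T -> R) :
  (forall k, lin_span D X (Z k)) ->
  lin_span D X (fun w => \sum_(k < n) Z k w).
Proof.
elim: n Z => [|n ih] Z sZ.
  under eq_fun do rewrite big_ord0; exact: lin_span0.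
under eq_fun do rewrite big_ord_recl.
by apply: lin_spanD => //; exact: ih.
Qed.

End linear_span.

(** The way Gaussianity passes to a process whose values are linear combinations of those of a
    Gaussian process: rescaled times, odd parts, increments. *)
Lemma sub_lin_span {R : realType} {T I J : Type} (D : set I) (X : I -> T -> R) (E : set J) (Y : J -> T -> R):
  (forall j, E j -> lin_span D X (Y j)) -> lin_span E Y `<=` lin_span D X.
Proof.
move=> sY _ [n [j [c [Ej ->]]]]; apply: lin_span_sum => k.
by apply: lin_spanZ; exact/sY/Ej.
Qed.

Section gaussian_criterion.
Context {R : realType}.
Local Open Scope ereal_scope.

(** What the comparison of laws asks of a centered Gaussian variable. Unlike [gaussian_rv], it
    passes to L^2 limits without identifying the limit law. *)
Definition cgauss d (T : measurableType d) (P : probability T R) (Z : T -> R) :=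
  exists v : R, [/\ (0 <= v)%R, msq P Z = v%:E &
    forall theta, \int[P]_w (cos (Z w + theta))%:E = gauss_char v theta].

Lemma centered_gaussian_process_mfun d (T : measurableType d)
    (P : probability T R) (I : Type) (D : set I) (X : I -> T -> R) :
  centered_gaussian_process P D X -> process D X.
Proof.
move=> [gX _] i Di; have [//|mX _] := gX 1%N (fun=> i) (fun=> 1%R).
by apply: eq_measurable_fun mX => w _; rewrite big_ord1 mul1r.
Qed.

Lemma centered_gaussian_process_rv d (T : measurableType d)
    (P : probability T R) (I : Type) (D : set I) (X : I -> T -> R) i :
  centered_gaussian_process P D X -> D i -> gaussian_rv P (X i).
Proof.
move=> [gX _] Di; have [|] := gX 1%N (fun=> i) (fun=> 1%R); first by [].
rewrite (_ : (fun w => _) = X i)//.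
by apply/funext => w; rewrite big_ord1 mul1r.
Qed.

Lemma centered_gaussian_process_msq d (T : measurableType d)
    (P : probability T R) (I : Type) (D : set I) (X : I -> T -> R) i :
  centered_gaussian_process P D X -> D i -> msq P (X i) < +oo.
Proof.
move=> gX Di; have [v [_ -> _]] := centered_gaussian_cos
  (centered_gaussian_process_rv gX Di) (gX.2 i Di).
by rewrite ltry.
Qed.

Lemma msq_integrable d (T : measurableType d) (P : probability T R)
    (f : T -> R) : measurable_fun setT f -> msq P f < +oo ->
  P.-integrable setT (EFin \o f).
Proof.
move=> mf f2; have m1 : measurable_fun setT (cst 1%R : T -> R) by [].
have h : msq P (cst 1%R) < +oo.
  rewrite /msq; under eq_integral do rewrite expr1n.
  by rewrite integral_cst// mul1e [X in X < _]probability_setT ltry.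
apply: eq_integrable (integrable_mul mf m1 f2 h) => // x _ /=.
by rewrite mulr1.
Qed.

Lemma expectation_lin_span d (T : measurableType d)
    (P : probability T R) (I : Type) (D : set I) (X : I -> T -> R) n
    (i : 'I_n -> I) (c : 'I_n -> R) : centered_gaussian_process P D X ->
  (forall k, D (i k)) -> 'E_P[fun w => \sum_(k < n) c k * X (i k) w]%R = 0.
Proof.
move=> gX Di; rewrite unlock; have mX := centered_gaussian_process_mfun gX.
have iX k : P.-integrable setT (EFin \o X (i k)).
  by apply: msq_integrable; [exact/mX/Di|exact: centered_gaussian_process_msq gX (Di k)].
under eq_integral do rewrite -sumEFin.
rewrite integral_sum//; last first.
  move=> k; apply: eq_integrable (integrableZl measurableT (c k) (iX k)) => //.
rewrite big1// => k _; under eq_integral do rewrite EFinM.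
have h : \int[P]_w (X (i k) w)%:E = 0.
  by have := gX.2 _ (Di k); rewrite unlock.
by rewrite integralZl ?[X in _ * X]h ?mule0//; exact: iX.
Qed.

Lemma gaussian_lin_span d (T : measurableType d)
    (P : probability T R) (I : Type) (D : set I) (X : I -> T -> R) Z :
  centered_gaussian_process P D X -> lin_span D X Z ->
  gaussian_rv P Z /\ 'E_P[Z] = 0.
Proof.
move=> gX [n [i [c [Di ->]]]]; split; first by apply: gX.1.
exact: expectation_lin_span gX Di.
Qed.

Lemma cgauss_lin_span d (T : measurableType d)
    (P : probability T R) (I : Type) (D : set I) (X : I -> T -> R) Z :
  centered_gaussian_process P D X -> lin_span D X Z -> cgauss P Z.
Proof.
move=> gX sZ; have [gZ EZ] := gaussian_lin_span gX sZ.
exact: centered_gaussian_cos.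
Qed.

(** Stated with [cgauss] on the linear spans so that it applies to Wiener integrals, which are only
    known as limits of Gaussian variables. The variance of a combination is a quadratic form in the
    covariances, and [cramer_wold] concludes. *)
Theorem eq_in_law_cgauss d d' (T : measurableType d) (T' : measurableType d')
    (P : probability T R) (P' : probability T' R) (I : Type) (D : set I)
    (X : I -> T -> R) (Y : I -> T' -> R) :
  process D X -> process D Y ->
  (forall Z, lin_span D X Z -> cgauss P Z) ->
  (forall Z, lin_span D Y Z -> cgauss P' Z) ->
  (forall s t, D s -> D t ->
    \int[P]_w (X s w * X t w)%:E = \int[P']_w (Y s w * Y t w)%:E) ->
  equal_in_law D P X P' Y.
Proof.
move=> mX mY gX gY XY; apply: cramer_wold => // n i c theta Di.
have [v [v0 vE ->]] : cgauss P (fun w => \sum_(k < n) c k * X (i k) w)%R.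
  by apply: gX; exists n, i, c.
have [v' [v'0 v'E ->]] : cgauss P' (fun w => \sum_(k < n) c k * Y (i k) w)%R.
  by apply: gY; exists n, i, c.
congr gauss_char; apply: EFin_inj.
have fX k : msq P (X (i k)) < +oo.
  by have [u [_ -> _]] := gX _ (lin_span_gen X (Di k)); rewrite ltry.
have fY k : msq P' (Y (i k)) < +oo.
  by have [u [_ -> _]] := gY _ (lin_span_gen Y (Di k)); rewrite ltry.
pose K k l := fine (\int[P]_w (X (i k) w * X (i l) w)%:E).
have KE k l : \int[P]_w (X (i k) w * X (i l) w)%:E = (K k l)%:E.
  rewrite fineK//; apply: integrable_fin_num => //.
  by apply: integrable_mul => //; exact/mX/Di.
rewrite -vE -v'E (@msq_sum _ _ _ _ _ _ _ K)//; last by move=> k; exact/mX/Di.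
rewrite (@msq_sum _ _ _ _ _ _ _ K)//; first by move=> k; exact/mY/Di.
by move=> k l; rewrite -XY.
Qed.

End gaussian_criterion.

(** * Self-similarity and the odd part of fractional Brownian motion *)

Section self_similar_and_fbm.
Context {R : realType}.

Lemma covariance_sym d (T : measurableType d) (P : probability T R)
  (X Y : T -> R) : (\int[P]_w (X w * Y w)%:E = \int[P]_w (Y w * X w)%:E)%E.
Proof. by apply: eq_integral => w _; rewrite mulrC. Qed.

Definition rcov (s t : R) : R := Num.sqrt (s + t) - Num.sqrt `|s - t|.

Lemma rcovC s t : rcov s t = rcov t s.
Proof. by rewrite /rcov (addrC s) (distrC s). Qed.

Context {d : measure_display} {T : measurableType d}.
Variables (P : probability T R) (r : R -> T -> R).
Hypothesis r_gauss : centered_gaussian_process P `[0, +oo[%classic r.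
Hypothesis r_cov : forall t t' : R, 0 <= t' -> t' <= t ->
  'E_P[r t \* r t']%E = (Num.sqrt (t + t') - Num.sqrt (t - t'))%:E.

Lemma rcovE s t : 0 <= s -> 0 <= t ->
  (\int[P]_w (r s w * r t w)%:E = (rcov s t)%:E)%E.
Proof.
wlog ts : s t / t <= s.
  move=> h s0 t0; have [|/ltW] := leP t s => ?; first exact: h.
  by rewrite covariance_sym rcovC; exact: h.
move=> s0 t0; have := r_cov t0 ts; rewrite unlock => ->.
by rewrite /rcov ger0_norm// subr_ge0.
Qed.

(** [rcov] is homogeneous of degree 1/2, and a^(1/4) enters a covariance twice. *)
Theorem self_similar_r : self_similar P 4^-1 r.
Proof.
move=> a a0; have mr := centered_gaussian_process_mfun r_gauss.
have D0 (t : R) : `[0, +oo[%classic t -> 0 <= t by rewrite /= in_itv/= andbT.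
have Da (t : R) : `[0, +oo[%classic t -> `[0, +oo[%classic (a * t).
  by move/D0 => t0; rewrite /= in_itv/= andbT mulr_ge0// ltW.
apply: eq_in_law_cgauss.
- by move=> t /Da; exact: mr.
- by move=> t /mr mrt; exact: measurable_funM.
- move=> Z sZ; apply: cgauss_lin_span r_gauss _; apply: sub_lin_span sZ.
  by move=> t Dt; exact: (lin_span_gen r (Da t Dt)).
- move=> Z sZ; apply: cgauss_lin_span r_gauss _; apply: sub_lin_span sZ.
  by move=> t Dt; apply: lin_spanZ; exact: (lin_span_gen r Dt).
move=> s t Ds Dt; rewrite rcovE ?(D0 _ (Da _ _))//.
have ia : (forall w, (a `^ 4^-1 * r s w * (a `^ 4^-1 * r t w))%:E =
    (Num.sqrt a)%:E * (r s w * r t w)%:E)%E.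
  move=> w; rewrite -EFinM mulrACA; congr (_ * _)%:E.
  rewrite -powRD; last by rewrite gt_eqF// implybT.
  by rewrite -[RHS]powR12_sqrt ?ltW//; congr (_ `^ _); lra.
under [RHS]eq_integral do rewrite ia.
rewrite integralZl//; last first.
  apply: integrable_mul; [exact: mr|exact: mr| |].
  - exact: centered_gaussian_process_msq r_gauss Ds.
  - exact: centered_gaussian_process_msq r_gauss Dt.
rewrite rcovE ?D0// -EFinM; congr EFin; rewrite /rcov -mulrDr -mulrBr.
by rewrite normrM gtr0_norm// !sqrtrM ?ltW// mulrBr.
Qed.

(** In the covariance of nu(t) - nu(-t), the terms sqrt s and sqrt t of the four covariances cancel;
    sqrt(s + t) and - sqrt |s - t| each occur twice with weight 1/2. *)
Theorem fbm_r d1 (T1 : measurableType d1) (P1 : probability T1 R)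
  (nu : R -> T1 -> R) : two_sided_fbm P1 4^-1 nu ->
  equal_in_law `[0, +oo[%classic P r P1 (fun t w => 2 * odd_part nu t w).
Proof.
move=> [gnu nucov]; have mnu := centered_gaussian_process_mfun gnu.
have mr := centered_gaussian_process_mfun r_gauss.
have D0 (t : R) : `[0, +oo[%classic t -> 0 <= t by rewrite /= in_itv/= andbT.
have oddE t w : 2 * odd_part nu t w = nu t w + -1 * nu (- t) w.
  by rewrite /odd_part mulrA divff ?mul1r ?mulN1r.
rewrite (_ : (fun t w => _) = (fun t w => nu t w + -1 * nu (- t) w)); last first.
  by apply/funext => t; apply/funext => w; exact: oddE.
have inu s t : P1.-integrable setT (fun w => (nu s w * nu t w)%:E).
  apply: integrable_mul; [exact: mnu|exact: mnu| |].
  - exact: centered_gaussian_process_msq gnu _.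
  - exact: centered_gaussian_process_msq gnu _.
apply: eq_in_law_cgauss => //.
- move=> t _; apply: measurable_funD; first exact: mnu.
  by apply: measurable_funM => //; exact: mnu.
- by move=> Z sZ; apply: cgauss_lin_span r_gauss sZ.
- move=> Z sZ; apply: cgauss_lin_span gnu _; apply: sub_lin_span sZ.
  move=> t Dt; apply: lin_spanD; first exact: lin_span_gen.
  by apply: lin_spanZ; exact: lin_span_gen.
have nuE s t : (\int[P1]_w (nu s w * nu t w)%:E = (2^-1 *
    (Num.sqrt `|s| + Num.sqrt `|t| - Num.sqrt `|s - t|))%:E)%E.
  have := nucov t s; rewrite unlock => ->; congr (_ * _)%:E.
  have -> : 2 * 4^-1 = 2^-1 :> R by lra.
  by rewrite !powR12_sqrt.
move=> s t /D0 s0 /D0 t0; rewrite rcovE//.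
have fE w : ((nu s w + -1 * nu (- s) w) * (nu t w + -1 * nu (- t) w))%:E =
   ((nu s w * nu t w)%:E - (nu s w * nu (- t) w)%:E
    - ((nu (- s) w * nu t w)%:E - (nu (- s) w * nu (- t) w)%:E))%E.
  by rewrite -!EFinB; congr EFin; ring.
under [RHS]eq_integral do rewrite fE.
rewrite integralB//; [|exact: integrableB|exact: integrableB].
rewrite !integralB// !nuE -!EFinB; congr EFin.
rewrite /rcov !opprK.
have -> : - s - t = - (s + t) by rewrite opprD.
have -> : - s + t = - (s - t) by rewrite opprB addrC.
by rewrite !normrN (ger0_norm (addr_ge0 s0 t0)) (ger0_norm s0) (ger0_norm t0); lra.
Qed.

End self_similar_and_fbm.

(** * Continuity of paths *)

Section geometric_increments.
Context {R : realType}.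

(** [K n] is the sum of the bounds from rank n on, so from rank N on u - K increases and u + K
    decreases: the limit lies between them, which gives the rate at once. *)
Lemma cvg_geometric_increments (u : nat -> R) (c q : R) N : 0 < q < 1 ->
  0 <= c -> (forall n, (N <= n)%N -> `|u n.+1 - u n| <= c * q ^+ n) ->
  exists2 l : R, u @ \oo --> l &
    forall n, (N <= n)%N -> `|l - u n| <= c * q ^+ n / (1 - q).
Proof.
move=> /andP[q0 q1] c0 uN; have p0 : 0 < 1 - q by rewrite subr_gt0.
pose K (n : nat) : R := c * q ^+ n / (1 - q).
have K0 n : 0 <= K n by rewrite /K divr_ge0 ?(ltW p0)// mulr_ge0// exprn_ge0// ltW.
have Kq n : K n - K n.+1 = c * q ^+ n.
  by rewrite /K exprS; field; rewrite gt_eqF.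
pose v (n : nat) := u (n + N)%N - K (n + N)%N.
pose w (n : nat) := u (n + N)%N + K (n + N)%N.
have uK n : (N <= n)%N -> u n - K n <= u n.+1 - K n.+1 /\ u n.+1 + K n.+1 <= u n + K n.
  move=> Nn; have := uN n Nn; rewrite -Kq ler_norml => /andP[? ?].
  by split; lra.
have vnd : nondecreasing_seq v.
  by apply/nondecreasing_seqP => n; rewrite /v addSn; apply: (uK _ _).1; exact: leq_addl.
have wni : nonincreasing_seq w.
  by apply/nonincreasing_seqP => n; rewrite /w addSn; apply: (uK _ _).2; exact: leq_addl.
have vw n m : v n <= w m.
  apply: (@le_trans _ _ (v (maxn n m))); first by apply: vnd; exact: leq_maxl.
  apply: (@le_trans _ _ (w (maxn n m))); last by apply: wni; exact: leq_maxr.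
  by rewrite /v /w lerD2l (le_trans _ (K0 _))// oppr_le0.
have cv : cvgn v.
  apply: nondecreasing_is_cvgn => //; exists (w 0%N) => _ [n _ <-]; exact: vw.
have Kc : K @ \oo --> (0 : R).
  rewrite -(mulr0 (c / (1 - q))).
  rewrite (_ : K = (fun n => c / (1 - q) * q ^+ n)); last first.
    by apply/funext => n; rewrite /K mulrAC.
  apply: cvgM; first exact: cvg_cst.
  by apply: cvg_expr; rewrite gtr0_norm.
have ucv : u @ \oo --> limn v.
  rewrite -(cvg_shiftn N) /=.
  rewrite (_ : (fun n => u (n + N)%N) = (fun n => v n + K (n + N)%N)); last first.
    by apply/funext => n; rewrite /v subrK.
  rewrite -[limn v]addr0; apply: cvgD; first exact: cv.
  by have := Kc; rewrite -(cvg_shiftn N).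
exists (limn v) => // n Nn.
have -> : u n = u (n - N + N)%N by rewrite subnK.
rewrite -/(K n) -{2}(subnK Nn) ler_norml; apply/andP; split.
  have := nondecreasing_cvgn_le vnd cv (n - N); rewrite /v; lra.
have : limn v <= w (n - N)%N by apply: limr_le => //; apply: nearW => m; exact: vw.
by rewrite /w; lra.
Qed.

End geometric_increments.

Section dyadic_steps.
Context {R : realType}.
Implicit Types (f : R -> R) (s t q : R).

Definition dyad (n : nat) t : R := (Num.truncn (2 ^+ n * t))%:R / 2 ^+ n.

Lemma dyad_ge0 n t : 0 <= dyad n t.
Proof. by rewrite divr_ge0. Qed.

Lemma dyad_dist n t : 0 <= t -> `|dyad n t - t| <= 2 ^- n.
Proof.
move=> t0; have n0 : 0 < 2 ^+ n :> R by rewrite exprn_gt0.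
have /andP[h1 h2] := truncn_itv (mulr_ge0 (ltW n0) t0).
have -> : dyad n t - t = ((Num.truncn (2 ^+ n * t))%:R - 2 ^+ n * t) / 2 ^+ n.
  by rewrite mulrBl mulrAC divff ?mul1r// gt_eqF.
rewrite normrM normfV (gtr0_norm n0) ler_pdivrMr// mulVf ?gt_eqF//.
by move: h2; rewrite -(natr1 (Num.truncn _)) ler_norml => h2; apply/andP; split; lra.
Qed.

Context (f : R -> R) (q : R) (N : nat).
Hypothesis q01 : 0 < q < 1.
(** The 4^n cells of length 2^-n cover [0, 2^n]. The conditions t + 1 <= 2^n below keep the grid
    points under consideration inside this window. *)
Hypothesis fq : forall n k, (N <= n)%N -> (k < 4 ^ n)%N ->
  `|f (k.+1%:R / 2 ^+ n) - f (k%:R / 2 ^+ n)| <= q ^+ n.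

Let q0 n : 0 <= q ^+ n.
Proof. by rewrite exprn_ge0// ltW//; case/andP: q01. Qed.

(** Two successive dyadic approximations of [t] are equal or are neighbours in the finer grid,
    according to the half of the cell in which [t] lies. *)
Lemma dyad_incr n t : 0 <= t -> t + 1 <= 2 ^+ n -> (N <= n)%N ->
  `|f (dyad n.+1 t) - f (dyad n t)| <= q * q ^+ n.
Proof.
move=> t0 tn Nn; rewrite -exprS; have n0 : 0 < 2 ^+ n :> R by rewrite exprn_gt0.
rewrite /dyad; set k := Num.truncn (2 ^+ n * t).
have /andP[k1 k2] : k%:R <= 2 ^+ n * t < k.+1%:R.
  by apply: truncn_itv; rewrite mulr_ge0// ltW.
have k2E : k%:R / 2 ^+ n = (k.*2)%:R / 2 ^+ n.+1 :> R.
  by rewrite -muln2 natrM exprSr -mulf_div divff ?mulr1.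
move: k2; rewrite -(natr1 k) => k2.
have [h|h] := ltP (2 ^+ n.+1 * t) (k.*2.+1)%:R.
  rewrite (@truncn_def _ _ k.*2) ?k2E ?subrr ?normr0//.
  rewrite h andbT -muln2 natrM exprS -mulrA mulrC.
  by rewrite ler_pM2l.
rewrite (@truncn_def _ _ k.*2.+1) ?k2E; last first.
  rewrite h /= -doubleS -muln2 natrM exprS -mulrA mulrC ltr_pM2r//.
  by rewrite -(natr1 k).
apply: fq; first exact: leqW.
rewrite -(ltr_nat R) natrX -mul2n natrM exprS.
have -> : (4 : R) ^+ n = 2 ^+ n * 2 ^+ n by rewrite -exprMn -natrM.
have : 2 ^+ n * t <= 2 ^+ n * 2 ^+ n by rewrite ler_pM2l//; lra.
have : 0 < 2 ^+ n * 2 ^+ n :> R by rewrite mulr_gt0.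
by set y := 2 ^+ n * 2 ^+ n; lra.
Qed.

(** Two times at distance at most 2^-n lie in the same cell or in adjacent cells. *)
Lemma dyad_close n s t : 0 <= s -> 0 <= t -> s + 1 <= 2 ^+ n ->
  t + 1 <= 2 ^+ n -> `|s - t| <= 2 ^- n -> (N <= n)%N ->
  `|f (dyad n s) - f (dyad n t)| <= q ^+ n.
Proof.
wlog st : s t / s <= t.
  move=> h s0 t0 sn tn d Nn; have [|/ltW] := leP s t => ?; first exact: h.
  by rewrite distrC; apply: h => //; rewrite distrC.
move=> s0 t0 sn tn d Nn; have n0 : 0 < 2 ^+ n :> R by rewrite exprn_gt0.
have {}d : 2 ^+ n * t <= 2 ^+ n * s + 1.
  move: d; rewrite distrC ger0_norm ?subr_ge0// -(ler_pM2l n0) divff ?gt_eqF//.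
  by rewrite mulrBr; lra.
have st' : 2 ^+ n * s <= 2 ^+ n * t by rewrite ler_pM2l.
rewrite /dyad; set k := Num.truncn (2 ^+ n * s).
have /andP[k1 k2] : k%:R <= 2 ^+ n * s < k.+1%:R.
  by apply: truncn_itv; rewrite mulr_ge0// ltW.
have [h|h] := ltP (2 ^+ n * t) k.+1%:R.
  rewrite (@truncn_def _ (2 ^+ n * t) k) ?subrr ?normr0//.
  by rewrite h andbT (le_trans k1).
rewrite (@truncn_def _ (2 ^+ n * t) k.+1); last first.
  by rewrite h /= -(natr1 k.+1) -(natr1 k); move: k2; rewrite -(natr1 k); lra.
rewrite distrC; apply: fq => //.
rewrite -(ltr_nat R) natrX.
have -> : (4 : R) ^+ n = 2 ^+ n * 2 ^+ n by rewrite -exprMn -natrM.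
apply: (le_lt_trans k1); rewrite ltr_pM2l//; lra.
Qed.

Lemma pow2_ge t : exists n0, forall n, (n0 <= n)%N -> t <= 2 ^+ n.
Proof.
exists (Num.truncn t).+1 => n tn.
rewrite (le_trans (ltW (truncnS_gt t)))// -natrX ler_nat.
by rewrite (leq_trans tn)// ltnW// ltn_expl.
Qed.

Lemma dyad_cvg t : 0 <= t -> exists2 l : R,
  f (dyad n t) @[n --> \oo] --> l &
  forall n, (N <= n)%N -> t + 1 <= 2 ^+ n ->
    `|l - f (dyad n t)| <= q * q ^+ n / (1 - q).
Proof.
move=> t0; have [n0 tn0] := pow2_ge (t + 1).
have [||l fl _] := @cvg_geometric_increments _ (fun n => f (dyad n t)) q q
    (maxn N n0) q01.
- by rewrite ltW//; case/andP: q01.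
- move=> n; rewrite geq_max => /andP[Nn n0n]; apply: dyad_incr => //.
  exact: tn0.
exists l => // n Nn tn.
(* The rate is obtained by starting again from rank n itself: the first application only gives it
   from [maxn N n0] on. *)
have [||l' fl' fn] := @cvg_geometric_increments _ (fun n => f (dyad n t)) q q n q01.
- by rewrite ltW//; case/andP: q01.
- move=> m nm; apply: dyad_incr => //; last exact: leq_trans nm.
  by rewrite (le_trans tn)// ler_weXn2l// ler1n.
suff -> : l = l' by exact: fn.
exact: (cvg_unique _ fl fl').
Qed.

(** The rate of [dyad_cvg] depends on the time only through the window, so at a common level n it
    holds for x and for a nearby y; [dyad_close] compares the two grid values. *)
Lemma continuous_dyad_lim (g : R -> R) :
  (forall t, 0 <= t -> f (dyad n t) @[n --> \oo] --> g t) ->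
  {within `[0, +oo[%classic, continuous g}.
Proof.
move=> fg; have /andP[qp q1] := q01.
have p0 : 0 < 1 - q by rewrite subr_gt0.
have gn t n : 0 <= t -> (N <= n)%N -> t + 1 <= 2 ^+ n ->
    `|g t - f (dyad n t)| <= q * q ^+ n / (1 - q).
  move=> t0 Nn tn; have [l fl lb] := dyad_cvg t0.
  by rewrite (cvg_unique _ (fg t t0) fl) //; exact: lb.
apply/subspace_continuousP => x; rewrite /= in_itv/= andbT => x0.
apply/cvgrPdist_le => e e0.
(* The factor is the total error in units of q^n: twice the tail q / (1 - q), plus one step of the
   grid. *)
have /cvgrPdist_lt/(_ e e0) [n1 _ hn1] :
    (2 * (q / (1 - q)) + 1) * q ^+ n @[n --> \oo] --> (0 : R).
  rewrite -[X in _ --> X](mulr0 (2 * (q / (1 - q)) + 1)).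
  by apply: cvgM; [exact: cvg_cst|apply: cvg_expr; rewrite gtr0_norm].
(* The margin 2 instead of 1 keeps every y at distance at most 1 from x in the same window. *)
have [n2 hn2] := pow2_ge (x + 2).
pose n := maxn N (maxn n1 n2).
have Nn : (N <= n)%N by exact: leq_maxl.
have n1n : (n1 <= n)%N by rewrite /n !leq_max leqnn orbT.
have n2n : (n2 <= n)%N by rewrite /n !leq_max leqnn !orbT.
have := hn1 n n1n; rewrite /= sub0r normrN ger0_norm; last first.
  rewrite mulr_ge0// addr_ge0// mulr_ge0// divr_ge0// ltW//.
move=> en; have xn := hn2 n n2n.
have n0 : 0 < 2 ^+ n :> R by rewrite exprn_gt0.
rewrite near_withinE; near=> y; rewrite /= in_itv/= andbT => y0.
have xy : `|x - y| <= 2 ^- n.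
  near: y; apply: (@cvgr_dist_le _ _ _ _ _ id x) => //.
have n2' : 2 ^- n <= 1 :> R.
  rewrite invf_le1//; apply: exprn_ege1; lra.
have yn : y + 1 <= 2 ^+ n.
  by move: xy; rewrite ler_norml => /andP[? ?]; lra.
have h1 := gn x n x0 Nn (ltac:(lra)).
have h2 := gn y n y0 Nn yn.
have h3 : `|f (dyad n x) - f (dyad n y)| <= q ^+ n.
  by apply: dyad_close => //; lra.
have -> : g x - g y = (g x - f (dyad n x)) + (f (dyad n x) - f (dyad n y))
    + (f (dyad n y) - g y) by ring.
apply: (le_trans _ (ltW en)); rewrite !(le_trans (ler_normD _ _))//.
rewrite (distrC _ (g y)).
have -> : (2 * (q / (1 - q)) + 1) * q ^+ n =
    q * q ^+ n / (1 - q) + q ^+ n + q * q ^+ n / (1 - q) by field; rewrite gt_eqF.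
rewrite lerD// (le_trans (ler_normD _ _))// lerD//.
Unshelve. all: by end_near. Qed.

End dyadic_steps.

Section borel_cantelli_geometric.
Context {R : realType} {d : measure_display} {T : measurableType d}.
Implicit Types F : nat -> set T.

Lemma measurable_lim_sup_set F : (forall n, measurable (F n)) ->
  measurable (lim_sup_set F).
Proof.
move=> mF; apply: bigcapT_measurable => n; apply: bigcup_measurable => k _.
exact: mF.
Qed.

Lemma notin_lim_sup_set F w : ~ lim_sup_set F w ->
  exists N, forall n, (N <= n)%N -> ~ F n w.
Proof.
move=> /existsNP[N /not_implyP[_ h]]; exists N => n Nn Fn.
by apply: h; exists n.
Qed.

Lemma lim_sup_set_geometric (P : probability T R) (C : R) F : 0 <= C ->
  (forall n, measurable (F n)) ->
  (forall n, (P (F n) <= (C / (2 ^ n.+1)%:R)%:E)%E) ->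
  P (lim_sup_set F) = 0%E.
Proof.
move=> C0 mF PF; apply: lim_sup_set_cvg0 => //.
apply: (@le_lt_trans _ _ C%:E); last exact: ltry.
apply: (le_trans _ (@epsilon_trick0 R C xpredT C0)).
by apply: lee_nneseries => [n _ _|n _]; [exact: measure_ge0|exact: PF].
Qed.

End borel_cantelli_geometric.

Section kolmogorov.
Context {R : realType} {d : measure_display} {T : measurableType d}.
Variables (P : probability T R) (X : R -> T -> R).
Hypothesis mX : process `[0, +oo[%classic X.
Variable C : R.
Hypothesis C0 : 0 <= C.
Hypothesis tailX : forall s t x : R, 0 <= s -> 0 <= t -> 0 < x ->
  (P [set w | (x <= `|X s w - X t w|)%R] <= (C * `|s - t| ^+ 4 / x ^+ 16)%:E)%E.

(* The threshold only has to satisfy [1/4 < q ^ 16 < 1]. *)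
Let q : R := 31 / 32.

Let q01 : 0 < q < 1.
Proof. by rewrite /q; apply/andP; split; lra. Qed.

Let qn0 n : 0 < q ^+ n.
Proof. by rewrite exprn_gt0//; case/andP: q01. Qed.

Let q16 n : 2 ^- n <= (q ^+ n) ^+ 16.
Proof.
rewrite exprAC -exprVn; apply: lerXn2r; rewrite ?nnegrE ?exprn_ge0//.
  by case/andP: q01 => /ltW.
(* The Bernoulli inequality gives (1 - 1/32)^16 >= 1 - 16/32 = 1/2. *)
have -> : q = 1 + - 32^-1 by rewrite /q; lra.
by apply: (le_trans _ (bernoulli_le 16 _)); lra.
Qed.

Let D0 (t : R) : 0 <= t -> `[0, +oo[%classic t.
Proof. by rewrite /= in_itv/= andbT. Qed.

Let mincr (s t x : R) : 0 <= s -> 0 <= t ->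
  measurable [set w | x <= `|X s w - X t w|].
Proof.
move=> s0 t0; rewrite -[X in measurable X]setTI.
apply: (@measurable_fun_le _ _ _ setT (cst x) (fun w => `|X s w - X t w|)) => //.
apply: measurableT_comp; first exact: normr_measurable.
by apply: measurable_funB; [exact: mX (D0 s0)|exact: mX (D0 t0)].
Qed.

(** As q^(16 n) >= 2^-n, the tail bound is at most C 2^(-3 n): the factor 4^-n pays for the union
    over the 4^n cells, and 2^-n remains for the Borel-Cantelli lemma. *)
Let tail_level (s t : R) n : 0 <= s -> 0 <= t -> `|s - t| <= 2 ^- n ->
  (P [set w | (q ^+ n <= `|X s w - X t w|)%R] <= (C * 2 ^- n / 4 ^+ n)%:E)%E.
Proof.
move=> s0 t0 stn; apply: (le_trans (tailX s0 t0 (qn0 n))).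
rewrite lee_fin -[leLHS]mulrA -[leRHS]mulrA ler_wpM2l//.
have p0 : 0 < 2 ^+ n :> R by rewrite exprn_gt0.
rewrite ler_pdivrMr; last by rewrite exprn_gt0.
apply: (@le_trans _ _ ((2 ^- n) ^+ 4)).
  by apply: lerXn2r; rewrite ?nnegrE// invr_ge0 ltW.
have -> : (2 ^- n) ^+ 4 = 2 ^- n / 4 ^+ n * 2 ^- n :> R.
  have -> : 4 ^+ n = 2 ^+ n * 2 ^+ n :> R by rewrite -exprMn -natrM.
  by field; rewrite gt_eqF.
by rewrite ler_wpM2l ?q16// mulr_ge0 ?invr_ge0 ?exprn_ge0.
Qed.

Let A (n : nat) : set T := \bigcup_(k < 4 ^ n)
  [set w | q ^+ n <= `|X (k.+1%:R / 2 ^+ n) w - X (k%:R / 2 ^+ n) w|].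

Let grid_ge0 k n : 0 <= k%:R / 2 ^+ n :> R.
Proof. by rewrite divr_ge0. Qed.

Let mA n : measurable (A n).
Proof. by apply: bigcup_measurable => k _; exact: mincr. Qed.

Let PA n : (P (A n) <= ((2 * C) / (2 ^ n.+1)%:R)%:E)%E.
Proof.
apply: (@le_trans _ _ (\sum_(k < 4 ^ n) (C * 2 ^- n / 4 ^+ n)%:E)%E).
  pose E k := [set w | q ^+ n <=
    `|X (k.+1%:R / 2 ^+ n) w - X (k%:R / 2 ^+ n) w|].
  apply: (@le_trans _ _ (\sum_(k < 4 ^ n) P (E k))%E).
    apply: content_subadditive; [by move=> k _; exact: mincr|exact: mA|].
    by rewrite /A bigcup_mkord.
  apply: lee_sum => k _; apply: tail_level => //.
  rewrite -mulrBl -natr1 addrAC subrr add0r mul1r ger0_norm//.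
rewrite sumEFin lee_fin sumr_const card_ord -(mulr_natr _ (4 ^ n)) natrX.
rewrite divfK ?expf_neq0// natrX exprS -mulf_div divff ?mul1r//.
Qed.

Let good : set T := ~` lim_sup_set A.

Let good_lim w : good w -> exists N, forall n k, (N <= n)%N -> (k < 4 ^ n)%N ->
  `|X (k.+1%:R / 2 ^+ n) w - X (k%:R / 2 ^+ n) w| <= q ^+ n.
Proof.
move=> /notin_lim_sup_set[N hN]; exists N => n k Nn kn.
rewrite leNgt; apply/negP => h; apply: (hN n Nn).
by exists k => //=; exact: ltW.
Qed.

Let good_cvg w (t : R) : good w -> 0 <= t ->
  exists l : R, X (dyad n t) w @[n --> \oo] --> l.
Proof.
move=> /good_lim[N hN] t0.
by have [l ? _] := @dyad_cvg _ (X^~ w) q N q01 hN t t0; exists l.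
Qed.

(** The indicator makes [Y] vanish on the exceptional event, so that every path, and not only almost
    every path, converges and is continuous. *)
Let Y (t : R) (w : T) : R :=
  lim (\1_good w * X (dyad n t) w @[n --> \oo]).

Let Y_cvg (t : R) w : 0 <= t -> \1_good w * X (dyad n t) w @[n --> \oo] --> Y t w.
Proof.
move=> t0; rewrite /Y indicE; case: (boolP (w \in good)) => gw.
  have [l Xl] := good_cvg (set_mem gw) t0.
  under eq_fun do rewrite mul1r.
  by apply: cvgP Xl.
under eq_fun do rewrite mul0r.
exact: is_cvg_cst.
Qed.

Let mY : process `[0, +oo[%classic Y.
Proof.
move=> t; rewrite /= in_itv/= andbT => t0.
apply: (measurable_fun_cvg (h := fun n w => \1_good w * X (dyad n t) w)).
  move=> n; apply: measurable_funM; last by apply/mX/D0; exact: dyad_ge0.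
  by apply: measurable_indic; apply: measurableC; exact: measurable_lim_sup_set.
by move=> w _; exact: Y_cvg.
Qed.

Let continuous_Y w : {within `[0, +oo[%classic, continuous (Y^~ w)}.
Proof.
have [gw|gw] := pselect (good w).
  have [N hN] := good_lim gw.
  apply: (@continuous_dyad_lim _ (X^~ w) q N q01 hN) => t t0.
  have := @Y_cvg t w t0; rewrite indicE mem_set//.
  by under eq_fun do rewrite mul1r.
rewrite (_ : Y^~ w = cst 0); first by apply: continuous_subspaceT => x; exact: cvg_cst.
apply/funext => t; rewrite /Y indicE memNset//.
under eq_fun do rewrite mul0r.
exact: lim_cst.
Qed.

(** A second use of the Borel-Cantelli lemma, at the fixed time [t]: [dyad n t] is within 2^-n of
    [t], so [X (dyad n t)] converges almost surely to [X t] as well as to [Y t]. *)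
Let Y_modification (t : R) : 0 <= t -> P [set w | Y t w = X t w] = 1%E.
Proof.
move=> t0.
pose B n := [set w | q ^+ n <= `|X (dyad n t) w - X t w|].
have mB n : measurable (B n) by apply: mincr => //; exact: dyad_ge0.
have PB n : (P (B n) <= ((2 * C) / (2 ^ n.+1)%:R)%:E)%E.
  apply: (le_trans (tail_level (dyad_ge0 _ _) t0 (dyad_dist _ t0))).
  rewrite lee_fin natrX exprS -mulf_div divff ?mul1r// ler_piMr//.
    by rewrite divr_ge0.
  by rewrite invf_le1 ?exprn_gt0//; apply: exprn_ege1; lra.
have mE : measurable [set w | Y t w = X t w].
  have mYX : measurable_fun setT (fun w => Y t w - X t w).
    by apply: measurable_funB; [exact: mY (D0 t0)|exact: mX (D0 t0)].
  rewrite (_ : [set w | _] = setT `&` (fun w => Y t w - X t w) @^-1` [set 0]).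
    exact: mYX.
  apply/seteqP; split => w /=; first by move=> ->; rewrite subrr.
  by move=> [_ /eqP]; rewrite subr_eq0 => /eqP.
have sE : ~` [set w | Y t w = X t w] `<=` lim_sup_set A `|` lim_sup_set B.
  move=> w; apply: contra_notP => /not_orP[gw /notin_lim_sup_set[N hN]] /=.
  have := @Y_cvg t w t0; rewrite indicE mem_set//.
  under eq_fun do rewrite mul1r.
  move=> hY; apply: (cvg_unique _ hY); first exact: Rhausdorff.
  apply/cvgrPdist_le => e e0.
  have qe : \forall n \near \oo, q ^+ n <= e.
    have /cvgrPdist_le/(_ e e0) : GRing.exp q @ \oo --> (0 : R).
      by apply: cvg_expr; rewrite gtr0_norm; case/andP: q01.
    by apply: filterS => n; rewrite sub0r normrN gtr0_norm.
  near=> n; rewrite distrC; apply: (@le_trans _ _ (q ^+ n)); last by near: n.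
  rewrite leNgt; apply/negP => h; apply: (hN n); last exact: ltW.
  by near: n; exact: nbhs_infty_ge.
have Ec : P (~` [set w | Y t w = X t w]) = 0%E.
  apply/eqP; rewrite -measure_le0.
  apply: (@le_trans _ _ (P (lim_sup_set A `|` lim_sup_set B))).
    apply: le_measure => //; rewrite inE; first exact: measurableC.
    by apply: measurableU; exact: measurable_lim_sup_set.
  apply: (@le_trans _ _ (P (lim_sup_set A) + P (lim_sup_set B))%E).
    by apply: measureU2; exact: measurable_lim_sup_set.
  by rewrite !(@lim_sup_set_geometric _ _ _ _ (2 * C))// ?mulr_ge0// adde0.
by have := probability_setC P (measurableC mE); rewrite setCK Ec sube0.
Unshelve. all: by end_near. Qed.

Theorem kolmogorov_continuous_modification :
  has_continuous_modification P `[0, +oo[%classic X.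
Proof.
exists Y; split => // t; rewrite /= in_itv/= andbT; exact: Y_modification.
Qed.

End kolmogorov.

(** * Gaussian tails and the increments of [r] *)

Section continuity_of_r.
Context {R : realType} {d : measure_display} {T : measurableType d}.
Local Open Scope ereal_scope.

(** The Markov inequality for the moment of order 2j, which scales as the power j of the
    variance. *)
Lemma gaussian_tail (P : probability T R) (Z : T -> R) (j : nat) (v x : R) :
  gaussian_rv P Z -> 'E_P[Z] = 0 -> msq P Z <= v%:E -> (0 < x)%R ->
  P [set w | (x <= `|Z w|)%R] <=
    ((v / std_var) ^+ j * fine (\int[@normal_prob R 0 1]_z (z ^+ j.*2)%:E)
      / x ^+ j.*2)%:E.
Proof.
move=> gZ EZ Zv x0; have sv0 : (0 < @std_var R)%R := std_var_gt0.
have [s [s0 ZE intZ]] := centered_gaussian_integral gZ EZ.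
have mZ : measurable_fun setT Z := gZ.1.
have xj0 : (0 < x ^+ j.*2)%R by rewrite exprn_gt0.
have m0 : 0 <= \int[@normal_prob R 0 1]_z (z ^+ j.*2)%:E.
  by apply: integral_ge0 => z _; rewrite lee_fin exprn_even_ge0// odd_double.
have mE : \int[@normal_prob R 0 1]_z (z ^+ j.*2)%:E =
    (fine (\int[@normal_prob R 0 1]_z (z ^+ j.*2)%:E))%:E.
  by rewrite fineK// ge0_fin_numE// std_moment_fin.
set m := fine _ in mE *.
have m0' : (0 <= m)%R by rewrite -lee_fin -mE.
have sv : (s ^+ 2 <= v / std_var)%R.
  by rewrite ler_pdivlMr// -lee_fin -ZE.
have mZj : measurable_fun setT (fun w => (Z w ^+ j.*2)%:E).
  by apply/measurable_EFinP; exact: measurable_funX.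
have := le_integral_abse P measurableT mZj xj0.
have -> : \int[P]_w `|(Z w ^+ j.*2)%:E| = (s ^+ j.*2 * m)%:E.
  transitivity (\int[P]_w (Z w ^+ j.*2)%:E).
    apply: eq_integral => w _; rewrite gee0_abs// lee_fin.
    by rewrite exprn_even_ge0// odd_double.
  rewrite (intZ (fun x => x ^+ j.*2)%R); last exact: exprn_continuous.
  under eq_integral do rewrite exprMn EFinM.
  rewrite ge0_integralZl_EFin//; first by rewrite mE EFinM.
  - by move=> z _; rewrite lee_fin exprn_even_ge0// odd_double.
  - by apply/measurable_EFinP; exact: exprn_measurable.
  - by rewrite exprn_ge0.
have -> : setT `&` [set w | (x ^+ j.*2)%:E <= `|(Z w ^+ j.*2)%:E|] =
    [set w | (x ^+ j.*2 <= `|Z w| ^+ j.*2)%R].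
  by apply/seteqP; split => w /=; rewrite lee_fin normrX //; case.
move=> h; apply: (@le_trans _ _ (P [set w | (x ^+ j.*2 <= `|Z w| ^+ j.*2)%R])).
  apply: le_measure; rewrite ?inE.
  - rewrite -[X in measurable X]setTI.
    apply: (@measurable_fun_le _ _ _ setT (cst x) (fun w => `|Z w|%R)) => //.
    by apply: measurableT_comp; [exact: normr_measurable|].
  - rewrite -[X in measurable X]setTI.
    apply: (@measurable_fun_le _ _ _ setT (cst _)
      (fun w => `|Z w| ^+ j.*2)%R) => //.
    apply: measurable_funX.
    by apply: measurableT_comp; [exact: normr_measurable|].
  - by move=> w /= xw; apply: lerXn2r; rewrite ?nnegrE// ltW.
rewrite EFinM -(@lee_pmul2l _ (x ^+ j.*2)%:E) ?fin_numE ?lte_fin//.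
apply: (le_trans h); rewrite -!EFinM lee_fin mulrCA divff ?gt_eqF// mulr1.
rewrite ler_wpM2r// -muln2 mulnC exprM.
by apply: lerXn2r; rewrite ?nnegrE ?sqr_ge0// (le_trans _ sv)// sqr_ge0.
Qed.

Variables (P : probability T R) (r : R -> T -> R).
Hypothesis r_gauss : centered_gaussian_process P `[0%R, +oo[%classic r.
Hypothesis r_cov : forall t t' : R, (0 <= t')%R -> (t' <= t)%R ->
  'E_P[r t \* r t']%E = (Num.sqrt (t + t') - Num.sqrt (t - t'))%:E.

Let D0 (t : R) : (0 <= t)%R -> `[0%R, +oo[%classic t.
Proof. by rewrite /= in_itv/= andbT. Qed.

(** The variance is sqrt(2s) + sqrt(2t) - 2 sqrt(s + t) + 2 sqrt |s - t|, and the first three terms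
    have a nonpositive sum by concavity of the square root. *)
Lemma msq_incr_r (s t : R) : (0 <= s)%R -> (0 <= t)%R ->
  msq P (fun w => r s w - r t w)%R <= (2 * Num.sqrt `|s - t|)%:E.
Proof.
move=> s0 t0; have mr := centered_gaussian_process_mfun r_gauss.
have ir (a b : R) : (0 <= a)%R -> (0 <= b)%R ->
    P.-integrable setT (fun w => (r a w * r b w)%:E).
  move=> /D0 a0 /D0 b0; apply: integrable_mul; [exact: mr|exact: mr| |].
  - exact: centered_gaussian_process_msq r_gauss a0.
  - exact: centered_gaussian_process_msq r_gauss b0.
have fE w : ((r s w - r t w) ^+ 2)%:E =
   (r s w * r s w)%:E - (r s w * r t w)%:E
    - ((r t w * r s w)%:E - (r t w * r t w)%:E).
  by rewrite -!EFinB; congr EFin; ring.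
rewrite /msq; under eq_integral do rewrite fE.
have i1 : P.-integrable setT (fun w => (r s w * r s w)%:E - (r s w * r t w)%:E).
  by apply: integrableB => //; exact: ir.
have i2 : P.-integrable setT (fun w => (r t w * r s w)%:E - (r t w * r t w)%:E).
  by apply: integrableB => //; exact: ir.
rewrite integralB// !integralB//; try exact: ir.
rewrite !(rcovE r_cov)// -!EFinB lee_fin /rcov !subrr normr0 sqrtr0.
rewrite (addrC t s) (distrC t s) !subr0 -mulr2n -(mulr2n t).
set S := (Num.sqrt (s + t))%R; set H := (Num.sqrt `|s - t|)%R.
have : (Num.sqrt (s *+ 2) + Num.sqrt (t *+ 2) <= 2 * S)%R.
  rewrite -(@ler_pXn2r _ 2)// ?nnegrE ?addr_ge0 ?mulr_ge0 ?sqrtr_ge0//.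
  rewrite exprMn [(S ^+ 2)%R]sqr_sqrtr ?addr_ge0//.
  have hs : (Num.sqrt (s *+ 2) ^+ 2 = s *+ 2)%R by rewrite sqr_sqrtr// mulrn_wge0.
  have ht : (Num.sqrt (t *+ 2) ^+ 2 = t *+ 2)%R by rewrite sqr_sqrtr// mulrn_wge0.
  move: (Num.sqrt (s *+ 2)) (Num.sqrt (t *+ 2)) hs ht => a b.
  rewrite !mulr2n => aE bE; have := sqr_ge0 (a - b)%R; nra.
by lra.
Qed.

Theorem continuous_r : has_continuous_modification P `[0%R, +oo[%classic r.
Proof.
have mr := centered_gaussian_process_mfun r_gauss.
(* The constant of [gaussian_tail] with j = 8 and v = 2 sqrt |s - t|, whose power 8 is 2^8 |s -
   t|^4. *)
pose C : R := ((2 / std_var) ^+ 8 *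
  fine (\int[@normal_prob R 0 1]_z (z ^+ 16)%:E))%R.
apply: (@kolmogorov_continuous_modification _ _ _ _ _ mr C) => //.
  rewrite mulr_ge0 ?exprn_ge0 ?divr_ge0 ?(ltW std_var_gt0)//.
  by apply/fine_ge0/integral_ge0 => z _; rewrite lee_fin exprn_even_ge0.
move=> s t x s0 t0 x0.
have sZ : lin_span `[0%R, +oo[%classic r (fun w => r s w - r t w)%R.
  have := lin_spanD (lin_span_gen r (D0 s0)) (lin_spanZ (-1) (lin_span_gen r (D0 t0))).
  congr (lin_span _ _ _); apply/funext => w; by rewrite mulN1r.
have [gZ EZ] := gaussian_lin_span r_gauss sZ.
apply: (le_trans (gaussian_tail 8 gZ EZ (msq_incr_r s0 t0) x0)).
rewrite lee_fin le_eqVlt; apply/orP; left; apply/eqP; congr (_ / _)%R.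
rewrite /C [RHS]mulrAC; congr (_ * _)%R.
have hE : (`|s - t| ^+ 4 = Num.sqrt `|s - t| ^+ 8)%R.
  by rewrite (exprM _ 2 4) sqr_sqrtr.
by rewrite hE -exprMn; congr (_ ^+ _)%R; rewrite mulrAC.
Qed.

End continuity_of_r.

(** * Wiener integrals *)

Section Lnorm2.
Context {R : realType} {d : measure_display} {T : measurableType d}.
Variable mu : {measure set T -> \bar R}.
Implicit Types f g : T -> R.
Local Open Scope ereal_scope.
Local Notation L f := ('N[mu]_2%:E[EFin \o f]).

Lemma cvge0P (u : nat -> \bar R) : (forall n, 0 <= u n) ->
  u @ \oo --> 0 <-> forall e : R, (0 < e)%R -> \forall n \near \oo, u n <= e%:E.
Proof.
move=> u0; split=> [/fine_cvgP[ufin /cvgrPdist_le h] e e0|h].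
  near=> n; have ufn : u n \is a fin_num by near: n; exact: ufin.
  rewrite -(fineK ufn) lee_fin; apply: (le_trans (ler_norm _)).
  rewrite -normrN -[X in (`|X|)%R]sub0r; near: n; exact: h.
have h1 := h 1%R ltr01; apply/fine_cvgP; split.
  apply: filterS h1 => n un; rewrite ge0_fin_numE//.
  by apply: le_lt_trans un _; rewrite ltry.
apply/cvgrPdist_le => e e0; near=> n.
have un : u n <= e%:E by near: n; exact: h.
have ufn : u n \is a fin_num by rewrite ge0_fin_numE// (le_lt_trans un)// ltry.
by rewrite sub0r normrN ger0_norm ?fine_ge0// -lee_fin fineK.
Unshelve. all: by end_near. Qed.

Lemma msq_Lnorm g : msq mu g = L g `^ 2.
Proof.
rewrite poweR_Lnorm//; apply: eq_integral => x _ /=.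
by rewrite powR_mulrn// real_normK// num_real.
Qed.

Lemma Lnorm_msq g : L g = msq mu g `^ 2^-1.
Proof.
have e : (2 * 2^-1 = 1 :> R)%R by lra.
by rewrite msq_Lnorm -poweRrM e poweRe1 ?Lnorm_ge0.
Qed.

Lemma Lnorm2_lty g : (L g < +oo) = (msq mu g < +oo).
Proof.
apply/idP/idP => h; first by rewrite msq_Lnorm poweR_lty.
by rewrite Lnorm_msq poweR_lty.
Qed.

Lemma Lnorm2_le_msq g (e : R) : (0 <= e)%R ->
  (L g <= e%:E) = (msq mu g <= (e ^+ 2)%:E).
Proof.
move=> e0; have eE : (e ^+ 2)%:E = e%:E `^ 2 by rewrite poweR_EFin powR_mulrn.
apply/idP/idP => h.
  rewrite eE msq_Lnorm; apply: gt0_ler_poweR => //.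
  - by rewrite in_itv /= Lnorm_ge0 leey.
  - by rewrite in_itv /= lee_fin e0 leey.
have e12 : (2 * 2^-1 = 1 :> R)%R by lra.
have -> : e%:E = (e ^+ 2)%:E `^ 2^-1.
  by rewrite eE -poweRrM e12 poweRe1// lee_fin.
rewrite Lnorm_msq; apply: gt0_ler_poweR => //.
- by rewrite in_itv /= msq_ge0 leey.
- by rewrite in_itv /= lee_fin sqr_ge0 leey.
Qed.

Lemma cvg_Lnorm2_msq (g_ : nat -> T -> R) :
  (L (g_ n) @[n --> \oo] --> 0) <-> (msq mu (g_ n) @[n --> \oo] --> 0).
Proof.
have L0 n : 0 <= L (g_ n) by exact: Lnorm_ge0.
have m0 n : 0 <= msq mu (g_ n) by exact: msq_ge0.
split => [/(cvge0P L0) h|/(cvge0P m0) h].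
  apply/(cvge0P m0) => e e0; have := h (Num.sqrt e).
  rewrite sqrtr_gt0 => /(_ e0); apply: filterS => n.
  by rewrite Lnorm2_le_msq ?sqrtr_ge0// sqr_sqrtr// ltW.
apply/(cvge0P L0) => e e0; have := h (e ^+ 2)%R (exprn_gt0 _ e0).
by apply: filterS => n; rewrite Lnorm2_le_msq// ltW.
Qed.

(** Minkowski's inequality in both directions; the finiteness of the norm of the limit is part of
    the conclusion. *)
Lemma Lnorm2_cvg (f_ : nat -> T -> R) f :
  (forall n, measurable_fun setT (f_ n)) -> measurable_fun setT f ->
  (forall n, L (f_ n) < +oo) -> L (f \- f_ n)%R @[n --> \oo] --> 0 ->
  L f < +oo /\ L (f_ n) @[n --> \oo] --> L f.
Proof.
move=> mf_ mf fn_fin f_f.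
have mB n : measurable_fun setT (f \- f_ n)%R by exact: measurable_funB.
have le1 n : L f <= L (f_ n) + L (f \- f_ n)%R.
  rewrite {1}(_ : f = f_ n \+ (f \- f_ n))%R; last first.
    by apply/funext => x /=; rewrite addrC subrK.
  by apply: minkowski_EFin => //; rewrite ler1n.
have le2 n : L (f_ n) <= L f + L (f \- f_ n)%R.
  rewrite {1}(_ : f_ n = f \+ (\- (f \- f_ n)))%R; last first.
    by apply/funext => x /=; rewrite opprB addrC subrK.
  rewrite -(oppe_Lnorm mu (EFin \o (f \- f_ n)%R)).
  by apply: minkowski_EFin => //; [exact: measurableT_comp|rewrite ler1n].
have [N _ hN] := (cvge0P (fun n => Lnorm_ge0 _ _ _)).1 f_f 1%R ltr01.
have f_fin : L f < +oo.
  apply: (le_lt_trans (le1 N)); apply: lte_add_pinfty => //.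
  by apply: le_lt_trans (hN N (leqnn N)) _; rewrite ltry.
split => //.
have fnum g : L g < +oo -> L g \is a fin_num by rewrite ge0_fin_numE ?Lnorm_ge0.
rewrite -(fineK (fnum _ f_fin)); apply/fine_cvgP; split.
  by apply: nearW => n; exact: fnum.
apply/cvgrPdist_le => e e0; near=> n.
have dn : L (f \- f_ n)%R <= e%:E.
  by near: n; exact: (cvge0P (fun n => Lnorm_ge0 _ _ _)).1.
have dfin : L (f \- f_ n)%R \is a fin_num.
  by apply: fnum; apply: le_lt_trans dn _; rewrite ltry.
have := le1 n; have := le2 n; move: dn.
rewrite /= -(fineK (fnum _ f_fin)) -(fineK (fnum _ (fn_fin n))) -(fineK dfin).
rewrite -!EFinD !lee_fin ler_norml => *; apply/andP; split; lra.
Unshelve. all: by end_near. Qed.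

Lemma msqD f g : measurable_fun setT f -> measurable_fun setT g ->
  msq mu f < +oo -> msq mu g < +oo ->
  msq mu (f \+ g)%R = msq mu f + msq mu g + 2%:E * \int[mu]_x (f x * g x)%:E.
Proof.
move=> mf mg f2 g2.
have i2 (h : T -> R) : measurable_fun setT h -> msq mu h < +oo ->
    mu.-integrable setT (fun x => (h x ^+ 2)%:E).
  move=> mh h2; have -> : (fun x => (h x ^+ 2)%:E) = (fun x => (h x * h x)%:E).
    by apply/funext => x; rewrite expr2.
  exact: integrable_mul.
have ifg := integrable_mul mf mg f2 g2.
rewrite /msq -integralZl// -integralD//; last 2 first.
- exact: i2.
- exact: i2.
rewrite -integralD//; last 2 first.
- by apply: integrableD => //; exact: i2.
- exact: integrableZl.
apply: eq_integral => x _; rewrite -EFinM -!EFinD; congr EFin => /=; ring.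
Qed.

Lemma msq_markov g (x : R) : measurable_fun setT g -> (0 < x)%R ->
  (x ^+ 2)%:E * mu [set w | (x <= `|g w|)%R] <= msq mu g.
Proof.
move=> mg x0; have mg2 := measurable_sqr mg.
have := le_integral_abse mu measurableT mg2 (exprn_gt0 2 x0).
rewrite setTI (_ : [set _ | _] = [set w | (x <= `|g w|)%R]); last first.
  apply/seteqP; split => w /=; rewrite lee_fin normrX => h.
    by rewrite -(@ler_pXn2r _ 2)// nnegrE// ltW.
  by apply: lerXn2r => //; rewrite nnegrE// ltW.
move=> h; apply: (le_trans h); rewrite le_eqVlt; apply/orP; left; apply/eqP.
by apply: eq_integral => w _; rewrite gee0_abs// lee_fin sqr_ge0.
Qed.

Lemma Lnorm2_dominated (f_ : nat -> T -> R) f :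
  (forall n, measurable_fun setT (f_ n)) -> measurable_fun setT f ->
  msq mu f < +oo -> (forall n x, 0 <= f_ n x <= f x)%R ->
  (forall x, f_ n x @[n --> \oo] --> f x) ->
  L (f \- f_ n)%R @[n --> \oo] --> 0.
Proof.
move=> mf_ mf f2 f_le f_f; apply/cvg_Lnorm2_msq.
have mB n : measurable_fun setT (f \- f_ n)%R by exact: measurable_funB.
have mB2 n := measurable_sqr (mB n).
have ig : mu.-integrable setT (fun x => (f x ^+ 2)%:E).
  have -> : (fun x => (f x ^+ 2)%:E) = (fun x => (f x * f x)%:E).
    by apply/funext => x; rewrite expr2.
  exact: integrable_mul.
have [] := @dominated_convergence _ _ _ mu setT measurableT
  (fun n x => ((f \- f_ n)%R x ^+ 2)%:E) (cst 0) (fun x => (f x ^+ 2)%:E) mB2.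
- exact: measurable_cst.
- apply: aeW => x _; apply: cvg_EFin; first exact: nearW.
  have h : (f x - f_ n x)%R @[n --> \oo] --> 0%R.
    by rewrite -(subrr (f x)); apply: cvgB => //; exact: cvg_cst.
  by have := cvgM h h; rewrite mulr0; exact.
- exact: ig.
- apply: aeW => x n _; have /andP[h1 h2] := f_le n x.
  rewrite gee0_abs ?lee_fin ?sqr_ge0//= lerXn2r ?nnegrE ?subr_ge0//.
    exact: le_trans h2.
  by rewrite gerBl.
- by move=> _ _; rewrite integral0.
Qed.

End Lnorm2.

Section cgauss_limit.
Context {R : realType} {d : measure_display} {T : measurableType d}.
Variable P : probability T R.
Local Open Scope ereal_scope.

Lemma abs_cosB_le (a b : R) : (`|cos a - cos b| <= `|a - b|)%R.
Proof.
have key (m h : R) : (`|cos (m + h) - cos (m - h)| <= 2 * `|h|)%R.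
  rewrite cosD cosB.
  have -> : (cos m * cos h - sin m * sin h - (cos m * cos h + sin m * sin h) =
    - (2 * (sin m * sin h)))%R by ring.
  rewrite normrN !normrM (ger0_norm (ler0n _ _)) ler_wpM2l// -[leRHS]mul1r.
  by apply: ler_pM => //; [exact: sin_max|exact: abs_sin_le].
have := key ((a + b) / 2)%R ((a - b) / 2)%R.
rewrite -[X in (_ <= X * _)%R -> _](ger0_norm (ler0n R 2)) -normrM.
have -> : ((a + b) / 2 + (a - b) / 2 = a)%R by lra.
have -> : ((a + b) / 2 - (a - b) / 2 = b)%R by lra.
by have -> : (2 * ((a - b) / 2) = a - b)%R by lra.
Qed.

Let icos (Z : T -> R) theta : measurable_fun setT Z ->
  P.-integrable setT (fun w => (cos (Z w + theta))%:E).
Proof.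
move=> mZ; apply: measurable_bounded_integrable => //.
- by rewrite [X in X < _]probability_setT ltry.
- apply: measurableT_comp; last exact: measurable_funD.
  by apply: continuous_measurable_fun; exact: continuous_cos.
- exists 1%R; split; first exact: num_real.
  by move=> M M1 w _ /=; rewrite (le_trans (cos_max _))// ltW.
Qed.

(** The variances converge because the L^2 norms do, and the expectations of cosines because the
    cosine is 1-Lipschitz; [gauss_char] is continuous in the variance. *)
Lemma cgauss_limit (Y_ : nat -> T -> R) (Y : T -> R) :
  (forall n, measurable_fun setT (Y_ n)) -> measurable_fun setT Y ->
  (forall n, cgauss P (Y_ n)) ->
  'N[P]_2%:E[EFin \o (Y \- Y_ n)%R] @[n --> \oo] --> 0 -> cgauss P Y.
Proof.
move=> mY_ mY gY Y_Y.
have Yn_fin n : 'N[P]_2%:E[EFin \o Y_ n] < +oo.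
  by rewrite Lnorm2_lty; have [v [_ -> _]] := gY n; rewrite ltry.
have [Yfin NY] := Lnorm2_cvg mY_ mY Yn_fin Y_Y.
have Ynum : 'N[P]_2%:E[EFin \o Y] \is a fin_num.
  by rewrite ge0_fin_numE ?Lnorm_ge0.
pose v := fine (msq P Y).
have vE : msq P Y = v%:E.
  by rewrite /v fineK// ge0_fin_numE ?msq_ge0// -Lnorm2_lty.
exists v; split => //; first by rewrite fine_ge0// msq_ge0.
move=> theta.
pose v_ n := fine (msq P (Y_ n)).
have v_v : v_ @ \oo --> v.
  have h g : fine (msq P g) = (fine 'N[P]_2%:E[EFin \o g] ^+ 2)%R.
    by rewrite msq_Lnorm fine_poweR powR_mulrn// fine_ge0// Lnorm_ge0.
  rewrite /v_ /v h; under eq_fun do rewrite h.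
  have NY' : fine 'N[P]_2%:E[EFin \o Y_ n] @[n --> \oo] -->
      fine 'N[P]_2%:E[EFin \o Y] by apply: fine_cvg; rewrite fineK.
  by rewrite expr2; under eq_fun do rewrite expr2; exact: cvgM.
have cY_ n : \int[P]_w (cos (Y_ n w + theta))%:E = gauss_char (v_ n) theta.
  by have [u [u0 uE ->]] := gY n; rewrite /v_ uE.
have h1 : gauss_char (v_ n) theta @[n --> \oo] --> gauss_char v theta.
  exact: gauss_char_cvg.
suff h2 : \int[P]_w (cos (Y_ n w + theta))%:E @[n --> \oo] -->
    \int[P]_w (cos (Y w + theta))%:E.
  have cE : (fun n => gauss_char (v_ n) theta) =
      (fun n => \int[P]_w (cos (Y_ n w + theta))%:E) by apply/funext => n.
  by rewrite cE in h1; exact: (cvg_unique _ h2 h1).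
have cfin (Z : T -> R) : measurable_fun setT Z ->
    \int[P]_w (cos (Z w + theta))%:E \is a fin_num.
  by move=> mZ; apply: integrable_fin_num => //; exact: icos.
rewrite -(fineK (cfin _ mY)); apply/fine_cvgP; split.
  by apply: nearW => n; exact: cfin.
have m0 n : 0 <= msq P (Y \- Y_ n)%R by exact: msq_ge0.
have /(cvge0P m0) hm := (cvg_Lnorm2_msq P _).1 Y_Y.
apply/cvgrPdist_le => e e0; near=> n.
have hn : msq P (Y \- Y_ n)%R <= ((e / 2) ^+ 2)%:E.
  by near: n; apply: hm; rewrite exprn_gt0// divr_gt0.
rewrite -lee_fin -fineB ?cfin// -integralB ?icos//.
have mB : measurable_fun setT (Y \- Y_ n)%R by exact: measurable_funB.
have mc : measurable_fun setT
    (fun w => (cos (Y w + theta))%:E - (cos (Y_ n w + theta))%:E).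
  by apply: emeasurable_funB; [exact: measurable_int (icos theta mY)
    |exact: measurable_int (icos theta (mY_ n))].
have ic : P.-integrable setT
    (fun w => (cos (Y w + theta))%:E - (cos (Y_ n w + theta))%:E).
  by apply: integrableB => //; exact: icos.
rewrite -fine_abse ?integrable_fin_num// fineK ?abse_fin_num ?integrable_fin_num//.
apply: (le_trans (le_abse_integral _ _ mc)) => //.
(* The inequality |x| <= e/2 + x^2 / (e/2) bounds the first moment by the mean square, which is at
   most (e/2)^2, and gives e in total. *)
apply: (@le_trans _ _ (\int[P]_w ((e / 2)%:E + ((e / 2)^-1)%:E * ((Y \- Y_ n)%R w ^+ 2)%:E))).
  apply: ge0_le_integral => //.
  - exact: measurableT_comp.
  - apply: emeasurable_funD => //; apply: emeasurable_funM => //.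
    exact: measurable_sqr.
  move=> w _; rewrite -EFinB -EFinM -EFinD lee_fin.
  apply: (le_trans (abs_cosB_le _ _)) => /=.
  rewrite opprD addrACA subrr addr0; set x := (Y w - Y_ n w)%R.
  have e2 : (0 < e / 2)%R by rewrite divr_gt0.
  have h := sqr_ge0 (`|x| - e / 2)%R.
  have := real_normK (num_real x) => <-.
  rewrite -(@ler_pM2l _ (e / 2)%R)// mulrDr mulrA divff ?gt_eqF// mul1r.
  by move: (normr_ge0 x) e2 h; set a := (`|x|)%R; set b := (e / 2)%R; nra.
rewrite ge0_integralD//; last 3 first.
- by move=> w _; rewrite lee_fin divr_ge0// ltW.
- by move=> w _; rewrite mule_ge0// lee_fin ?sqr_ge0// invr_ge0 divr_ge0// ltW.
- by apply: emeasurable_funM => //; exact: measurable_sqr.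
rewrite integral_cst// [X in _ * X + _]probability_setT mule1.
rewrite ge0_integralZl_EFin//; last 3 first.
- by move=> w _; rewrite lee_fin sqr_ge0.
- exact: measurable_sqr.
- by rewrite invr_ge0 divr_ge0// ltW.
apply: (@le_trans _ _ ((e / 2)%:E + ((e / 2)^-1)%:E * ((e / 2) ^+ 2)%:E)).
  by rewrite leeD2l// lee_pmul2l// lte_fin invr_gt0 divr_gt0.
have e2 : (e / 2 != 0)%R by rewrite gt_eqF// divr_gt0.
have -> : ((e / 2) ^+ 2 = e / 2 * (e / 2))%R by rewrite expr2.
by rewrite -EFinM -EFinD lee_fin mulKf// -splitr.
Unshelve. all: by end_near. Qed.

End cgauss_limit.

Section L2_complete.
Context {R : realType} {d : measure_display} {T : measurableType d}.
Variable P : probability T R.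
Local Open Scope ereal_scope.
Local Notation L f := ('N[P]_2%:E[EFin \o f]).

Variable Y_ : nat -> T -> R.
Hypothesis mY_ : forall n, measurable_fun setT (Y_ n).
Hypothesis dY_ : forall n, L (Y_ n.+1 \- Y_ n)%R <= ((4^-1) ^+ n)%:E.

Let mB m n : measurable_fun setT (Y_ m \- Y_ n)%R.
Proof. exact: measurable_funB. Qed.

(** The factor 1 - 4^-k strengthens the bound 2 * 4^-n so that the induction on k closes. *)
Let dY n k : L (Y_ (n + k)%N \- Y_ n)%R <=
  (2 * (4^-1) ^+ n * (1 - (4^-1) ^+ k))%:E.
Proof.
elim: k => [|k IH].
  rewrite addn0 expr0 subrr mulr0 (_ : EFin \o _ = cst 0) ?Lnorm0//.
  by apply/funext => x /=; rewrite subrr.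
rewrite (_ : Y_ _ \- Y_ n = (Y_ (n + k.+1)%N \- Y_ (n + k)%N) \+
  (Y_ (n + k)%N \- Y_ n))%R; last by apply/funext => x /=; rewrite addrA subrK.
apply: (le_trans (minkowski_EFin _ _ _ _)); [exact: mB|exact: mB|by rewrite ler1n|].
apply: (@le_trans _ _ (((4^-1) ^+ (n + k))%:E +
    (2 * (4^-1) ^+ n * (1 - (4^-1) ^+ k))%:E)).
  by apply: leeD => //; rewrite addnS; exact: dY_.
rewrite -EFinD lee_fin exprD exprSr.
have : (0 <= (4^-1) ^+ n * (4^-1) ^+ k :> R)%R by rewrite mulr_ge0// exprn_ge0.
set a := ((4^-1) ^+ n)%R; set b := ((4^-1) ^+ k)%R; nra.
Qed.

Let F n := [set w | (2^-1 ^+ n <= `|Y_ n.+1 w - Y_ n w|)%R].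

Let mF n : measurable (F n).
Proof.
rewrite (_ : F n = (Num.norm \o (Y_ n.+1 \- Y_ n)%R) @^-1` `[(2^-1 ^+ n)%R, +oo[%classic).
  rewrite -[X in measurable X]setTI.
  have h : measurable_fun setT (Num.norm \o (Y_ n.+1 \- Y_ n)%R).
    exact: measurableT_comp.
  by apply: h => //; exact: measurable_itv.
by apply/seteqP; split => w /=; rewrite in_itv/= andbT.
Qed.

Let PF n : P (F n) <= (2 / (2 ^ n.+1)%:R)%:E.
Proof.
have h0 : (0 < (2^-1 ^+ n) ^+ 2 :> R)%R by rewrite !exprn_gt0.
have := msq_markov P (mB n.+1 n) (exprn_gt0 n (_ : 0 < 2^-1 :> R)%R).
move=> /(_ ltac:(by [])) h.
have {}h : ((2^-1 ^+ n) ^+ 2)%:E * P (F n) <= (((4^-1) ^+ n) ^+ 2)%:E.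
  apply: (le_trans h); rewrite -Lnorm2_le_msq//.
have -> : (2 / (2 ^ n.+1)%:R = 2^-1 ^+ n :> R)%R.
  by rewrite expnS natrM invfM mulrA divff// mul1r natrX exprVn.
rewrite -(@lee_pmul2l _ ((2^-1 ^+ n) ^+ 2)%:E)//.
apply: (le_trans h); rewrite -EFinM lee_fin.
have -> : ((4^-1) ^+ n = 2^-1 ^+ n * 2^-1 ^+ n :> R)%R.
  by rewrite -exprMn; congr (_ ^+ _)%R; lra.
have a0 : (0 <= 2^-1 ^+ n :> R)%R by rewrite exprn_ge0.
have a1 : (2^-1 ^+ n <= 1 :> R)%R by rewrite exprn_ile1//; lra.
rewrite expr2; move: a0 a1; set a := (2^-1 ^+ n)%R => a0 a1.
have -> : (a ^+ 2 * a = a ^+ 3 * 1)%R by ring.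
have -> : (a * a * (a * a) = a ^+ 3 * a)%R by ring.
by rewrite ler_wpM2l// exprn_ge0.
Qed.

(** The speed 4^-n leaves a margin: by the Markov inequality, increments larger than 2^-n have
    summable probabilities, so the sequence converges almost surely. Fatou's lemma then transfers
    the bounds [dY] to the limit. Outside the event of convergence the limit is set to 0. *)
Lemma L2_complete : exists2 Y : T -> R, measurable_fun setT Y &
  forall n, L (Y \- Y_ n)%R <= (2 * (4^-1) ^+ n)%:E.
Proof.
pose good w := ~ lim_sup_set F w.
pose G := [set w | good w].
have mG : measurable G.
  by apply: measurableC; exact: measurable_lim_sup_set.
have Y_cvg w : exists l : R, (\1_G w * Y_ n w)%R @[n --> \oo] --> l.
  have [gw|gw] := pselect (G w); last first.
    by exists 0%R; rewrite indicE memNset//; under eq_fun do rewrite mul0r; exact: cvg_cst.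
  have [N hN] := notin_lim_sup_set gw.
  have [|//|n Nn|l Yl _] := @cvg_geometric_increments R (Y_^~ w) 1%R (2^-1)%R N.
  - by apply/andP; split; lra.
  - by rewrite mul1r leNgt; apply/negP => /ltW; exact: hN.
  by exists l; rewrite indicE mem_set//; under eq_fun do rewrite mul1r.
have [Y hY] := choice Y_cvg.
have mY : measurable_fun setT Y.
  apply: (measurable_fun_cvg (h := fun n w => \1_G w * Y_ n w)%R) => //.
  by move=> n; apply: measurable_funM => //; exact: measurable_indic.
exists Y => // n.
have b0 k : (0 <= 2 * (4^-1) ^+ k :> R)%R by rewrite mulr_ge0// exprn_ge0.
rewrite Lnorm2_le_msq//.
pose g m w := (((Y_ (n + m)%N \- Y_ n)%R w) ^+ 2)%:E.
have -> : msq P (Y \- Y_ n)%R = \int[P]_w limn_einf (g^~ w).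
  apply: ae_eq_integral => //.
  - by apply: measurable_sqr; exact: measurable_funB.
  - rewrite (_ : (fun x => _) = (fun x => - limn_esup (fun m => - g m x))).
      apply: measurableT_comp => //; apply: measurable_fun_limn_esup => m.
      by apply: measurableT_comp => //; apply: measurable_sqr; exact: mB.
    apply/funext => x; rewrite -limn_einfN; congr limn_einf.
    by apply/funext => m; exact/esym/oppeK.
  - exists (~` G); split; first exact: measurableC.
      rewrite setCK; apply: (@lim_sup_set_geometric _ _ _ P 2%R) => //.
    move=> w /= /not_implyP[_ h] gw; apply: h.
    apply/esym; apply: (cvg_limn_einf_sup _).1.
    have := hY w; rewrite indicE mem_set//; under eq_fun do rewrite mul1r.
    move=> hw; apply: cvg_EFin; first exact: nearW.
    rewrite /=.
    have hw' : (Y_ (n + m)%N w - Y_ n w)%R @[m --> \oo] --> (Y w - Y_ n w)%R.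
      apply: cvgB; last exact: cvg_cst.
      by have := hw; rewrite -(cvg_shiftn n); under eq_fun do rewrite addnC.
    exact: (cvgM hw' hw').
apply: (le_trans (fatou _ _ _ _)) => //.
- by move=> m; apply: measurable_sqr; exact: mB.
- by move=> m w _; rewrite lee_fin sqr_ge0.
have gm m : \int[P]_w g m w <= ((2 * (4^-1) ^+ n) ^+ 2)%:E.
  rewrite -[X in X <= _]/(msq P (Y_ (n + m)%N \- Y_ n)%R) -Lnorm2_le_msq//.
  apply: (le_trans (dY n m)); rewrite lee_fin ler_piMr// gerBl exprn_ge0//.
rewrite limn_einf_lim; apply: lime_le; first exact: is_cvg_einfs.
apply: nearW => m; apply: (le_trans _ (gm m)).
by apply: ereal_inf_lbound; exists m => /=.
Qed.

End L2_complete.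

(** * Existence, isometry and covariance of Wiener integrals *)

Section wiener_integrals.
Context {R : realType} {d : measure_display} {T : measurableType d}.
Context {d' : measure_display} {U : measurableType d'}.
Variables (P : probability T R) (mu : {measure set U -> \bar R}).
Context {I : Type}.
Variables (D : set I) (E : I -> set U) (M : I -> T -> R).
Hypothesis mM : process D M.
Hypothesis mE : forall i, D i -> measurable (E i).
Hypothesis E_fin : forall i, D i -> (mu (E i) < +oo)%E.
Hypothesis gM : forall Z, lin_span D M Z -> cgauss P Z.
Hypothesis MM : forall i j, D i -> D j ->
  (\int[P]_w (M i w * M j w)%:E = mu (E i `&` E j))%E.
Local Open Scope ereal_scope.
Local Notation elem := (elementary_integral D E M).
Local Notation wien := (is_wiener_integral P mu D E M).

(* An elementary integrand and its integral depend linearly, and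
   simultaneously, on the coefficients: together they form one linear span of
   functions on the disjoint union of [U] and [T]. *)
Let EM (i : I) (z : U + T) : R :=
  match z with inl x => \1_(E i) x | inr w => M i w end.

Let pair (f : U -> R) (Y : T -> R) (z : U + T) : R :=
  match z with inl x => f x | inr w => Y w end.

Let elem_span f Y : elem f Y <-> lin_span D EM (pair f Y).
Proof.
split=> [[n [c [i [Di -> ->]]]]|[n [i [c [Di fY]]]]].
  by exists n, i, c; split => //; apply/funext => -[].
exists n, c, i; split => //; apply/funext => x.
  by have /(congr1 (@^~ (inl x))) := fY.
by have /(congr1 (@^~ (inr x))) := fY.
Qed.

Lemma elementary_integralD f Y g Z : elem f Y -> elem g Z ->
  elem (f \+ g)%R (Y \+ Z)%R.
Proof.
move=> /elem_span fY /elem_span gZ; apply/elem_span.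
by have := lin_spanD fY gZ; congr lin_span; apply/funext => -[].
Qed.

Lemma elementary_integralZ a f Y : elem f Y ->
  elem (fun x => a * f x)%R (fun w => a * Y w)%R.
Proof.
move=> /elem_span fY; apply/elem_span.
by have := lin_spanZ a fY; congr lin_span; apply/funext => -[].
Qed.

Lemma elementary_integralB f Y g Z : elem f Y -> elem g Z ->
  elem (f \- g)%R (Y \- Z)%R.
Proof.
move=> fY gZ; have := elementary_integralD fY (elementary_integralZ (-1) gZ).
by congr (elem _ _); apply/funext => x /=; rewrite mulN1r.
Qed.

Lemma measurable_elementary f Y : elem f Y ->
  measurable_fun setT f /\ measurable_fun setT Y.
Proof.
move=> [n [c [i [Di -> ->]]]]; split; apply: measurable_sum => k.
  by apply: measurable_funM => //; apply: measurable_indic; exact/mE/Di.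
by apply: measurable_funM => //; exact/mM/Di.
Qed.

Lemma elementary_integral0 : elem (fun=> 0%R) (fun=> 0%R).
Proof.
have e (V : Type) (k : 'I_0) : V by case: k.
exists 0%N, (e R), (e I); split; first by case.
  by apply/funext => x; rewrite big_ord0.
by apply/funext => x; rewrite big_ord0.
Qed.

Lemma elementary_indic i : D i -> elem (\1_(E i) : U -> R) (M i).
Proof.
move=> Di; exists 1%N, (fun=> 1%R), (fun=> i); split => //.
  by apply/funext => x; rewrite big_ord1 mul1r.
by apply/funext => x; rewrite big_ord1 mul1r.
Qed.

Lemma elementary_sum n (g : 'I_n -> U -> R) :
  (forall k, exists Y, elem (g k) Y) ->
  exists Y, elem (fun x => \sum_(k < n) g k x)%R Y.
Proof.
elim: n g => [|n IH] g hg.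
  exists (fun=> 0%R); have := elementary_integral0.
  by congr elem; apply/funext => x; rewrite big_ord0.
have [Y gY] := hg ord0; have [|Z gZ] := IH (fun k => g (lift ord0 k)).
  by move=> k; exact: hg.
exists (Y \+ Z)%R; have := elementary_integralD gY gZ.
by congr elem; apply/funext => x; rewrite big_ord_recl.
Qed.

Lemma cgauss_elementary f Y : elem f Y -> cgauss P Y.
Proof. by move=> [n [c [i [Di _ ->]]]]; apply: gM; exists n, i, c. Qed.

Let msq_indic i : D i -> msq mu (\1_(E i) : U -> R) = mu (E i).
Proof.
move=> Di; transitivity (\int[mu]_x (\1_(E i) x)%:E); last first.
  by rewrite integral_indic ?setIT//; exact: mE.
apply: eq_integral => x _; congr EFin; rewrite indicE.
by case: (_ \in _); rewrite ?expr1n ?expr0n.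
Qed.

(** Both sides are the same quadratic form in the coefficients, with matrix mu(E_k [&] E_l).
    Repeated or overlapping sets are therefore harmless. *)
Lemma elementary_isometry f Y : elem f Y -> msq P Y = msq mu f.
Proof.
move=> [n [c [i [Di -> ->]]]].
have Kfin k l : mu (E (i k) `&` E (i l)) \is a fin_num.
  rewrite ge0_fin_numE//; apply: (le_lt_trans _ (E_fin (Di k))).
  by apply: le_measure; rewrite ?inE; [apply: measurableI; exact: mE|exact: mE|].
rewrite (@msq_sum _ _ _ _ _ _ _ (fun k l => fine (mu (E (i k) `&` E (i l))))).
- rewrite (@msq_sum _ _ _ _ _ _ _
    (fun k l => fine (mu (E (i k) `&` E (i l)))))//.
  + by move=> k; apply: measurable_indic; exact: mE.
  + by move=> k; rewrite msq_indic// E_fin.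
  + move=> k l; rewrite fineK//.
    transitivity (\int[mu]_x (\1_(E (i k) `&` E (i l)) x)%:E).
      by apply: eq_integral => x _; rewrite indicI.
    by rewrite integral_indic ?setIT//; apply: measurableI; exact: mE.
- by move=> k; exact/mM/Di.
- by move=> k; have [v [_ -> _]] := gM (lin_span_gen M (Di k)); rewrite ltry.
- by move=> k l; rewrite MM// fineK.
Qed.

Lemma elementary_lty f Y : elem f Y -> msq mu f < +oo.
Proof.
move=> fY; rewrite -(elementary_isometry fY).
by have [v [_ -> _]] := cgauss_elementary fY; rewrite ltry.
Qed.

Let Lnorm2_msq_cvg d0 (V : measurableType d0) (nu : {measure set V -> \bar R})
    (g_ : nat -> V -> R) :
  'N[nu]_2%:E[EFin \o g_ n] @[n --> \oo] --> 0 <->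
  msq nu (g_ n) @[n --> \oo] --> 0.
Proof. exact: cvg_Lnorm2_msq. Qed.

Lemma is_wiener_integral_isometry f Y : wien f Y ->
  [/\ msq mu f < +oo, msq P Y = msq mu f & cgauss P Y].
Proof.
move=> [mf mY [f_ [Y_ [fY f_f Y_Y]]]].
have mf_ n : measurable_fun setT (f_ n) by case: (measurable_elementary (fY n)).
have mY_ n : measurable_fun setT (Y_ n) by case: (measurable_elementary (fY n)).
have ffin n : 'N[mu]_2%:E[EFin \o f_ n] < +oo.
  by rewrite Lnorm2_lty; exact: elementary_lty (fY n).
have Yfin n : 'N[P]_2%:E[EFin \o Y_ n] < +oo.
  by rewrite Lnorm2_lty (elementary_isometry (fY n)); exact: elementary_lty (fY n).
have [f2 Nf] := Lnorm2_cvg mf_ mf ffin f_f.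
have [Y2 NY] := Lnorm2_cvg mY_ mY Yfin Y_Y.
split; first by rewrite -Lnorm2_lty.
  rewrite !msq_Lnorm; congr (_ `^ _).
  have e n : 'N[P]_2%:E[EFin \o Y_ n] = 'N[mu]_2%:E[EFin \o f_ n].
    by rewrite !Lnorm_msq (elementary_isometry (fY n)).
  have E' : (fun n => 'N[P]_2%:E[EFin \o Y_ n]) =
      (fun n => 'N[mu]_2%:E[EFin \o f_ n]) by apply/funext => n.
  by rewrite E' in NY; exact: (cvg_unique _ NY Nf).
apply: (cgauss_limit mY_ mY _ Y_Y) => n; exact: cgauss_elementary (fY n).
Qed.

Let cvg_LnormD d0 (V : measurableType d0) (nu : {measure set V -> \bar R})
    (f g : V -> R) (f_ g_ : nat -> V -> R) :
  measurable_fun setT f -> measurable_fun setT g ->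
  (forall n, measurable_fun setT (f_ n)) -> (forall n, measurable_fun setT (g_ n)) ->
  'N[nu]_2%:E[EFin \o (f \- f_ n)%R] @[n --> \oo] --> 0 ->
  'N[nu]_2%:E[EFin \o (g \- g_ n)%R] @[n --> \oo] --> 0 ->
  'N[nu]_2%:E[EFin \o ((f \+ g) \- (f_ n \+ g_ n))%R] @[n --> \oo] --> 0.
Proof.
move=> mf mg mf_ mg_ f0 g0.
apply: (@squeeze_cvge _ _ _ _ (cst 0) _ (fun n =>
  'N[nu]_2%:E[EFin \o (f \- f_ n)%R] + 'N[nu]_2%:E[EFin \o (g \- g_ n)%R])).
- apply: nearW => n; rewrite Lnorm_ge0 /=.
  rewrite (_ : ((f \+ g) \- (f_ n \+ g_ n))%R = ((f \- f_ n) \+ (g \- g_ n))%R).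
    apply: minkowski_EFin; [exact: measurable_funB|exact: measurable_funB|].
    by rewrite ler1n.
  by apply/funext => x /=; rewrite opprD addrACA.
- exact: cvg_cst.
- by rewrite -[X in _ --> X]adde0; apply: cvgeD.
Qed.

Lemma is_wiener_integralD f Y g Z : wien f Y -> wien g Z ->
  wien (f \+ g)%R (Y \+ Z)%R.
Proof.
move=> [mf mY [f_ [Y_ [fY f_f Y_Y]]]] [mg mZ [g_ [Z_ [gZ g_g Z_Z]]]].
split; [exact: measurable_funD|exact: measurable_funD|].
exists (fun n => f_ n \+ g_ n)%R, (fun n => Y_ n \+ Z_ n)%R; split.
- by move=> n; exact: elementary_integralD.
- apply: cvg_LnormD => // n.
    by case: (measurable_elementary (fY n)).
  by case: (measurable_elementary (gZ n)).
- apply: cvg_LnormD => // n.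
    by case: (measurable_elementary (fY n)).
  by case: (measurable_elementary (gZ n)).
Qed.

Let cvg_LnormZ d0 (V : measurableType d0) (nu : {measure set V -> \bar R})
    a (f : V -> R) (f_ : nat -> V -> R) :
  measurable_fun setT f -> (forall n, measurable_fun setT (f_ n)) ->
  'N[nu]_2%:E[EFin \o (f \- f_ n)%R] @[n --> \oo] --> 0 ->
  'N[nu]_2%:E[EFin \o ((fun x => a * f x) \- (fun x => a * f_ n x))%R]
    @[n --> \oo] --> 0.
Proof.
move=> mf mf_ /Lnorm2_msq_cvg f0; apply/Lnorm2_msq_cvg.
have e n : msq nu ((fun x => a * f x) \- (fun x => a * f_ n x))%R =
    (a ^+ 2)%:E * msq nu (f \- f_ n)%R.
  rewrite -msqZ; last exact: measurable_funB.
  by congr msq; apply/funext => x /=; rewrite mulrBr.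
under eq_fun do rewrite e.
by rewrite -(mule0 (a ^+ 2)%:E); apply: cvgeZl.
Qed.

Lemma is_wiener_integralZ a f Y : wien f Y ->
  wien (fun x => a * f x)%R (fun w => a * Y w)%R.
Proof.
move=> [mf mY [f_ [Y_ [fY f_f Y_Y]]]].
split; [exact: measurable_funM|exact: measurable_funM|].
exists (fun n x => a * f_ n x)%R, (fun n w => a * Y_ n w)%R; split.
- by move=> n; exact: elementary_integralZ.
- by apply: cvg_LnormZ => // n; case: (measurable_elementary (fY n)).
- by apply: cvg_LnormZ => // n; case: (measurable_elementary (fY n)).
Qed.

Lemma is_wiener_integral0 : wien (fun=> 0%R) (fun=> 0%R).
Proof.
have z d0 (V : measurableType d0) (nu : {measure set V -> \bar R}) :
    'N[nu]_2%:E[EFin \o ((fun=> 0%R) \- (fun=> 0%R))%R] @[n --> \oo] --> 0.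
  rewrite (_ : EFin \o _ = cst 0).
    by rewrite Lnorm0//; exact: cvg_cst.
  by apply/funext => x /=; rewrite subrr.
split => //; exists (fun _ _ => 0%R), (fun _ _ => 0%R); split; [|exact: z|exact: z].
by move=> _; exact: elementary_integral0.
Qed.

(** Density suffices for existence: by the isometry, the elementary integrals along a rapidly
    converging subsequence satisfy the hypothesis of [L2_complete]. *)
Lemma is_wiener_integral_exists (f : U -> R) (f_ : nat -> U -> R) (Y_ : nat -> T -> R) :
  measurable_fun setT f -> (forall n, elem (f_ n) (Y_ n)) ->
  'N[mu]_2%:E[EFin \o (f \- f_ n)%R] @[n --> \oo] --> 0 ->
  exists Y, wien f Y.
Proof.
move=> mf fY f_f.
have mf_ n : measurable_fun setT (f_ n) by case: (measurable_elementary (fY n)).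
have mY_ n : measurable_fun setT (Y_ n) by case: (measurable_elementary (fY n)).
have N0 g : 0 <= 'N[mu]_2%:E[EFin \o g] by exact: Lnorm_ge0.
(* The factor 1/2 makes two consecutive errors sum to at most 4^-k, since (1 + 1/4) / 2 <= 1. *)
have /choice[s hs] (k : nat) : exists n,
    'N[mu]_2%:E[EFin \o (f \- f_ n)%R] <= (2^-1 * (4^-1) ^+ k)%:E.
  have [|N _ h] := (cvge0P (fun n => N0 (f \- f_ n)%R)).1 f_f (2^-1 * (4^-1) ^+ k)%R.
    by rewrite mulr_gt0// exprn_gt0.
  by exists N; apply: h => /=.
have df k : 'N[P]_2%:E[EFin \o (Y_ (s k.+1) \- Y_ (s k))%R] <= ((4^-1) ^+ k)%:E.
  rewrite Lnorm_msq (elementary_isometry (elementary_integralB (fY _) (fY _))).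
  rewrite -Lnorm_msq (_ : _ \- _ = (f \- f_ (s k)) \+ (\- (f \- f_ (s k.+1))))%R.
    apply: (le_trans (minkowski_EFin _ _ _ _)).
    - exact: measurable_funB.
    - by apply: measurableT_comp => //; exact: measurable_funB.
    - by rewrite ler1n.
    have := oppe_Lnorm mu (EFin \o (f \- f_ (s k.+1))%R) 2%:E.
    rewrite (_ : \- _ = EFin \o (\- (f \- f_ (s k.+1)))%R)// => ->.
    apply: (le_trans (leeD (hs k) (hs k.+1))); rewrite -EFinD lee_fin exprS.
    have : (0 <= (4^-1) ^+ k :> R)%R by rewrite exprn_ge0.
    by set a := ((4^-1) ^+ k)%R; lra.
  by apply/funext => x /=; ring.
have [Y mY hY] := L2_complete (fun k => mY_ (s k)) df.
have c4 (c : R) : (0 < c)%R -> (c * (4^-1) ^+ k)%:E @[k --> \oo] --> 0.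
  move=> c0; apply: cvg_EFin; first exact: nearW.
  rewrite -(mulr0 c); apply: cvgMr; apply: cvg_expr.
  by rewrite ger0_norm//; lra.
exists Y; split => //; exists (f_ \o s), (Y_ \o s); split => [n||].
- exact: fY.
- apply: (@squeeze_cvge _ _ _ _ (cst 0) _ (fun k => (2^-1 * (4^-1) ^+ k)%:E)).
  + by apply: nearW => k; rewrite hs andbT; exact: N0.
  + exact: cvg_cst.
  + exact: c4.
- apply: (@squeeze_cvge _ _ _ _ (cst 0) _ (fun k => (2 * (4^-1) ^+ k)%:E)).
  + by apply: nearW => k; rewrite hY andbT; exact: Lnorm_ge0.
  + exact: cvg_cst.
  + exact: c4.
Qed.

(** The usual simple functions increasing to [f] are elementary: those of their level sets that
    carry a nonzero coefficient lie in some {f >= e} with e > 0, hence have finite measure and are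
    integrator sets. *)
Lemma is_wiener_integral_ge0 (f : U -> R) : measurable_fun setT f ->
  (forall x, 0 <= f x)%R -> msq mu f < +oo ->
  (forall A, measurable A -> mu A < +oo -> A `<=` [set x | (0 < f x)%R] ->
    exists2 i, D i & E i = A) ->
  exists Y, wien f Y.
Proof.
move=> mf f0 f2 fE.
have mEf : measurable_fun setT (EFin \o f) by exact/measurable_EFinP.
have Ef0 x : setT x -> 0 <= (EFin \o f) x by move=> _; rewrite lee_fin.
(* The alternative c = 0 is for the lowest level set, on which [f] may vanish and which may have
   infinite measure. *)
have elemA (c : R) A : measurable A ->
    (c = 0%R \/ exists2 e : R, (0 < e)%R & A `<=` [set x | (e <= f x)%R]) ->
    exists Y, elem (fun x => c * \1_A x)%R Y.
  move=> mA [->|[e e0 Ae]].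
    exists (fun=> 0%R); have := elementary_integral0.
    by congr elem; apply/funext => x; rewrite mul0r.
  have [|x /Ae/= h|i Di <-] := fE A mA.
  - have mS : measurable [set x | (e <= `|f x|)%R].
      rewrite (_ : [set _ | _] = (Num.norm \o f) @^-1` `[e, +oo[%classic).
        rewrite -[X in measurable X]setTI.
        have h : measurable_fun setT (Num.norm \o f) by exact: measurableT_comp.
        by apply: h => //; exact: measurable_itv.
      by apply/seteqP; split => w /=; rewrite in_itv/= andbT.
    have h : mu A <= mu [set x | (e <= `|f x|)%R].
      apply: le_measure; rewrite ?inE// => x /Ae/= h.
      by rewrite (le_trans h)// ler_norm.
    apply: (le_lt_trans h); rewrite -(@lte_pmul2l _ (e ^+ 2)%:E)//; last first.
      by rewrite lte_fin exprn_gt0.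
    by apply: (le_lt_trans (msq_markov mu mf e0)); rewrite gt0_muley ?lte_fin ?exprn_gt0.
  - exact: lt_le_trans h.
  - by exists (fun w => c * M i w)%R; apply: elementary_integralZ; exact: elementary_indic.
pose f_ n := approx setT (EFin \o f) n.
have mA n k : measurable (dyadic_approx setT (EFin \o f) n k).
  rewrite /dyadic_approx; case: ifPn => // _; rewrite -preimage_comp.
  by apply: mEf => //; apply/measurable_image_EFin; exact: measurable_itv.
have /choice[Y_ fY] n : exists Y, elem (f_ n) Y.
  have [|Y1 h1] := @elementary_sum (n * 2 ^ n) (fun k x =>
      k%:R * 2 ^- n * \1_(dyadic_approx setT (EFin \o f) n k) x)%R.
    move=> k; apply: elemA => //; have [->|k0] := posnP k.
      by left; rewrite !mul0r.
    right; exists (k%:R * 2 ^- n)%R; first by rewrite mulr_gt0 ?ltr0n// invr_gt0 exprn_gt0.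
    rewrite /dyadic_approx ltn_ord => x [_ /=]; rewrite inE/= => -[y].
    by rewrite in_itv/= => /andP[h _] [<-].
  have [||Y2 h2] := elemA n%:R (integer_approx setT (EFin \o f) n).
  - by apply: emeasurable_fun_c_infty.
  - have [->|n0] := posnP n; [by left|right].
    by exists n%:R; [rewrite ltr0n|move=> x [_ /=]; rewrite lee_fin].
  by exists (Y1 \+ Y2)%R; exact: elementary_integralD.
apply: (@is_wiener_integral_exists f f_ Y_) => //.
apply: Lnorm2_dominated => //.
- by move=> n; case: (measurable_elementary (fY n)).
- move=> n x; rewrite /f_; apply/andP; split.
    rewrite addr_ge0 ?mulr_ge0// sumr_ge0// => k _.
  by have := @le_approx _ _ _ setT (EFin \o f) n x Ef0; apply.
- move=> x; exact: (@cvg_approx _ _ _ setT (EFin \o f) x Ef0 Logic.I (ltry _)).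
Qed.

(* Polarization of the isometry. *)
Lemma is_wiener_integral_covariance f Y g Z : wien f Y -> wien g Z ->
  \int[P]_w (Y w * Z w)%:E = \int[mu]_x (f x * g x)%:E.
Proof.
move=> fY gZ; have [mf mY _] := fY; have [mg mZ _] := gZ.
have [f2 Yf _] := is_wiener_integral_isometry fY.
have [g2 Zg _] := is_wiener_integral_isometry gZ.
have [_ + _] := is_wiener_integral_isometry (is_wiener_integralD fY gZ).
have Y2 : msq P Y < +oo by rewrite Yf.
have Z2 : msq P Z < +oo by rewrite Zg.
rewrite (msqD mY mZ Y2 Z2) (msqD mf mg f2 g2) Yf Zg.
have fin d0 (V : measurableType d0) (nu : {measure set V -> \bar R}) h :
    msq nu h < +oo -> msq nu h \is a fin_num by rewrite ge0_fin_numE ?msq_ge0.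
have := integrable_fin_num measurableT (integrable_mul mY mZ Y2 Z2).
have := integrable_fin_num measurableT (integrable_mul mf mg f2 g2).
move=> /fineK <- /fineK <-; rewrite -(fineK (fin _ _ _ _ f2)) -(fineK (fin _ _ _ _ g2)).
by rewrite -!EFinM -!EFinD => -[]/addrI/(mulfI _) ->//; rewrite pnatr_eq0.
Qed.

Section wiener_process.
Context {J : Type}.
Variables (S : set J) (f : J -> U -> R) (X : J -> T -> R).
Hypothesis fX : forall t, S t -> wien (f t) (X t).

(** A linear combination of Wiener integrals is itself the Wiener integral of the combined
    integrand. *)
Lemma cgauss_wiener Z : lin_span S X Z -> cgauss P Z.
Proof.
move=> [n [i [c [Si ->]]]].
suff [_ _ //] : [/\ msq mu (fun x => \sum_(k < n) c k * f (i k) x)%R < +oo,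
   msq P (fun w => \sum_(k < n) c k * X (i k) w)%R =
     msq mu (fun x => \sum_(k < n) c k * f (i k) x)%R &
   cgauss P (fun w => \sum_(k < n) c k * X (i k) w)%R].
apply: is_wiener_integral_isometry.
elim: n i c Si => [|n IH] i c Si.
  under [X in wien X _]eq_fun do rewrite big_ord0.
  under [X in wien _ X]eq_fun do rewrite big_ord0.
  exact: is_wiener_integral0.
under [X in wien X _]eq_fun do rewrite big_ord_recl.
under [X in wien _ X]eq_fun do rewrite big_ord_recl.
apply: is_wiener_integralD; first by apply: is_wiener_integralZ; exact: fX.
exact: IH.
Qed.

End wiener_process.

Lemma wiener_integralP f : (exists Y, wien f Y) ->
  wien f (wiener_integral P mu D E M f).
Proof. by move=> [Y fY]; rewrite /wiener_integral; case: xgetP => [_ -> //|/(_ Y)]. Qed.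

(** Common to the heat and Brownian representations: for each there remain the existence of the
    integrals and one deterministic integral. *)
Lemma eq_in_law_wiener (J : Type) (S : set J) d0 (T0 : measurableType d0)
    (P0 : probability T0 R) (X : J -> T0 -> R) (a : R) (f : J -> U -> R) :
  centered_gaussian_process P0 S X ->
  (forall t, S t -> exists Y, wien (f t) Y) ->
  (forall s t, S s -> S t -> \int[P0]_w (X s w * X t w)%:E =
    \int[mu]_x (a * f s x * (a * f t x))%:E) ->
  equal_in_law S P0 X P (fun t w => a * wiener_integral P mu D E M (f t) w)%R.
Proof.
move=> gX fY XX.
have fW t : S t -> wien (fun x => a * f t x)%R
    (fun w => a * wiener_integral P mu D E M (f t) w)%R.
  by move=> /fY/wiener_integralP; exact: is_wiener_integralZ.
apply: eq_in_law_cgauss.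
- exact: centered_gaussian_process_mfun gX.
- by move=> t /fW[].
- by move=> Z; exact: cgauss_lin_span gX.
- exact: cgauss_wiener fW.
- move=> s t Ss St; rewrite XX//; apply/esym.
  exact: is_wiener_integral_covariance (fW _ Ss) (fW _ St).
Qed.

End wiener_integrals.

(** * The heat equation *)

Section ge0_FTC.
Context {R : realType}.
Local Notation mu := (@lebesgue_measure R).

(** The integrand may blow up at either end: the usual theorem is applied on closed subintervals,
    and monotone convergence reaches the open interval. *)
Lemma ge0_FTC_oo (f F : R -> R) (a b : R) : a < b ->
  (forall x, a < x < b -> 0 <= f x) ->
  (forall x, a < x < b -> {for x, continuous f}) ->
  (forall x : R, a < x < b -> is_derive x (1 : R) F (f x)) ->
  F x @[x --> a^'+] --> F a -> F x @[x --> b^'-] --> F b ->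
  (\int[mu]_(x in `]a, b[) (f x)%:E = (F b - F a)%:E)%E.
Proof.
move=> ab f0 cf dF Fa Fb.
(* The denominator starts at 3 so that h n < (b - a) / 2 and the subinterval is nondegenerate from n
   = 0 on. *)
pose h (n : nat) : R := (b - a) / n.+3%:R.
have ba : 0 < b - a by rewrite subr_gt0.
have h0 n : 0 < h n by rewrite divr_gt0.
have h2 n : h n < (b - a) / 2.
  by rewrite ltr_pM2l// ltf_pV2 ?posrE// ltr_nat.
have h_cvg : h @ \oo --> (0 : R).
  rewrite -(mulr0 (b - a)); apply: cvgMr.
  exact: (cvg_comp _ _ (cvg_addnl 2) (@cvg_harmonic R)).
have hS m n : (m <= n)%N -> h n <= h m.
  by move=> mn; rewrite ler_pM2l// lef_pV2 ?posrE// ler_nat.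
pose I n := `[a + h n, b - h n]%classic.
have Iab n x : I n x -> a < x < b.
  rewrite /I/= in_itv/= => /andP[ax xb]; have := h0 n.
  by move=> h0n; apply/andP; split; lra.
have IU : \bigcup_n I n = `]a, b[%classic.
  apply/seteqP; split => [x [n _ /Iab]|x]; first by rewrite /= in_itv.
  rewrite /= in_itv/= => /andP[ax xb].
  have m0 : 0 < Num.min (x - a) (b - x) by rewrite lt_min !subr_gt0 ax.
  have [N _ hN] := cvgr0_norm_lt _ h_cvg _ m0.
  exists N => //; have := hN N (leqnn N); rewrite /= gtr0_norm// lt_min.
  by rewrite /I/= in_itv/= => /andP[u v]; apply/andP; split; lra.
have cI n : {within I n, continuous f}.
  by apply/continuous_in_subspaceT => x; rewrite inE => /Iab; exact: cf.
have lt_I n : a + h n < b - h n by have := h2 n; lra.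
have IF n : (\int[mu]_(x in I n) (f x)%:E = (F (b - h n) - F (a + h n))%:E)%E.
  have cF x : a < x < b -> {for x, continuous F}.
    by move=> /dF dFx; apply/differentiable_continuous/derivable1_diffP.
  rewrite (@continuous_FTC2 _ f F)// ?EFinB//; first exact: cI.
    have ca : a < a + h n < b by have := h0 n; have := h2 n; lra.
    have cb : a < b - h n < b by have := h0 n; have := h2 n; lra.
    apply: And3.
    - by move=> x xI; have /dF : a < x < b; [apply: (@Iab n); apply: subset_itv_oo_cc|].
    - exact/cvg_at_right_filter/cF.
    - exact/cvg_at_left_filter/cF.
  move=> x xI; rewrite derive1E; have /dF : a < x < b.
    by apply: (@Iab n); apply: subset_itv_oo_cc.
  by move=> ?; rewrite derive_val.
have mI : measurable_fun `]a, b[ f.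
  apply: open_continuous_measurable_fun; first exact: interval_open.
  by move=> x; rewrite inE/= in_itv/=; exact: cf.
have := @ge0_nondecreasing_set_cvg_integral _ (measurableTypeR R) R I (EFin \o f) mu.
rewrite IU => hcvg; apply: (cvg_unique _ (hcvg _ _ _ _)) => //.
- move=> m n mn; apply/subsetPset => x; rewrite /I/= !in_itv/= => /andP[u v].
  by have hmn := hS _ _ mn; apply/andP; split; lra.
- by move=> n; exact: measurable_itv.
- move=> n; apply/measurable_EFinP; apply: measurable_funS mI => //.
  by move=> x /Iab; rewrite /= in_itv.
- by move=> n x /Iab/f0; rewrite lee_fin.
rewrite (_ : (fun n => _) = (fun n => (F (b - h n) - F (a + h n))%:E)); last first.
  by apply/funext => n; exact: IF.
apply: cvg_EFin; first exact: nearW.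
rewrite /=; apply: cvgB.
  move/cvg_at_leftP : Fb; apply; split => [n|]; first by rewrite gtrBl.
  by rewrite -[X in _ --> X]subr0; apply: cvgB => //; exact: cvg_cst.
move/cvg_at_rightP : Fa; apply; split => [n|]; first by rewrite ltrDl.
by rewrite -[X in _ --> X]addr0; apply: cvgD => //; exact: cvg_cst.
Qed.

End ge0_FTC.

Section heat_kernel.
Context {R : realType}.
Local Notation mu := (@lebesgue_measure R).
Implicit Types a b x t s : R.

Lemma heat_kernel_ge0 t x : 0 <= heat_kernel t x.
Proof. by rewrite mulr_ge0 ?expR_ge0// invr_ge0 sqrtr_ge0. Qed.

Lemma heat_kernel_normal_pdf t x : 0 < t ->
  heat_kernel t x = normal_pdf 0 (Num.sqrt t) x.
Proof.
move=> t0; have st0 : Num.sqrt t != 0 by rewrite gt_eqF// sqrtr_gt0.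
rewrite normal_pdfE// /normal_peak /normal_fun /heat_kernel.
rewrite sqr_sqrtr ?ltW// subr0 mulNr mulr_natl -mulr_natl.
congr ((Num.sqrt _)^-1 * expR (- (_ / _))); ring.
Qed.

(** The exponents add up as 1/a + 1/b = (a + b) / (a b). Integrating the second factor on the right,
    a probability density, gives the semigroup property at the origin. *)
Lemma heat_kernel_mul a b x : 0 < a -> 0 < b ->
  heat_kernel a x * heat_kernel b x =
  heat_kernel (a + b) 0 * heat_kernel (a * b / (a + b)) x.
Proof.
move=> a0 b0; have ab0 : 0 < a + b by rewrite addr_gt0.
have p0 : 0 < 2 * pi :> R by rewrite mulr_gt0// pi_gt0.
rewrite /heat_kernel mulrACA [RHS]mulrACA -!expRD -!invfM -!sqrtrM; last 2 first.
- by rewrite mulr_ge0 ?ltW.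
- by rewrite mulr_ge0 ?ltW.
congr ((Num.sqrt _)^-1 * expR _).
  by field; rewrite gt_eqF.
by field; rewrite !gt_eqF.
Qed.

Lemma integral_heat_kernel_mul a b : 0 < a -> 0 < b ->
  (\int[mu]_x (heat_kernel a x * heat_kernel b x)%:E =
   (heat_kernel (a + b) 0)%:E)%E.
Proof.
move=> a0 b0; have c0 : 0 < a * b / (a + b) by rewrite divr_gt0 ?mulr_gt0 ?addr_gt0.
under eq_integral do rewrite heat_kernel_mul// [heat_kernel (_ / _) _]heat_kernel_normal_pdf// EFinM.
rewrite ge0_integralZl_EFin ?heat_kernel_ge0//; last 2 first.
- by move=> x _; rewrite lee_fin normal_pdf_ge0.
- by apply/measurable_EFinP; exact: measurable_normal_pdf.
by rewrite integral_normal_pdf mule1.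
Qed.

Lemma heat_kernel0 t : 0 < t ->
  Num.sqrt (2 * pi) * heat_kernel t 0 = (Num.sqrt t)^-1.
Proof.
move=> t0; have p0 : 0 < 2 * pi :> R by rewrite mulr_gt0// pi_gt0.
rewrite /heat_kernel expr0n mul0r oppr0 expR0 mulr1 [Num.sqrt (_ * t)]sqrtrM ?ltW// invfM mulrA.
by rewrite divff ?mul1r// gt_eqF// sqrtr_gt0.
Qed.

(** The boundary case 2m = s, where the integrand is singular at [m], is the one that gives the
    variances. *)
Lemma integral_inv_sqrt s m : 0 <= m -> m *+ 2 <= s ->
  (\int[mu]_(u in `]0%R, m[) ((Num.sqrt (s - 2 * u))^-1)%:E =
   (Num.sqrt s - Num.sqrt (s - 2 * m))%:E)%E.
Proof.
rewrite le_eqVlt => /predU1P[<- _|m0 ms].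
  by rewrite set_itvoo0 integral_set0 mulr0 subr0 subrr.
pose F u := - Num.sqrt (s - 2 * u).
have cF : continuous F.
  move=> u; apply: cvgN; apply: continuous_comp; last exact: sqrt_continuous.
  by apply: cvgB; [exact: cvg_cst|apply: cvgM; [exact: cvg_cst|exact: cvg_id]].
have s0 u : 0 < u < m -> 0 < s - 2 * u by move=> /andP[_ um]; lra.
rewrite (_ : _ - _ = F m - F 0); last by rewrite /F mulr0 subr0 opprK addrC.
apply: ge0_FTC_oo => //.
- move=> u /s0 su; apply: cvgV; first by rewrite gt_eqF// sqrtr_gt0.
  apply: continuous_comp; last exact: sqrt_continuous.
  by apply: cvgB; [exact: cvg_cst|apply: cvgM; [exact: cvg_cst|exact: cvg_id]].
- move=> u /s0 su; have d := is_derive1_sqrt su.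
  have dl : is_derive u (1 : R) (fun u => s - 2 * u) (- 2).
      have h := is_deriveB (is_derive_cst s u (1 : R)) (is_deriveZ 2 (is_derive_id u (1 : R))).
    by apply: (is_derive_eq h); rewrite sub0r -[_ *: _]/(_ * _) mulr1.
  have := is_deriveN (is_derive1_comp (f := Num.sqrt) (g := fun u => s - 2 * u) d dl).
  move=> H; apply: is_derive_eq.
  rewrite invfM; field; rewrite gt_eqF// sqrtr_gt0//.
- exact/cvg_at_right_filter/cF.
- exact/cvg_at_left_filter/cF.
Qed.

End heat_kernel.

Section heat_equation.
Context {R : realType}.
Local Notation mu := (@lebesgue_measure R).
Local Notation st := (@space_time_measure R).

Lemma measurable_sqrt : measurable_fun setT (Num.sqrt : R -> R).
Proof. by apply: continuous_measurable_fun; exact: sqrt_continuous. Qed.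

(** The integrand of [mild_solution] at x = 0, with [0 - z.1] left as it is so that the two are
    convertible. *)
Definition mild_kernel (t : R) (z : R * R) : R :=
  if 0 <= z.2 < t then heat_kernel (t - z.2) (0 - z.1) else 0.

Lemma mild_kernel_ge0 t z : 0 <= mild_kernel t z.
Proof. by rewrite /mild_kernel; case: ifP => // _; exact: heat_kernel_ge0. Qed.

Lemma measurable_mild_kernel t :
  measurable_fun setT (mild_kernel t : space_time R -> R).
Proof.
have m1 : measurable_fun setT (fun z : space_time R => z.1 : R) by exact: measurable_fst.
have m2 : measurable_fun setT (fun z : space_time R => z.2 : R) by exact: measurable_snd.
have mp : measurable_fun setT (fun z : space_time R => 2 * (t - z.2)).
  by apply: measurable_funM => //; exact: measurable_funB.
have mV (g : space_time R -> R) : measurable_fun setT g ->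
    measurable_fun setT (fun z => g z `^ (-1)).
  by move=> mg; exact: (measurableT_comp (@measurable_powR R (-1)) mg).
(* Inverses are rewritten as powers of exponent -1, for which measurability on the whole line is
   available; the two agree where the condition holds. *)
rewrite (_ : mild_kernel t = fun z => if (0 <= z.2) && (z.2 < t) then
    Num.sqrt (pi * (2 * (t - z.2))) `^ (-1) *
    expR (- (z.1 ^+ 2 * (2 * (t - z.2)) `^ (-1))) else 0).
  apply: measurable_fun_ifT => //.
    by apply: measurable_and; [exact: measurable_fun_ler|exact: measurable_fun_ltr].
  apply: measurable_funM.
    apply: mV; apply: (measurableT_comp measurable_sqrt).
    exact: measurable_funM.
  apply: measurableT_comp => //; apply: measurableT_comp => //.
  apply: measurable_funM; first exact: measurable_funX.
  exact: mV.
apply/funext => z; rewrite /mild_kernel; case: ifPn => // /andP[_ zt].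
have tz : 0 < 2 * (t - z.2) by rewrite mulr_gt0// subr_gt0.
rewrite /heat_kernel !powR_inv1 ?sqrtr_ge0 ?ltW// sub0r sqrrN; congr ((Num.sqrt _)^-1 * _).
by rewrite mulrA [2 * _]mulrC.
Qed.

Lemma mild_kernel_covariance s t : 0 <= s -> 0 <= t ->
  (\int[st]_z (mild_kernel s z * mild_kernel t z)%:E =
   ((Num.sqrt (2 * pi))^-1 * rcov s t)%:E)%E.
Proof.
move=> s0 t0; pose m := Num.min s t.
have mst : measurable_fun setT (fun z : space_time R =>
    (mild_kernel s z * mild_kernel t z)%:E).
  by apply/measurable_EFinP; apply: measurable_funM; exact: measurable_mild_kernel.
rewrite /space_time_measure fubini_tonelli2//; last first.
  by move=> z; rewrite lee_fin mulr_ge0// mild_kernel_ge0.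
have p0 : 0 < 2 * pi :> R by rewrite mulr_gt0// pi_gt0.
have q0 : Num.sqrt (2 * pi) != 0 :> R by rewrite gt_eqF// sqrtr_gt0.
transitivity (\int[mu]_(u in `[0%R, m[) ((Num.sqrt (2 * pi))^-1 *
    (Num.sqrt (s + t - 2 * u))^-1)%:E)%E.
  rewrite [RHS]integral_mkcond; apply: eq_integral => u _.
  rewrite /fubini_G /patch mem_setE in_itv/= /m lt_min.
  case: ifPn => [/and3P[u0 us ut]|um].
    rewrite [X in _ = X%:E](_ : _ = heat_kernel ((s - u) + (t - u)) 0); last first.
      rewrite (_ : s + t - 2 * u = (s - u) + (t - u)); last by ring.
      by rewrite -[X in _ * X]heat_kernel0 ?mulKf// addr_gt0// subr_gt0.
    rewrite -integral_heat_kernel_mul ?subr_gt0//; apply: eq_integral => y _.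
    rewrite /mild_kernel/= u0 us ut sub0r; congr (_ * _)%:E.
      by rewrite /heat_kernel sqrrN.
    by rewrite /heat_kernel sqrrN.
  rewrite integral0_eq// => y _; rewrite /mild_kernel/=; congr EFin.
  move: um; rewrite !negb_and; case: (0 <= u) => /=; last by rewrite mul0r.
  by case: (u < s) => /=; [case: (u < t) => //=; rewrite mulr0|rewrite mul0r].
have mi A : measurable A -> measurable_fun A (fun u : R => ((Num.sqrt (s + t - 2 * u))^-1)%:E).
  move=> mA; apply/measurable_EFinP.
  under [X in measurable_fun _ X]eq_fun do rewrite -powR_inv1 ?sqrtr_ge0//.
  apply: measurable_funTS; apply: (measurableT_comp (@measurable_powR R (-1))).
  apply: (measurableT_comp measurable_sqrt).
  by apply: measurable_funB => //; exact: measurable_funM.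
under eq_integral do rewrite EFinM.
rewrite ge0_integralZl_EFin//; last exact: mi.
rewrite -integral_itv_obnd_cbnd; last by apply: mi.
have [m0 ms] : 0 <= m /\ m *+ 2 <= s + t.
  rewrite /m; split; first by rewrite le_min s0.
  by rewrite mulr2n lerD// ge_min lexx ?orbT.
rewrite integral_inv_sqrt// -EFinM; congr (_ * (_ - Num.sqrt _))%:E.
by rewrite /m; case: (leP s t) => h; [rewrite ler0_norm|rewrite gtr0_norm];
  rewrite ?subr_gt0 ?subr_le0//; ring.
Qed.

Theorem heat_r d (T : measurableType d) (P : probability T R) (r : R -> T -> R)
    (r_gauss : centered_gaussian_process P `[0, +oo[%classic r)
    (r_cov : forall t t' : R, 0 <= t' -> t' <= t ->
       'E_P[r t \* r t']%E = (Num.sqrt (t + t') - Num.sqrt (t - t'))%:E)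
    d2 (T2 : measurableType d2) (P2 : probability T2 R)
    (W : set (space_time R) -> T2 -> R) :
  space_time_white_noise P2 W ->
  equal_in_law `[0, +oo[%classic P r
    P2 (fun (t : R) w => (2 * pi) `^ (4^-1) * mild_solution P2 W 0 t w).
Proof.
move=> [gW covW].
have D0 (t : R) : `[0, +oo[%classic t -> 0 <= t by rewrite /= in_itv/= andbT.
have mW := centered_gaussian_process_mfun gW.
have p0 : 0 < 2 * pi :> R by rewrite mulr_gt0// pi_gt0.
have p4 : (2 * pi) `^ 4^-1 * (2 * pi) `^ 4^-1 = Num.sqrt (2 * pi) :> R.
  rewrite -powRD; last by rewrite gt_eqF ?implybT.
  by rewrite -powR12_sqrt ?ltW//; congr (_ `^ _); lra.
have q0 : Num.sqrt (2 * pi) != 0 :> R by rewrite gt_eqF// sqrtr_gt0.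
apply: (@eq_in_law_wiener _ _ _ _ _ P2 st _ space_time_sets id W _ _ _ _ _
  R `[0, +oo[%classic _ _ P r _ mild_kernel) => //.
- by move=> A [].
- by move=> A [].
- by move=> Z; exact: cgauss_lin_span gW.
- by move=> A B hA hB; rewrite -covW// unlock.
- move=> t /D0 t0; apply: is_wiener_integral_ge0.
  + exact: mW.
  + by move=> A [].
  + by move=> A [].
  + by move=> Z; exact: cgauss_lin_span gW.
  + by move=> A B hA hB; rewrite -covW// unlock.
  + exact: measurable_mild_kernel.
  + exact: mild_kernel_ge0.
  + rewrite /msq (_ : (fun z => _) = (fun z => (mild_kernel t z * mild_kernel t z)%:E)).
      by rewrite mild_kernel_covariance// ltry.
    by apply/funext => z; rewrite expr2.
  (* A set on which the kernel is positive lies in nonnegative times, so it belongs to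
     [space_time_sets]. *)
  + move=> A mA Afin Apos; exists A => //; split => // z /Apos/=.
    by rewrite /mild_kernel; case: ifP => [/andP[]//|_]; rewrite ltxx.
- move=> s t /D0 s0 /D0 t0; rewrite (rcovE r_cov)//.
  rewrite (_ : (fun z => _) = (fun z => (Num.sqrt (2 * pi))%:E *
    (mild_kernel s z * mild_kernel t z)%:E)%E); last first.
    by apply/funext => z; rewrite mulrACA p4 EFinM.
  rewrite ge0_integralZl_EFin ?sqrtr_ge0//; last 2 first.
  + by move=> z _; rewrite lee_fin mulr_ge0// mild_kernel_ge0.
  + by apply/measurable_EFinP; apply: measurable_funM; exact: measurable_mild_kernel.
  by rewrite mild_kernel_covariance// -EFinM mulVKf.
Qed.

End heat_equation.

(** * Binomial series and beta integrals *)

Section binomial_series.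
Context {R : realType}.
Implicit Types al x s : R.

(* The coefficients [al (al + 1) ... (al + n - 1) / n!] of [(1 - x)^(- al)]. *)
Definition binser al n : R := \prod_(k < n) ((al + k%:R) / k.+1%:R).

Lemma binser0 al : binser al 0 = 1.
Proof. by rewrite /binser big_ord0. Qed.

Lemma binserS al n : binser al n.+1 * n.+1%:R = binser al n * (al + n%:R).
Proof. by rewrite /binser big_ord_recr/= -mulrA divfK. Qed.

Lemma binser_gt0 al n : 0 < al -> 0 < binser al n.
Proof. by move=> al0; apply: prodr_gt0 => k _; rewrite divr_gt0// ltr_wpDr. Qed.

Lemma norm_binser_le1 al n : `|al| <= 1 -> `|binser al n| <= 1.
Proof.
move=> al1; rewrite /binser normr_prod; apply: prodr_ile1 => k _.
rewrite normr_ge0 normrM normfV (ger0_norm (ler0n R k.+1)) ler_pdivrMr// mul1r -natr1 addrC.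
by rewrite (le_trans (ler_normD _ _))// ger0_norm// lerD2l.
Qed.

(** A partial sum of the series at s x, divided by its claimed sum. It equals 1 at s = 0, so its
    error at s = 1 is a derivative in s. *)
Let phi al x n s : R := (1 - s * x) `^ al * \sum_(k < n.+1) binser al k * (s * x) ^+ k.

(* Every power of [s x] but the last cancels in the derivative of [phi]. *)
Let is_derive_phi al x n s : 0 < 1 - s * x -> is_derive s (1 : R) (phi al x n)
  (- (x * (binser al n * (al + n%:R)) * (s * x) ^+ n * (1 - s * x) `^ (al - 1))).
Proof.
move=> sx; have p : 1 - s * x != 0 by rewrite gt_eqF.
have dl : is_derive s (1 : R) (fun s => s * x) x.
  have h := is_deriveM (is_derive_id s (1 : R)) (is_derive_cst x s (1 : R)).
  by apply: (is_derive_eq h); rewrite scaler0 add0r -[_ *: _]/(_ * _) mulr1.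
have dl1 : is_derive s (1 : R) (fun s => 1 - s * x) (- x).
  have h := is_deriveB (is_derive_cst (1 : R) s (1 : R)) dl.
  by apply: (is_derive_eq h); rewrite sub0r.
have dp : is_derive s (1 : R) (fun s => (1 - s * x) `^ al)
    (al * (1 - s * x) `^ (al - 1) * (- x)).
  have h := is_derive1_comp (f := fun y => y `^ al) (g := fun s => 1 - s * x)
    (is_derive1_powR al sx) dl1.
  exact: h.
have pE : (1 - s * x) `^ al = (1 - s * x) * (1 - s * x) `^ (al - 1).
  transitivity ((1 - s * x) `^ (1 + (al - 1))); first by congr (_ `^ _); ring.
  by rewrite [LHS]powRD ?p ?implybT// powRr1// ltW.
elim: n => [|n IH].
  rewrite (_ : phi al x 0 = fun s => (1 - s * x) `^ al); last first.
    by apply/funext => y; rewrite /phi big_ord1 binser0 expr0 !mulr1.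
  by apply: (is_derive_eq dp); rewrite binser0 expr0 addr0; ring.
rewrite (_ : phi al x n.+1 = phi al x n \+
    (fun s => (1 - s * x) `^ al * (binser al n.+1 * (s * x) ^+ n.+1))); last first.
  by apply/funext => y; rewrite /phi big_ord_recr/= mulrDr.
have dX : is_derive s (1 : R) (fun s => binser al n.+1 * (s * x) ^+ n.+1)
    (binser al n.+1 * (n.+1%:R * (s * x) ^+ n * x)).
  have h := is_deriveZ (binser al n.+1) (is_deriveX n.+1 dl).
  rewrite (_ : (fun s => _) = binser al n.+1 \*: ((fun s => s * x) ^+ n.+1)); last first.
    by apply/funext => y; rewrite exprfctE.
  exact: h.
have h := is_deriveD IH (is_deriveM dp dX).
apply: (is_derive_eq h); rewrite -![_ *: _]/(_ * _) pE.
have c := binserS al n.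
set b := binser al n.+1 in c *; set q := (s * x) ^+ n.
have -> : binser al n * (al + n%:R) = b * n.+1%:R by rewrite c.
rewrite exprS -/q; set y := s * x; set w := _ `^ _; rewrite -natr1; ring.
Qed.

(** With q = r^2, the Bernoulli inequality for (1 / r)^n bounds (n + 1) r^n by a constant, and the
    other factor r^n tends to 0. *)
Lemma cvg_nexpr (q : R) : 0 <= q < 1 -> n.+1%:R * q ^+ n @[n --> \oo] --> 0.
Proof.
move=> /andP[q0 q1]; pose u n : R := n.+1%:R * q ^+ n.
have [->|qn0] := eqVneq q 0.
  apply/cvgrPdist_le => e e0; exists 1%N => // n /= n0.
  by rewrite expr0n gtn_eqF// mulr0 subrr normr0 ltW.
have {qn0} qgt0 : 0 < q by rewrite lt_def qn0.
pose r := Num.sqrt q; have r0 : 0 < r by rewrite sqrtr_gt0.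
have r1 : r < 1 by rewrite -sqrtr1 ltr_sqrt.
have rq : r * r = q by rewrite -expr2 sqr_sqrtr.
pose p := r^-1 - 1; have p0 : 0 < p by rewrite subr_gt0 invf_gt1.
pose C := 1 + p^-1.
apply: (squeeze_cvgr (f := cst 0) (h := fun n => C * r ^+ n)).
- apply: nearW => n /=; apply/andP; split; first by rewrite mulr_ge0// exprn_ge0.
  rewrite -rq exprMn mulrA ler_wpM2r ?exprn_ge0 ?(ltW r0)//.
  have rn0 : 0 < r ^+ n by rewrite exprn_gt0.
  rewrite -ler_pdivlMr// -exprVn; have -> : r^-1 = 1 + p by rewrite /p; ring.
  apply: (le_trans _ (ler_wpM2l _ (bernoulli_le n _))).
  + have -> : C * (1 + n%:R * p) = n.+1%:R + (n%:R * p + p^-1).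
      by rewrite /C -natr1; field; rewrite gt_eqF.
    by rewrite lerDl addr_ge0 ?mulr_ge0 ?invr_ge0// ltW.
  + by rewrite addr_ge0// invr_ge0 ltW.
  + by apply: le_trans (ltW p0); lra.
- exact: cvg_cst.
- by rewrite -(mulr0 C); apply: cvgMr; apply: cvg_expr; rewrite ger0_norm// ltW.
Qed.

(** By the mean value theorem for [phi] on [0, 1], the error is at most (1 - |x|)^(al - 1) (n + 1)
    |x|^n. The condition |al| <= 1 bounds the coefficients by 1 and makes the exponent al - 1
    nonpositive, so that its power is largest at 1 - |x|. *)
Lemma binomial_series al x : `|al| <= 1 -> `|x| < 1 ->
  \sum_(k < n) binser al k * x ^+ k @[n --> \oo] --> (1 - x) `^ (- al).
Proof.
move=> al1 x1; rewrite -cvg_shiftS/=.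
have x1' : 0 < 1 - x by rewrite subr_gt0 (le_lt_trans (ler_norm x)).
have q0 : 0 < 1 - `|x| by rewrite subr_gt0.
suff h : phi al x n 1 @[n --> \oo] --> (1 : R).
  have pw : (1 - x) `^ al != 0 by rewrite gt_eqF// powR_gt0.
  have -> : (fun n => \sum_(k < n.+1) binser al k * x ^+ k) =
      (fun n => ((1 - x) `^ al)^-1 * phi al x n 1).
    by apply/funext => n; rewrite /phi mul1r mulKf.
  have := cvgM (cvg_cst ((1 - x) `^ al)^-1) h.
  by rewrite mulr1 powRN; exact.
pose C : R := (1 - `|x|) `^ (al - 1).
have bnd n : `|phi al x n 1 - 1| <= C * (n.+1%:R * `|x| ^+ n).
  have sx (s : R) : 0 <= s <= 1 -> `|s * x| <= `|x|.
    by move=> /andP[s0 s1]; rewrite normrM ger0_norm// ler_piMl.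
  have sx0 (s : R) : 0 <= s <= 1 -> 1 - `|x| <= 1 - s * x.
    by move=> /sx h; rewrite lerB// (le_trans (ler_norm _)).
  have dphi (s : R) : 0 <= s <= 1 -> is_derive s (1 : R) (phi al x n)
      (- (x * (binser al n * (al + n%:R)) * (s * x) ^+ n * (1 - s * x) `^ (al - 1))).
    by move=> /sx0 h; apply: is_derive_phi; exact: lt_le_trans h.
  have [||c] := MVT_segment ler01 (f := phi al x n) (df := fun s =>
    - (x * (binser al n * (al + n%:R)) * (s * x) ^+ n * (1 - s * x) `^ (al - 1))).
  - by move=> s; rewrite in_itv/= => /andP[s0 s1]; apply: dphi; rewrite !ltW.
  - apply/continuous_in_subspaceT => s; rewrite inE/= in_itv/= => /dphi ds.
    exact/differentiable_continuous/derivable1_diffP.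
  rewrite in_itv/= => c01; have -> : phi al x n 0 = 1.
    rewrite /phi mul0r subr0 powR1 mul1r big_ord_recl expr0 binser0 big1 ?mulr1 ?addr0//.
    by move=> k _; rewrite expr0n mulr0.
  rewrite subr0 mulr1 => ->; rewrite normrN !normrM normrX.
  have hb : `|x| * (`|binser al n| * `|al + n%:R|) <= n.+1%:R.
    rewrite -[leRHS]mul1r ler_pM// ?mulr_ge0//; first exact: ltW.
    rewrite -[leRHS]mul1r ler_pM//; first exact: norm_binser_le1.
    by rewrite -natr1 addrC (le_trans (ler_normD _ _))// ger0_norm// lerD2l.
  have hx : `|c * x| ^+ n <= `|x| ^+ n by rewrite lerXn2r ?nnegrE// sx.
  have hp : `|(1 - c * x) `^ (al - 1)| <= (1 - `|x|) `^ (al - 1).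
    rewrite ger0_norm ?powR_ge0// (_ : al - 1 = - (1 - al)); last by ring.
    rewrite !powRN lef_pV2 ?posrE ?powR_gt0//; last first.
      exact: lt_le_trans (sx0 _ c01).
    apply: ge0_ler_powR; rewrite ?nnegrE ?subr_ge0//; last exact: sx0.
    - by rewrite (le_trans (ler_norm _)).
    - exact: ltW.
    - by have := sx0 _ c01; lra.
  rewrite /C [leRHS]mulrC; apply: ler_pM => //.
  by apply: ler_pM => //; rewrite ?mulr_ge0// exprn_ge0.
apply/cvgrPdist_le => e e0; near=> n.
rewrite distrC; apply: (le_trans (bnd n)).
near: n.
have x01 : 0 <= `|x| < 1 by rewrite normr_ge0.
have /cvgrPdist_le/(_ e e0) : C * (n.+1%:R * `|x| ^+ n) @[n --> \oo] --> 0.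
  by rewrite -(mulr0 C); apply: cvgMr; exact: cvg_nexpr.
apply: filterS => n; rewrite sub0r normrN; exact: le_trans (ler_norm _).
Unshelve. all: by end_near. Qed.

(* [B(n + 3/4, 3/4) / B(3/4, 3/4)] *)
Definition beta_ratio n : R := \prod_(k < n) ((k%:R + 3 / 4) / (k%:R + 3 / 2)).

Lemma beta_ratioS n : beta_ratio n.+1 * (n%:R + 3 / 2) = beta_ratio n * (n%:R + 3 / 4).
Proof.
have h : n%:R + 3 / 2 != 0 :> R by rewrite gt_eqF// ltr_wpDl.
by rewrite /beta_ratio big_ord_recr/= -mulrA divfK.
Qed.

(** The identity behind the Brownian representation: the odd coefficients of sqrt(1 + z) - sqrt(1 -
    z) are those of the expanded integral. Both sides equal 1 at n = 0 and are multiplied by (n +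
    1/4) (n + 3/4) / ((n + 1) (n + 3/2)) from n to n + 1. *)
Lemma binser_odd n :
  - 2 * binser (- 2^-1) n.*2.+1 = binser 4^-1 n * beta_ratio n.
Proof.
elim: n => [|n IH].
  rewrite /binser big_ord1 /beta_ratio !big_ord0 /= addr0 divr1; lra.
have h1 := binserS (- 2^-1) n.*2.+1; have h2 := binserS (- 2^-1) n.*2.+2.
have h3 := binserS 4^-1 n; have h4 := beta_ratioS n.
have e2 : n.*2.+2%:R = 2 * (n%:R + 1) :> R by rewrite -doubleS -mul2n natrM -[n.+1%:R]natr1.
have e1 : n.*2.+1%:R = 2 * n%:R + 1 :> R by rewrite -[n.*2.+1%:R]natr1 -mul2n natrM.
have e3 : n.*2.+3%:R = 2 * n%:R + 3 :> R by rewrite -natr1 e2; ring.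
rewrite doubleS; move: h1 h2 h3 h4 IH; rewrite -(natr1 n) e1 e2 e3.
have n0 : 0 <= n%:R :> R by [].
set N : R := n%:R in n0 *.
set b1 := binser _ n.*2.+1; set b2 := binser _ n.*2.+2; set b3 := binser _ n.*2.+3.
set a := binser _ n; set a' := binser _ n.+1; set w := beta_ratio n; set w' := beta_ratio _.
move=> h1 h2 h3 h4 IH.
have p1 : 2 * (N + 1) != 0 by rewrite gt_eqF//; lra.
have p3 : 2 * N + 3 != 0 by rewrite gt_eqF//; lra.
have pa : N + 1 != 0 by rewrite gt_eqF//; lra.
have pw : N + 3 / 2 != 0 by rewrite gt_eqF//; lra.
(* All denominators are multiplied out so that the recurrences can be substituted as equations
   between products. *)
apply: (mulIf p3); apply: (mulIf p1); apply: (mulIf pa); apply: (mulIf pw).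
have -> : - 2 * b3 * (2 * N + 3) * (2 * (N + 1)) * (N + 1) * (N + 3 / 2) =
  - 2 * (b3 * (2 * N + 3)) * (2 * (N + 1)) * (N + 1) * (N + 3 / 2) by ring.
have -> : a' * w' * (2 * N + 3) * (2 * (N + 1)) * (N + 1) * (N + 3 / 2) =
  (a' * (N + 1)) * (w' * (N + 3 / 2)) * (2 * N + 3) * (2 * (N + 1)) by ring.
rewrite h2 h3 h4.
have -> : - 2 * (b2 * (- 2^-1 + 2 * (N + 1))) * (2 * (N + 1)) * (N + 1) * (N + 3 / 2) =
  - 2 * (b2 * (2 * (N + 1))) * (- 2^-1 + 2 * (N + 1)) * (N + 1) * (N + 3 / 2) by ring.
rewrite h1.
have -> : - 2 * (b1 * (- 2^-1 + (2 * N + 1))) * (- 2^-1 + 2 * (N + 1)) * (N + 1) * (N + 3 / 2) =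
  (- 2 * b1) * (- 2^-1 + (2 * N + 1)) * (- 2^-1 + 2 * (N + 1)) * (N + 1) * (N + 3 / 2) by ring.
by rewrite IH; field.
Qed.

Lemma sum_odd (u : nat -> R) n :
  \sum_(k < n.*2) (u k - (- 1) ^+ k * u k) = 2 * \sum_(k < n) u k.*2.+1.
Proof.
elim: n => [|n IH]; first by rewrite double0 !big_ord0 mulr0.
rewrite doubleS !big_ord_recr/= IH exprS -signr_odd odd_double expr0; ring.
Qed.

(** The difference of the series of exponent 1/2 at - z and at z keeps the odd terms only; the
    partial sums are taken along even lengths to pair the terms. *)
Lemma cvg_odd_series (z : R) : 0 <= z < 1 ->
  \sum_(k < n) (binser 4^-1 k * beta_ratio k * z ^+ k.*2.+1) @[n --> \oo] -->
  (Num.sqrt (1 + z) - Num.sqrt (1 - z) : R).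
Proof.
move=> /andP[z0 z1].
have al1 : `|- 2^-1 : R| <= 1 by rewrite normrN ger0_norm//; lra.
have nz : `|z| < 1 by rewrite ger0_norm.
have nNz : `|- z| < 1 by rewrite normrN.
have := cvgB (binomial_series al1 nNz) (binomial_series al1 nz).
rewrite !opprK !powR12_sqrt ?subr_ge0 ?addr_ge0 ?(ltW z1)// => h0; have h := h0 eventually_filter.
have h2 : (fun n => n.*2) @ \oo --> \oo.
  move=> A [N _ NA]; exists N => // n /= Nn; apply: NA => /=.
  by rewrite (leq_trans Nn)// -addnn leq_addr.
have := cvg_comp _ _ h2 h; apply: cvg_trans; apply: near_eq_cvg; apply: nearW => n /=.
rewrite -[LHS]/(\sum_(k < n.*2) binser (- 2^-1) k * (- z) ^+ k -
  \sum_(k < n.*2) binser (- 2^-1) k * z ^+ k) -sumrB.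
pose u k := - (binser (- 2^-1) k * z ^+ k).
transitivity (2 * \sum_(k < n) u k.*2.+1).
  rewrite -sum_odd; apply: eq_bigr => k _; rewrite /u [(- z) ^+ k]exprNn.
  by set e := (- 1) ^+ k; ring.
by rewrite mulr_sumr; apply: eq_bigr => k _; rewrite -binser_odd /u; ring.
Qed.

Lemma odd_series_coef_ge0 k : 0 <= binser 4^-1 k * beta_ratio k.
Proof.
rewrite mulr_ge0//; first by rewrite ltW// binser_gt0.
by apply: prodr_ge0 => i _; rewrite divr_ge0// addr_ge0.
Qed.

End binomial_series.

(** * Termwise integration: the beta function and the covariance of the Brownian kernels *)

Section brownian_covariance.
Context {R : realType}.
Local Notation mu := (@lebesgue_measure R).
Local Notation a := (@binser R 4^-1).
Local Notation w := (@beta_ratio R).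

Lemma nneseries_EFin (u : nat -> R) (l : R) :
  \sum_(k < n) u k @[n --> \oo] --> l ->
  (\sum_(0 <= k <oo) (u k)%:E)%E = l%:E.
Proof.
move=> ul; apply/cvg_lim => //.
rewrite (_ : (fun n => _) = (fun n => (\sum_(k < n) u k)%:E)); last first.
  by apply/funext => n; rewrite big_mkord sumEFin.
by apply: cvg_EFin => //; exact: nearW.
Qed.

(** The end point z = 1 gives the variances. All terms are nonnegative, so an Abel argument works:
    each partial sum at 1 is a left limit of partial sums below [h z], and conversely [h z] is at
    most the sum at 1. *)
Lemma cvg_odd_series_le1 (z : R) : 0 <= z <= 1 ->
  \sum_(k < n) (a k * w k * z ^+ k.*2.+1) @[n --> \oo] -->
  (Num.sqrt (1 + z) - Num.sqrt (1 - z) : R).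
Proof.
move=> /andP[z0]; rewrite le_eqVlt => /predU1P[->{z z0}|z1]; last first.
  by apply: cvg_odd_series; rewrite z0.
pose h (z : R) : R := Num.sqrt (1 + z) - Num.sqrt (1 - z).
have ch : continuous h.
  move=> x; apply: cvgB.
    apply: continuous_comp; last exact: sqrt_continuous.
    by apply: cvgD; [exact: cvg_cst|exact: cvg_id].
  apply: continuous_comp; last exact: sqrt_continuous.
  by apply: cvgB; [exact: cvg_cst|exact: cvg_id].
pose p (n : nat) (z : R) : R := \sum_(k < n) (a k * w k * z ^+ k.*2.+1).
have v0 := @odd_series_coef_ge0 R.
have cp n : continuous (p n).
  elim: n => [|n IH] x.
    by rewrite /p; under eq_fun do rewrite big_ord0; exact: cvg_cst.
  rewrite (_ : p n.+1 = p n \+ (fun z => a n * w n * z ^+ n.*2.+1)); last first.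
    by apply/funext => y; rewrite /p big_ord_recr.
  apply: cvgD; first exact: IH.
  by apply: cvgM; [exact: cvg_cst|exact: exprn_continuous].
have near1 : \forall z \near (1 : R)^'-, 0 <= z < 1.
  near=> z; apply/andP; split; near: z; last exact: nbhs_left_lt.
  by apply: nbhs_left_ge.
have nd (z : R) : 0 <= z -> nondecreasing_seq (p ^~ z).
  move=> z0; apply/nondecreasing_seqP => n; rewrite /p big_ord_recr/= lerDl.
  by rewrite mulr_ge0// exprn_ge0.
have ph (z : R) n : 0 <= z < 1 -> p n z <= h z.
  move=> z01; have z0 : 0 <= z by case/andP: z01.
  have := cvg_odd_series z01 => hz.
  have <- : limn (p ^~ z) = h z by exact: (cvg_lim (@Rhausdorff R) hz).
  apply: nondecreasing_cvgn_le; first exact: nd.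
  by apply/cvg_ex; exists (h z).
have p1 n : p n 1 <= h 1.
  apply: (cvgr_to_le (cvg_at_left_filter (@cp n 1))); near=> z.
  have z01 : 0 <= z < 1 by near: z.
  apply: (le_trans (@ph z n z01)); case/andP: z01 => z0 z1.
  by rewrite /h lerB// ler_wsqrtr// ?lerD2l ?lerN2 ltW.
have cvg1 : cvgn (p ^~ 1).
  apply: nondecreasing_is_cvgn; first exact: nd.
  by exists (h 1) => _ [n _ <-].
suff e : limn (p ^~ 1) = h 1 by rewrite -[_ - _]/(h 1) -e; exact: cvg1.
apply/eqP; rewrite eq_le; apply/andP; split.
  by apply: limr_le => //; exact: nearW.
have h1 := cvg_at_left_filter (ch 1).
apply: (cvgr_to_le h1); near=> z.
have z01 : 0 <= z < 1 by near: z.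
have /andP[z0 z1] := z01.
have hz := cvg_odd_series z01.
rewrite -[leLHS](cvg_lim (@Rhausdorff R) hz); apply: ler_lim => //.
  by apply/cvg_ex; exists (h z).
apply: nearW => n; apply: ler_sum => k _.
by rewrite ler_wpM2l// expr1n exprn_ile1// ltW.
Unshelve. all: by end_near. Qed.

Lemma integral_powR (m p : R) : 0 < m -> -1 < p ->
  (\int[mu]_(x in `]0%R, m[) (x `^ p)%:E = (m `^ (p + 1) / (p + 1))%:E)%E.
Proof.
move=> m0 p1; have q0 : 0 < p + 1 by lra.
pose F (x : R) := x `^ (p + 1) / (p + 1).
have dF (x : R) : 0 < x -> is_derive x (1 : R) F (x `^ p).
  move=> x0; have h := is_deriveZ (p + 1)^-1 (is_derive1_powR (p + 1) x0).
  rewrite (_ : F = (p + 1)^-1 \*: (fun y : R => y `^ (p + 1))); last first.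
    by apply/funext => y; rewrite /F mulrC.
  apply: (is_derive_eq h); rewrite -[_ *: _]/(_ * _) mulKf ?gt_eqF//.
  by congr (_ `^ _); ring.
have F0 : F 0 = 0 by rewrite /F powR0 ?mul0r// gt_eqF.
rewrite (_ : _ / _ = F m - F 0); last by rewrite F0 subr0.
apply: ge0_FTC_oo => //.
- by move=> x /andP[x0 xm]; rewrite powR_ge0.
- move=> x /andP[x0 xm]; apply/differentiable_continuous/derivable1_diffP.
  by have [] := is_derive1_powR p x0.
- by move=> x /andP[/dF].
- have -> : F 0 = 0 * (p + 1)^-1 by rewrite F0 mul0r.
  apply: cvgM; last exact: cvg_cst.
  exact: powR_cvg0.
- apply: cvg_at_left_filter; apply/differentiable_continuous/derivable1_diffP.
  by have [] := dF m m0.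
Qed.

(** Nonnegativity of all terms allows the exchange of sum and integral. The exponent [e] is 1 for
    the beta function and 2 for the Brownian kernels. *)
Lemma integral_binser (W : R -> R) (m t : R) (e : nat) : 0 < m -> m <= t -> (0 < e)%N ->
  measurable_fun `]0, m[ W -> (forall x, 0 < x < m -> 0 <= W x) ->
  (\int[mu]_(x in `]0%R, m[) (W x * (1 - (x / t) ^+ e) `^ (- 4^-1))%:E =
   \sum_(0 <= k <oo) \int[mu]_(x in `]0%R, m[) (W x * (a k * (x / t) ^+ (e * k)))%:E)%E.
Proof.
move=> m0 mt e0 mW W0; have t0 : 0 < t by exact: lt_le_trans mt.
have a0 k : 0 <= a k by rewrite ltW// binser_gt0.
rewrite -integral_nneseries//; last 2 first.
- move=> k; apply/measurable_EFinP; apply: measurable_funM => //.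
  apply: measurable_funM => //; apply: measurable_funX.
  exact: measurable_funM.
- move=> k x; rewrite /= in_itv/= => x0m; rewrite lee_fin !mulr_ge0 ?W0//.
  by rewrite exprn_ge0// divr_ge0// ltW//; case/andP: x0m.
apply: eq_integral => x; rewrite inE/= in_itv/= => /andP[x0 xm].
apply/esym/nneseries_EFin.
have xt : 0 <= x / t < 1.
  by rewrite divr_ge0 ?(ltW x0) ?(ltW t0)//= ltr_pdivrMr// mul1r (lt_le_trans xm).
have al1 : `|4^-1 : R| <= 1 by rewrite ger0_norm//; lra.
have xe : `|(x / t) ^+ e| < 1.
  case/andP: xt => ? ?; rewrite ger0_norm ?exprn_ge0//; by rewrite exprn_ilt1// -lt0n.
have h := binomial_series al1 xe.
rewrite (_ : (fun n => _) = (fun n => W x * \sum_(k < n) a k * (x / t) ^+ e ^+ k)).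
  exact: cvgMr.
by apply/funext => n; rewrite mulr_sumr; apply: eq_bigr => k _; rewrite exprM.
Qed.

(* Partial sums of [B(n + 3/4, 3/4)], the moment of [u^n] under
   [u^(- 1/4) (1 - u)^(- 1/4) du], obtained by expanding the second factor. *)
Definition beta_sum n K : R := \sum_(k < K) a k / (k%:R + n%:R + 3 / 4).

Let aS k : a k.+1 * (k%:R + 1) = a k * (k%:R + 4^-1).
Proof. by have := binserS (4^-1 : R) k; rewrite -[k.+1%:R]natr1 [4^-1 + _]addrC. Qed.

Let a_gt0 k : 0 < a k. Proof. exact: binser_gt0. Qed.

(** The functional equation B(x + 1, y) = x / (x + y) B(x, y) at x = n + 3/4, y = 3/4, for partial
    sums: the last term is the error of truncation. *)
Lemma beta_sumS n K : (n%:R + 3 / 2) * beta_sum n.+1 K =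
  (n%:R + 3 / 4) * beta_sum n K - K%:R * a K / (K%:R + n%:R + 3 / 4).
Proof.
elim: K => [|K IH]; first by rewrite /beta_sum !big_ord0 !mulr0 mul0r mul0r subr0.
rewrite /beta_sum !big_ord_recr/= -/(beta_sum _ _) -/(beta_sum _ _) !mulrDr IH.
rewrite -(natr1 n) -(natr1 K); have := aS K.
have n0 : 0 <= n%:R :> R by []. have K0 : 0 <= K%:R :> R by [].
set N : R := n%:R in n0 *; set k : R := K%:R in K0 *; set b := a K; set b' := a K.+1 => h.
have p1 : k + N + 3 / 4 != 0 by rewrite gt_eqF//; lra.
have p2 : k + (N + 1) + 3 / 4 != 0 by rewrite gt_eqF//; lra.
have p3 : k + 1 + N + 3 / 4 != 0 by rewrite gt_eqF//; lra.
have -> : (k + 1) * b' = b * (k + 4^-1) by rewrite -h; ring.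
field.
by rewrite !gt_eqF//; lra.
Qed.

(** A crude form of the decay of the coefficients, strong enough to make them tend to 0. *)
Let a_sqr k : a k ^+ 2 * (k%:R + 1) <= 1.
Proof.
elim: k => [|k IH]; first by rewrite binser0 expr1n add0r mulr1.
apply: le_trans IH; have k0 : 0 <= k%:R :> R by [].
rewrite -[k.+1%:R]natr1; have := aS k.
set K : R := k%:R in k0 *; set b := a k; set b' := a k.+1 => h.
have p : K + 1 != 0 by rewrite gt_eqF//; lra.
have -> : b' = b * (K + 4^-1) / (K + 1) by rewrite -h mulfK.
have -> : (b * (K + 4^-1) / (K + 1)) ^+ 2 * (K + 1 + 1) =
    b ^+ 2 * ((K + 4^-1) ^+ 2 * (K + 2) / (K + 1) ^+ 2) by field.
rewrite ler_wpM2l ?sqr_ge0// ler_pdivrMr ?exprn_gt0//; last by lra.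
have := mulr_ge0 k0 k0; nra.
Qed.


Let a_cvg0 : a @ \oo --> (0 : R).
Proof.
have h : Num.sqrt (k.+1%:R^-1) @[k --> \oo] --> (0 : R).
  rewrite -sqrtr0; apply: continuous_cvg; first exact: sqrt_continuous.
  exact: cvg_harmonic.
apply: (squeeze_cvgr (f := cst 0) (h := fun k => Num.sqrt (k.+1%:R^-1))) => //; last exact: cvg_cst.
apply: nearW => k; rewrite /= ltW//= -[leLHS]ger0_norm ?(ltW (a_gt0 k))// -sqrtr_sqr.
rewrite ler_wsqrtr// -[leRHS]mul1r ler_pdivlMr// -[k.+1%:R]natr1; exact: a_sqr.
Qed.

(** Convergence is shown for n = 0 by monotonicity; [beta_sumS], whose error term is at most [a K],
    then propagates it to every n with the ratio that defines [beta_ratio]. *)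
Lemma cvg_beta_sum : exists2 B : R, 0 < B & forall n, beta_sum n @ \oo --> B * w n.
Proof.
have nd : nondecreasing_seq (beta_sum 0).
  apply/nondecreasing_seqP => K; rewrite /beta_sum big_ord_recr/= lerDl.
  by rewrite divr_ge0 ?addr_ge0// ltW.
(* A telescoping bound: a_K - a_(K+1) = (3/4) a_K / (K + 1) and (K + 1) / (K + 3/4) <= 4/3, whence
   the constant (4/3)^2 = 16/9. *)
have ub K : beta_sum 0 K <= 16 / 9 * (1 - a K).
  elim: K => [|K IH]; first by rewrite /beta_sum big_ord0 binser0 subrr mulr0.
  rewrite /beta_sum big_ord_recr/= -/(beta_sum _ _) addr0.
  have K0 : 0 <= K%:R :> R by [].
  have h := aS K; have b0 := a_gt0 K; set k : R := K%:R in K0 h *.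
  have p1 : 0 < k + 1 by lra.
  have p2 : 0 < k + 3 / 4 by lra.
  have hd : a K / (k + 3 / 4) <= 16 / 9 * (a K - a K.+1).
    rewrite ler_pdivrMr// -(@ler_pM2r _ (k + 1))//.
    have -> : 16 / 9 * (a K - a K.+1) * (k + 3 / 4) * (k + 1) =
      16 / 9 * (a K * (k + 1) - a K.+1 * (k + 1)) * (k + 3 / 4) by ring.
    rewrite h; nra.
  by apply: (le_trans (lerD IH hd)); rewrite le_eqVlt; apply/orP; left; apply/eqP; ring.
have cB : cvgn (beta_sum 0).
  apply: nondecreasing_is_cvgn => //; exists (16 / 9) => _ [K _ <-].
  by apply: (le_trans (ub K)); have := a_gt0 K; lra.
pose B := limn (beta_sum 0).
exists B.
  have : beta_sum 0 1 <= B by exact: nondecreasing_cvgn_le.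
  apply: lt_le_trans; rewrite /beta_sum big_ord1 binser0/= !add0r; lra.
elim=> [|n IH]; first by rewrite /beta_ratio big_ord0 mulr1; exact: cB.
have n0 : 0 <= n%:R :> R by [].
have p : n%:R + 3 / 2 != 0 :> R by rewrite gt_eqF//; lra.
have d0 : K%:R * a K / (K%:R + n%:R + 3 / 4) @[K --> \oo] --> (0 : R).
  apply: (squeeze_cvgr (f := cst 0) (h := fun k => a k)) => //; last exact: cvg_cst.
  apply: nearW => K; have K0 : 0 <= K%:R :> R by [].
  have b0 := a_gt0 K; have p2 : 0 < K%:R + n%:R + 3 / 4 :> R by lra.
  rewrite /= divr_ge0 ?mulr_ge0 ?(ltW p2) ?(ltW b0)//= ler_pdivrMr//; nra.
have -> : beta_sum n.+1 = (fun K => (n%:R + 3 / 2)^-1 * ((n%:R + 3 / 4) * beta_sum n K -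
    K%:R * a K / (K%:R + n%:R + 3 / 4))).
  by apply/funext => K; rewrite -beta_sumS mulKf.
have -> : B * w n.+1 = (n%:R + 3 / 2)^-1 * ((n%:R + 3 / 4) * (B * w n) - 0).
  have h := beta_ratioS (R := R) n.
  apply: (mulIf p); rewrite -mulrA h subr0; field; rewrite gt_eqF//; lra.
apply: cvgMr; apply: cvgB => //; exact: cvgMr.
Qed.

(** The substitution x = m sqrt u would turn this integral into m^(2n+1) / 2 times B(n + 3/4, 3/4);
    it is evaluated by expanding in powers of x / m, which leads to [beta_sum n]. *)
Lemma beta_ratio_integral n (B : R) : beta_sum n @ \oo --> B * w n -> forall m : R, 0 < m ->
  (\int[mu]_(x in `]0%R, m[) (x `^ (2^-1) * x ^+ n.*2 * (m ^+ 2 - x ^+ 2) `^ (- 4^-1))%:E =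
   (m ^+ n.*2.+1 / 2 * (B * w n))%:E)%E.
Proof.
move=> hB m m0; have mn0 : m != 0 by rewrite gt_eqF.
pose W (x : R) := m `^ (- 2^-1) * (x `^ (2^-1) * x ^+ n.*2).
have mW : measurable_fun `]0, m[ W.
  apply: measurable_funM => //; apply: measurable_funM => //.
  by apply: measurable_funTS; exact: measurable_powR.
transitivity (\int[mu]_(x in `]0%R, m[) (W x * (1 - (x / m) ^+ 2) `^ (- 4^-1))%:E)%E.
  apply: eq_integral => x; rewrite inE/= in_itv/= => /andP[x0 xm]; congr EFin.
  have -> : m ^+ 2 - x ^+ 2 = m ^+ 2 * (1 - (x / m) ^+ 2) by field.
  have xm1 : x / m <= 1 by rewrite ler_pdivrMr// mul1r ltW.
  rewrite powRM ?exprn_ge0 ?(ltW m0)//; last first.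
    by rewrite subr_ge0 exprn_ile1// divr_ge0// ltW.
  rewrite -[m ^+ 2]powR_mulrn ?(ltW m0)// -powRrM.
  rewrite (_ : 2%:R * - 4^-1 = - 2^-1 :> R); last by lra.
  rewrite /W; ring.
rewrite integral_binser//; last first.
  by move=> x /andP[x0 _]; rewrite !mulr_ge0 ?powR_ge0// exprn_ge0// ltW.
have tE k : (\int[mu]_(x in `]0%R, m[) (W x * (a k * (x / m) ^+ (2 * k)))%:E =
    (m ^+ n.*2.+1 / 2 * (a k / (k%:R + n%:R + 3 / 4)))%:E)%E.
  have k0 : 0 <= k%:R :> R by []. have n0 : 0 <= n%:R :> R by [].
  (* The exponent of x in the k-th term. As p + 1 = 2 (k + n + 3/4), integration produces the
     denominators of [beta_sum] and the factor 1/2. *)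
  pose p : R := 2^-1 + (n.*2 + 2 * k)%:R.
  have pE : p = 2 * (k%:R + n%:R + 3 / 4) - 1.
    by rewrite /p natrD -muln2 !natrM; field.
  have p1 : p + 1 != 0 by rewrite pE gt_eqF//; lra.
  pose C := m `^ (- 2^-1) * a k / m ^+ (2 * k).
  transitivity (\int[mu]_(x in `]0%R, m[) (C%:E * (x `^ p)%:E))%E.
    apply: eq_integral => x; rewrite inE/= in_itv/= => /andP[x0 xm].
    rewrite -EFinM; congr EFin; rewrite /W /C /p powRD; last by rewrite gt_eqF ?implybT.
    rewrite powR_mulrn ?(ltW x0)// exprD expr_div_n; ring.
  rewrite ge0_integralZl_EFin//; last 3 first.
  - by move=> x _; rewrite lee_fin powR_ge0.
  - by apply/measurable_EFinP; apply: measurable_funTS; exact: measurable_powR.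
  - by rewrite /C divr_ge0 ?exprn_ge0 ?(ltW m0)// mulr_ge0 ?powR_ge0// ltW// binser_gt0.
  rewrite integral_powR//; last by rewrite pE; lra.
  rewrite -EFinM; congr EFin.
  have -> : m `^ (p + 1) = m `^ (2^-1) * m ^+ (2 * k) * m ^+ n.*2.+1.
    rewrite -mulrA -exprD -powR_mulrn ?(ltW m0)// -powRD ?mn0 ?implybT//.
    by congr (_ `^ _); rewrite /p !natrD -[n.*2.+1%:R]natr1; ring.
  have mk : m ^+ (2 * k) != 0 by rewrite expf_neq0.
  have m2 : m `^ (- 2^-1) * m `^ (2^-1) = 1 by rewrite -powRD ?mn0 ?implybT// addrC subrr powRr0.
  transitivity ((m `^ (- 2^-1) * m `^ (2^-1)) * (a k * m ^+ n.*2.+1 / (p + 1))).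
    by rewrite /C; field; rewrite p1.
  by rewrite m2 mul1r pE; field; rewrite !gt_eqF//; lra.
under eq_eseriesr do rewrite tE.
apply: nneseries_EFin.
under eq_fun do rewrite -mulr_sumr.
exact: cvgMr.
Qed.

Lemma euler_betaE (B : R) : beta_sum 0 @ \oo --> B -> euler_beta (3 / 4) (3 / 4) = B.
Proof.
move=> hB; rewrite /euler_beta /Rintegral.
transitivity (fine (B%:E)) => //; congr fine.
transitivity (\int[mu]_(x in `]0%R, 1%R[) (x `^ (- 4^-1) * (1 - (x / 1) ^+ 1) `^ (- 4^-1))%:E)%E.
  apply: eq_integral => x _; rewrite divr1 expr1.
  by rewrite (_ : 3 / 4 - 1 = - 4^-1 :> R)//; lra.
rewrite integral_binser//; last 2 first.
- by apply: measurable_funTS; exact: measurable_powR.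
- by move=> x _; rewrite powR_ge0.
have tE k : (\int[mu]_(x in `]0%R, 1%R[) (x `^ (- 4^-1) * (a k * (x / 1) ^+ (1 * k)))%:E =
    (a k / (k%:R + 0%:R + 3 / 4))%:E)%E.
  have k0 : 0 <= k%:R :> R by [].
  transitivity (\int[mu]_(x in `]0%R, 1%R[) ((a k)%:E * (x `^ (k%:R - 4^-1))%:E))%E.
    apply: eq_integral => x; rewrite inE/= in_itv/= => /andP[x0 xm].
    rewrite -EFinM; congr EFin; rewrite powRD; last by rewrite (gt_eqF x0) implybT.
    rewrite powR_mulrn ?(ltW x0)// divr1 mul1n; ring.
  rewrite ge0_integralZl_EFin//; last 3 first.
  - by move=> x _; rewrite lee_fin powR_ge0.
  - by apply/measurable_EFinP; apply: measurable_funTS; exact: measurable_powR.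
  - by rewrite ltW// binser_gt0.
  rewrite integral_powR//; last by lra.
  by rewrite -EFinM powR1 mul1r; congr (_ / _)%:E; rewrite addr0; lra.
under eq_eseriesr do rewrite tE.
exact: nneseries_EFin.
Qed.

Lemma euler_beta_gt0 : 0 < euler_beta (3 / 4) (3 / 4) :> R.
Proof.
have [B B0 hB] := cvg_beta_sum; rewrite (@euler_betaE B)//.
by have := hB 0%N; rewrite /beta_ratio big_ord0 mulr1.
Qed.

Lemma integral_brownian_kernels (m t : R) : 0 < m -> m <= t ->
  (\int[mu]_(x in `]0%R, m[) (x `^ (2^-1) * (m ^+ 2 - x ^+ 2) `^ (- 4^-1) *
     (t ^+ 2 - x ^+ 2) `^ (- 4^-1))%:E =
   (2^-1 * euler_beta (3 / 4) (3 / 4) * (Num.sqrt (t + m) - Num.sqrt (t - m)))%:E)%E.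
Proof.
move=> m0 mt; have t0 : 0 < t by exact: lt_le_trans mt.
have tn0 : t != 0 by rewrite gt_eqF.
have [B B0 hB] := cvg_beta_sum; rewrite (@euler_betaE B); last first.
  by have := hB 0%N; rewrite /beta_ratio big_ord0 mulr1.
pose V (x : R) := x `^ (2^-1) * (m ^+ 2 - x ^+ 2) `^ (- 4^-1).
pose W (x : R) := t `^ (- 2^-1) * V x.
have mV : measurable_fun setT V.
  apply: measurable_funM; first exact: measurable_powR.
  apply: (measurableT_comp (@measurable_powR R (- 4^-1))).
  by apply: measurable_funB => //; exact: measurable_funX.
have V0 x : 0 <= V x by rewrite mulr_ge0 ?powR_ge0.
transitivity (\int[mu]_(x in `]0%R, m[) (W x * (1 - (x / t) ^+ 2) `^ (- 4^-1))%:E)%E.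
  apply: eq_integral => x; rewrite inE/= in_itv/= => /andP[x0 xm]; congr EFin.
  have -> : t ^+ 2 - x ^+ 2 = t ^+ 2 * (1 - (x / t) ^+ 2) by field.
  have xm1 : x / t <= 1 by rewrite ler_pdivrMr// mul1r (le_trans (ltW xm)).
  rewrite [(t ^+ 2 * _) `^ _]powRM ?exprn_ge0 ?(ltW t0)//; last first.
    by rewrite subr_ge0 exprn_ile1// divr_ge0// ltW.
  rewrite -[t ^+ 2]powR_mulrn ?(ltW t0)// -powRrM.
  rewrite (_ : 2%:R * - 4^-1 = - 2^-1 :> R); last by lra.
  rewrite /W /V; ring.
rewrite integral_binser//; last 2 first.
- by apply: measurable_funTS; exact: measurable_funM.
- by move=> x _; rewrite mulr_ge0// powR_ge0.
have tE n : (\int[mu]_(x in `]0%R, m[) (W x * (a n * (x / t) ^+ (2 * n)))%:E =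
    (2^-1 * B * Num.sqrt t * (a n * w n * (m / t) ^+ n.*2.+1))%:E)%E.
  pose C := t `^ (- 2^-1) * a n / t ^+ n.*2.
  transitivity (\int[mu]_(x in `]0%R, m[) (C%:E *
     (x `^ (2^-1) * x ^+ n.*2 * (m ^+ 2 - x ^+ 2) `^ (- 4^-1))%:E))%E.
    apply: eq_integral => x _; rewrite -EFinM; congr EFin.
    rewrite /W /V /C mul2n expr_div_n; ring.
  rewrite ge0_integralZl_EFin//; last 3 first.
  - move=> x; rewrite /= in_itv/= => /andP[x0 _].
    by rewrite lee_fin !mulr_ge0 ?powR_ge0// exprn_ge0// ltW.
  - apply/measurable_EFinP; apply: measurable_funTS.
    rewrite (_ : (fun x => _) = (fun x => x ^+ n.*2 * V x)).
      by apply: measurable_funM => //; exact: measurable_funX.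
    by apply/funext => x; rewrite /V; ring.
  - by rewrite /C divr_ge0 ?exprn_ge0 ?(ltW t0)// mulr_ge0 ?powR_ge0// ltW// binser_gt0.
  rewrite (beta_ratio_integral (hB n))// -EFinM; congr EFin.
  have tk : t ^+ n.*2 != 0 by rewrite expf_neq0.
  have -> : Num.sqrt t = t * t `^ (- 2^-1).
    rewrite -powR12_sqrt ?(ltW t0)// -[X in X * _]powRr1 ?(ltW t0)// -powRD ?tn0 ?implybT//.
    by congr (_ `^ _); lra.
  rewrite /C expr_div_n !exprS; field; by rewrite tk.
under eq_eseriesr do rewrite tE.
(* The value 1 is attained when m = t, hence the series is used up to its end point. *)
have z01 : 0 <= m / t <= 1.
  by rewrite divr_ge0 ?(ltW m0) ?(ltW t0)//= ler_pdivrMr// mul1r.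
apply: nneseries_EFin.
under eq_fun do rewrite -mulr_sumr.
have -> : 2^-1 * B * (Num.sqrt (t + m) - Num.sqrt (t - m)) =
    2^-1 * B * Num.sqrt t * (Num.sqrt (1 + m / t) - Num.sqrt (1 - m / t)).
  rewrite -[RHS]mulrA; congr (_ * _); rewrite mulrBr -!sqrtrM ?(ltW t0)//.
  by congr (Num.sqrt _ - Num.sqrt _); field.
apply: cvgMr; exact: cvg_odd_series_le1.
Qed.

End brownian_covariance.

(** * The Brownian representation *)

Section step_approximation.
Context {R : realType} {d : measure_display} {T : measurableType d}.
Variables (P : probability T R) (b : R -> T -> R).
Local Notation mu := (@lebesgue_measure R).
Local Notation D := [set uv : R * R | 0 <= uv.1 <= uv.2].
Local Notation E := (fun uv : R * R => `]uv.1, uv.2]%classic).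
Local Notation M := (fun (uv : R * R) w => b uv.2 w - b uv.1 w).
Hypothesis b_gauss : centered_gaussian_process P `[0, +oo[%classic b.
Hypothesis b_cov : forall s t : R, 0 <= s -> 0 <= t ->
  'E_P[b s \* b t]%E = (Num.min s t)%:E.

Let inD0 (t : R) : 0 <= t -> `[0, +oo[%classic t.
Proof. by rewrite /= in_itv/= andbT. Qed.

Let mb t : 0 <= t -> measurable_fun setT (b t).
Proof. by move=> /inD0; exact: (centered_gaussian_process_mfun b_gauss). Qed.

Let b2 t : 0 <= t -> (msq P (b t) < +oo)%E.
Proof. by move=> /inD0; exact: (centered_gaussian_process_msq b_gauss). Qed.

Lemma process_increments : process D M.
Proof.
move=> [u v] /andP[/= u0 uv]; apply: measurable_funB; apply: mb => //.
exact: le_trans uv.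
Qed.

Lemma cgauss_increments Z : lin_span D M Z -> cgauss P Z.
Proof.
move=> sZ; apply: (cgauss_lin_span b_gauss); apply: sub_lin_span sZ.
move=> [u v] /andP[/= u0 uv]; have v0 := le_trans u0 uv.
have h := lin_spanD (lin_span_gen b (inD0 v0)) (lin_spanZ (-1) (lin_span_gen b (inD0 u0))).
by move: h; congr (lin_span _ _ _); apply/funext => w /=; rewrite mulN1r.
Qed.

Lemma lebesgue_itv_inter (u v u' v' : R) :
  mu (`]u, v]%classic `&` `]u', v']%classic) =
  (Num.max 0 (Num.min v v' - Num.max u u'))%:E.
Proof.
rewrite (_ : _ `&` _ = `]Num.max u u', Num.min v v']%classic); last first.
  apply/seteqP; split => x; rewrite /= !in_itv/= gt_max le_min.
    by move=> [/andP[-> ->] /andP[-> ->]].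
  by move=> /andP[/andP[-> ->] /andP[-> ->]].
rewrite lebesgue_measure_itv/= lte_fin; case: ltP => h.
  by rewrite -EFinB [Num.max 0 _]max_r// subr_ge0 ltW.
by rewrite [Num.max 0 _]max_l// subr_le0.
Qed.

Lemma increments_covariance i j : D i -> D j ->
  (\int[P]_w (M i w * M j w)%:E = mu (E i `&` E j))%E.
Proof.
move: i j => [u v] [u' v'] /andP[/= u0 uv] /andP[/= u0' uv'].
have v0 := le_trans u0 uv; have v0' := le_trans u0' uv'.
have ib s t : 0 <= s -> 0 <= t -> P.-integrable setT (fun w => (b s w * b t w)%:E).
  by move=> s0 t0; apply: integrable_mul; [exact: mb|exact: mb|exact: b2|exact: b2].
have Eb s t : 0 <= s -> 0 <= t -> (\int[P]_w (b s w * b t w)%:E = (Num.min s t)%:E)%E.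
  by move=> s0 t0; rewrite -b_cov// unlock.
rewrite lebesgue_itv_inter.
transitivity (\int[P]_w (((b v w * b v' w)%:E - (b v w * b u' w)%:E) -
    ((b u w * b v' w)%:E - (b u w * b u' w)%:E)))%E.
  by apply: eq_integral => w _; rewrite -!EFinB; congr EFin; ring.
rewrite integralB//; [|by apply: integrableB => //; exact: ib..].
rewrite !integralB//; [|exact: ib..].
rewrite !Eb// -!EFinB; congr EFin.
rewrite /Num.max /Num.min; do ![case: ltP => ?]; lra.
Qed.

Variables (f : R -> R) (t : R).
Hypothesis t0 : 0 < t.
Hypothesis f_out : forall x, ~~ (0 < x < t) -> f x = 0.
Hypothesis f_ge0 : forall x, 0 <= f x.
Hypothesis f_nd : forall x y, 0 < x -> x <= y -> y < t -> f x <= f y.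
Hypothesis f_cont : forall x, 0 < x < t -> {for x, continuous f}.
Hypothesis mf : measurable_fun setT f.
Hypothesis f2 : (msq mu f < +oo)%E.

Let u n k : R := t * k%:R / n.+1%:R.
(** Values at the left ends of the cells, which lie below a nondecreasing [f]. The last cell gets 0:
    it contains [t], where [f] vanishes, and a positive value there would break the bound by [f]. *)
Let c n k : R := if (k < n)%N then f (u n k) else 0.
Let f_ n (x : R) : R := \sum_(k < n.+1) c n k * \1_(E (u n k, u n k.+1)) x.

Let u0 n : u n 0 = 0. Proof. by rewrite /u mulr0 mul0r. Qed.

Let u1 n : u n n.+1 = t. Proof. by rewrite /u mulfK. Qed.

Let uS n k : u n k.+1 = u n k + t / n.+1%:R.
Proof. by rewrite /u -[k.+1%:R]natr1; field. Qed.

Let u_le n k l : (k <= l)%N -> u n k <= u n l.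
Proof. by move=> kl; rewrite /u ler_pM2r ?invr_gt0// ler_pM2l// ler_nat. Qed.

Let f_in n k x : (k < n.+1)%N -> u n k < x <= u n k.+1 -> f_ n x = c n k.
Proof.
move=> kn /andP[kx xk]; rewrite /f_ (bigD1 (Ordinal kn))//= big1 ?addr0.
  by rewrite indicE mem_set ?mulr1//= in_itv/= kx.
move=> l /eqP/val_eqP/= lk; rewrite indicE memNset ?mulr0//= in_itv/= => /andP[lx xl].
case: (ltngtP l k) lk => // h _.
  by have := le_lt_trans (u_le n h) kx; rewrite ltNge xl.
by have := le_lt_trans (u_le n h) lx; rewrite ltNge xk.
Qed.

Let f_notin n x : ~~ (0 < x <= t) -> f_ n x = 0.
Proof.
move=> h; rewrite /f_ big1// => k _; rewrite indicE memNset ?mulr0//= in_itv/=.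
move=> /andP[kx xk]; case/negP: h; apply/andP; split.
  by apply: le_lt_trans kx; rewrite -(u0 n) u_le.
by apply: (le_trans xk); rewrite -(u1 n) u_le.
Qed.

Let cell n x : 0 < x <= t -> exists2 k, (k < n.+1)%N & u n k < x <= u n k.+1.
Proof.
move=> /andP[x0 xt].
have ex : exists k, x <= u n k by exists n.+1; rewrite u1.
case: (ex_minnP ex) => -[|k] xk kmin; first by have := lt_le_trans x0 xk; rewrite u0 ltxx.
exists k; first by apply: kmin; rewrite u1.
by rewrite xk andbT ltNge; apply/negP => /kmin; rewrite ltnn.
Qed.

Let f_le n x : 0 <= f_ n x <= f x.
Proof.
have [/cell-/(_ n)[k kn kx]|/f_notin->] := boolP (0 < x <= t); last by rewrite lexx f_ge0.
rewrite (f_in kn kx) /c; case: ifPn => [kn'|_]; last by rewrite lexx f_ge0.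
rewrite f_ge0/=; case/andP: kx => kx xk.
have xt : x < t.
  apply: (le_lt_trans xk); rewrite -(u1 n).
  apply: (le_lt_trans (u_le n kn')); rewrite uS ltrDl divr_gt0//.
case: k {kn kn' xk} kx => [|k] kx; first by rewrite u0 f_out ?ltxx.
apply: f_nd => //; last exact: ltW.
by rewrite /u divr_gt0// mulr_gt0.
Qed.

Let f_cvg x : f_ n x @[n --> \oo] --> f x.
Proof.
have [x0t|/f_out fx0] := boolP (0 < x < t); last first.
  rewrite fx0 (_ : (fun n => _) = cst 0); first exact: cvg_cst.
  by apply/funext => n; apply/eqP; rewrite eq_le -{1}fx0 andbC; exact: f_le.
apply/cvgrPdist_lt => e e0.
have /cvgrPdist_lt/(_ e e0) := f_cont x0t.
rewrite -nbhs_nearE => /nbhs_ballP[dl /= dl0 hdl].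
case/andP: x0t => x0 xt.
have tn : t / n.+1%:R @[n --> \oo] --> (0 : R).
  by rewrite -(mulr0 t); apply: cvgMr; exact: cvg_harmonic.
have m0 : 0 < Num.min dl (t - x) by rewrite lt_min dl0 subr_gt0.
(* A mesh smaller than t - x keeps x out of the last cell, and a mesh smaller than dl puts the left
   end of its cell within reach of continuity. *)
near=> n; have tn0 : 0 < t / n.+1%:R by rewrite divr_gt0.
have : `|t / n.+1%:R| < Num.min dl (t - x) by near: n; exact: cvgr0_norm_lt.
rewrite gtr0_norm// lt_min => /andP[n1 n2].
have [|k kn /[dup] kx /andP[k1 k2]] := @cell n x; first by rewrite x0 ltW.
rewrite (f_in kn kx) /c ifT; last first.
  rewrite ltn_neqAle -ltnS kn andbT; apply/eqP => kE; move: k1.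
  rewrite kE => k1; have := uS n n; rewrite u1.
  by move: n2 k1; set z := t / _; set y := u n n => ? ? ?; lra.
apply: hdl; rewrite /ball/=; move: k1 k2 n1; rewrite uS.
set z := t / _; set y := u n k => ? ? ?; rewrite ger0_norm; lra.
Unshelve. all: by end_near. Qed.

(** The integrator is known on intervals only, so level sets do not serve as integrands;
    monotonicity gives step functions that stay between 0 and [f], and the square-integrable [f]
    dominates them up to its singularity at [t]. *)
Lemma monotone_wiener_integral_exists :
  exists Y, is_wiener_integral P mu D E M f Y.
Proof.
have mE i : D i -> measurable (E i) by move=> _; exact: measurable_itv.
have E_fin i : D i -> (mu (E i) < +oo)%E.
  by move=> _; rewrite /= lebesgue_measure_itv/=; case: ifP => _; rewrite ?ltry// -EFinB ltry.
have elem_ n : exists Y, elementary_integral D E M (f_ n) Y.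
  apply: elementary_sum => k; exists (fun w => c n k * M (u n k, u n k.+1) w).
  apply: elementary_integralZ; apply: elementary_indic => /=.
  by rewrite u_le// andbT -(u0 n) u_le.
have [Y_ hY] := choice elem_.
apply: (@is_wiener_integral_exists _ _ _ _ _ P mu _ D E M process_increments mE E_fin
  cgauss_increments increments_covariance f f_ Y_) => //.
apply: Lnorm2_dominated => //.
by move=> n; have [] := measurable_elementary process_increments mE (hY n).
Qed.

End step_approximation.

Section brownian_representation.
Context {R : realType}.
Local Notation mu := (@lebesgue_measure R).

Definition brownian_kernel (t s : R) : R :=
  if 0 < s < t then s `^ (4^-1) / (t ^+ 2 - s ^+ 2) `^ (4^-1) else 0.

Let B : R := euler_beta (3 / 4) (3 / 4).

Lemma brownian_kernel_ge0 t s : 0 <= brownian_kernel t s.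
Proof. by rewrite /brownian_kernel; case: ifP => // _; rewrite divr_ge0 ?powR_ge0. Qed.

Lemma brownian_kernel_out t s : ~~ (0 < s < t) -> brownian_kernel t s = 0.
Proof. by rewrite /brownian_kernel => /negbTE ->. Qed.

Let sqrB_gt0 (t s : R) : 0 < s < t -> 0 < t ^+ 2 - s ^+ 2.
Proof.
move=> /andP[s0 st]; rewrite subr_gt0 ltrXn2r// ?nnegrE ?ltW//.
Qed.

Lemma measurable_brownian_kernel t : measurable_fun setT (brownian_kernel t).
Proof.
rewrite (_ : brownian_kernel t = fun s => if (0 < s) && (s < t) then
    s `^ (4^-1) * (t ^+ 2 - s ^+ 2) `^ (- 4^-1) else 0); last first.
  by apply/funext => s; rewrite /brownian_kernel; case: ifP => // _; rewrite powRN.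
apply: measurable_fun_ifT => //.
  by apply: measurable_and; exact: measurable_fun_ltr.
apply: measurable_funM; first exact: measurable_powR.
apply: (measurableT_comp (@measurable_powR R (- 4^-1))).
by apply: measurable_funB => //; exact: measurable_funX.
Qed.

Lemma brownian_kernel_nd t x y : 0 < x -> x <= y -> y < t ->
  brownian_kernel t x <= brownian_kernel t y.
Proof.
move=> x0 xy yt; have y0 := lt_le_trans x0 xy; have xt := le_lt_trans xy yt.
rewrite /brownian_kernel x0 xt y0 yt /=.
have px : 0 < t ^+ 2 - x ^+ 2 by apply: sqrB_gt0; rewrite x0.
have py : 0 < t ^+ 2 - y ^+ 2 by apply: sqrB_gt0; rewrite y0.
apply: ler_pM; rewrite ?invr_ge0 ?powR_ge0//.
  by apply: ge0_ler_powR => //; rewrite nnegrE ltW.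
rewrite lef_pV2 ?posrE ?powR_gt0//; apply: ge0_ler_powR; rewrite ?nnegrE ?(ltW px) ?(ltW py)//.
by rewrite lerD2l lerN2 lerXn2r// nnegrE ltW.
Qed.

Lemma continuous_brownian_kernel t x : 0 < x < t ->
  {for x, continuous (brownian_kernel t)}.
Proof.
move=> x0t; have cp (p y : R) : 0 < y -> {for y, continuous (fun y : R => y `^ p)}.
  move=> y0; apply/differentiable_continuous/derivable1_diffP.
  by have [] := is_derive1_powR p y0.
have p0 := sqrB_gt0 x0t.
have h : {for x, continuous (fun s : R => s `^ (4^-1) / (t ^+ 2 - s ^+ 2) `^ (4^-1))}.
  apply: cvgM; first by apply: cp; case/andP: x0t.
  apply: cvgV; first by rewrite gt_eqF// powR_gt0.
  have hc : {for x, continuous (fun s : R => t ^+ 2 - s ^+ 2)}.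
    by apply: cvgB; [exact: cvg_cst|exact: exprn_continuous].
  exact: (@continuous_comp _ _ _ _ (fun y : R => y `^ (4^-1)) x hc (cp _ _ p0)).
have e : brownian_kernel t x = x `^ (4^-1) / (t ^+ 2 - x ^+ 2) `^ (4^-1).
  by rewrite /brownian_kernel x0t.
suff : brownian_kernel t y @[y --> x] --> brownian_kernel t x by [].
rewrite e; apply: cvg_trans h; apply: near_eq_cvg.
near=> s; rewrite /brownian_kernel ifT//.
have : s \in `]0, t[ by near: s; apply: near_in_itvoo; rewrite in_itv.
by rewrite in_itv.
Unshelve. all: by end_near. Qed.

Lemma brownian_kernel_covariance s t : 0 <= s -> 0 <= t ->
  (\int[mu]_x (brownian_kernel s x * brownian_kernel t x)%:E =
   (2^-1 * B * rcov s t)%:E)%E.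
Proof.
wlog st : s t / s <= t => [h s0 t0|].
  have [st|/ltW ts] := leP s t; first exact: h.
  by rewrite rcovC -(h t s ts t0 s0); apply: eq_integral => x _; rewrite mulrC.
move=> s0 t0; rewrite /rcov distrC (ger0_norm (_ : 0 <= t - s)) ?subr_ge0// [s + t]addrC.
move: s0; rewrite le_eqVlt => /predU1P[<-|s0].
  rewrite addr0 subr0 subrr mulr0 integral0_eq// => x _.
  by rewrite brownian_kernel_out ?mul0r//; apply/negP => /andP[/lt_trans/[apply]]; rewrite ltxx.
rewrite -integral_brownian_kernels// [RHS]integral_mkcond; apply: eq_integral => x _.
rewrite /patch mem_setE in_itv/=; case: ifPn => [|xs]; last first.
  by rewrite brownian_kernel_out// mul0r.
move=> /andP[x0 xs]; congr EFin; rewrite /brownian_kernel x0 xs (lt_le_trans xs st)/=.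
have -> : x `^ (2^-1) = x `^ (4^-1) * x `^ (4^-1).
  by rewrite -powRD ?(gt_eqF x0) ?implybT//; congr (_ `^ _); lra.
rewrite !powRN; ring.
Qed.

Theorem brownian_r d (T : measurableType d) (P : probability T R) (r : R -> T -> R)
    (r_gauss : centered_gaussian_process P `[0, +oo[%classic r)
    (r_cov : forall t t' : R, 0 <= t' -> t' <= t ->
       'E_P[r t \* r t']%E = (Num.sqrt (t + t') - Num.sqrt (t - t'))%:E)
    d3 (T3 : measurableType d3) (P3 : probability T3 R) (b : R -> T3 -> R) :
  standard_brownian_motion P3 b ->
  equal_in_law `[0, +oo[%classic P r
    P3 (fun (t : R) w => (2^-1 * B) `^ (- 2^-1) *
      brownian_integral P3 b (brownian_kernel t) w).
Proof.
move=> [gb covb _].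
have D0 (t : R) : `[0, +oo[%classic t -> 0 <= t by rewrite /= in_itv/= andbT.
have B0 : 0 < 2^-1 * B by rewrite mulr_gt0// euler_beta_gt0.
have cc : (2^-1 * B) `^ (- 2^-1) * (2^-1 * B) `^ (- 2^-1) = (2^-1 * B)^-1.
  rewrite -powRD ?(gt_eqF B0) ?implybT// -[RHS]powR_inv1 ?(ltW B0)//.
  by congr (_ `^ _); lra.
have mE (i : R * R) : measurable (`]i.1, i.2]%classic : set R) by exact: measurable_itv.
have E_fin (i : R * R) : (mu `]i.1, i.2]%classic < +oo)%E.
  by rewrite /= lebesgue_measure_itv/=; case: ifP => _; rewrite ?ltry// -EFinB ltry.
have mM := process_increments gb.
apply: (@eq_in_law_wiener _ _ _ _ (measurableTypeR R) _ mu _ _ _ _ mM (fun i _ => mE i) (fun i _ => E_fin i)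
  (cgauss_increments gb) (increments_covariance gb covb)
  R `[0, +oo[%classic _ _ P r _ brownian_kernel r_gauss).
(* Time 0 is separate because the partition of [0, t] needs t > 0; there the kernel is identically
   0. *)
- move=> t /D0; rewrite le_eqVlt => /predU1P[<-|t0].
    exists (fun=> 0); rewrite (_ : brownian_kernel 0 = fun=> 0).
      exact: is_wiener_integral0.
    apply/funext => x; apply: brownian_kernel_out.
    by apply/negP => /andP[/lt_trans/[apply]]; rewrite ltxx.
  apply: (monotone_wiener_integral_exists gb covb t0).
  + exact: brownian_kernel_out.
  + exact: brownian_kernel_ge0.
  + exact: brownian_kernel_nd.
  + exact: continuous_brownian_kernel.
  + exact: measurable_brownian_kernel.
  + rewrite /msq (_ : (fun z => _) = (fun z => (brownian_kernel t z * brownian_kernel t z)%:E)).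
      by rewrite brownian_kernel_covariance ?ltry// ltW.
    by apply/funext => z; rewrite expr2.
move=> s t /D0 s0 /D0 t0; rewrite (rcovE r_cov)//.
rewrite (_ : (fun z => _) = (fun z => ((2^-1 * B)^-1)%:E *
  (brownian_kernel s z * brownian_kernel t z)%:E)%E); last first.
  by apply/funext => z; rewrite mulrACA cc EFinM.
rewrite ge0_integralZl_EFin//; last 3 first.
- by move=> z _; rewrite lee_fin mulr_ge0// brownian_kernel_ge0.
- by apply/measurable_EFinP; apply: measurable_funM; exact: measurable_brownian_kernel.
- by rewrite invr_ge0 ltW.
by rewrite brownian_kernel_covariance// -EFinM mulKf// gt_eqF.
Qed.

End brownian_representation.

Theorem theorem2p2 (R : realType) (d : measure_display) (T : measurableType d)
  (P : probability T R) (r : R -> T -> R)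
  (r_gauss : centered_gaussian_process P `[0, +oo[%classic r)
  (r_cov : forall t t' : R, 0 <= t' -> t' <= t ->
     'E_P[r t \* r t']%E = (Num.sqrt (t + t') - Num.sqrt (t - t'))%:E) :
  has_continuous_modification P `[0, +oo[%classic r /\
  self_similar P (4^-1) r /\
  (forall (d1 : measure_display) (T1 : measurableType d1)
     (P1 : probability T1 R) (nu : R -> T1 -> R),
     two_sided_fbm P1 (4^-1) nu ->
     equal_in_law `[0, +oo[%classic P r P1 (fun (t : R) w => 2 * odd_part nu t w)) /\
  (forall (d2 : measure_display) (T2 : measurableType d2)
     (P2 : probability T2 R) (W : set (space_time R) -> T2 -> R),
     space_time_white_noise P2 W ->
     equal_in_law `[0, +oo[%classic P r
       P2 (fun (t : R) w => (2 * pi) `^ (4^-1) * mild_solution P2 W 0 t w)) /\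
  (forall (d3 : measure_display) (T3 : measurableType d3)
     (P3 : probability T3 R) (b : R -> T3 -> R),
     standard_brownian_motion P3 b ->
     let c : R := (2^-1 * euler_beta (3 / 4) (3 / 4)) `^ (- 2^-1) in
     equal_in_law `[0, +oo[%classic P r
       P3 (fun (t : R) w => c * brownian_integral P3 b
             (fun s => if 0 < s < t
                       then s `^ (4^-1) / (t ^+ 2 - s ^+ 2) `^ (4^-1)
                       else 0) w)).
Proof.
split; first exact: continuous_r.
split; first exact: self_similar_r.
split; first by move=> d1 T1 P1 nu; exact: fbm_r.
split; first by move=> d2 T2 P2 W; exact: heat_r.
by move=> d3 T3 P3 b; exact: brownian_r.
Qed.
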